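(* Let $\varphi:\mathbb{D}\to\mathbb{D}$ be such that $\varphi\in\mathcal{D}$. Then: (a) if $\displaystyle\sup_{n\ge1}\mathcal{D}(\varphi^n)<\infty$, then $C_\varphi$ is bounded on $\mathcal{D}$; (b) if $\displaystyle\lim_{n\to\infty}\mathcal{D}(\varphi^n)=0$, then $C_\varphi$ is compact on $\mathcal{D}$.
   Context: $\mathbb{D}$ is the open unit disc in $\mathbb{C}$. The Dirichlet space $\mathcal{D}$ consists of the holomorphic functions $f$ on $\mathbb{D}$ whose Dirichlet integral $\mathcal{D}(f)=\int_{\mathbb{D}}|f'(z)|^2\,dA(z)$ is finite, where $dA=dx\,dy/\pi$, with norm $\|f\|_{\mathcal{D}}^2=|f(0)|^2+\mathcal{D}(f)$. The composition operator is $C_\varphi(f)=f\circ\varphi$. Here $\varphi^n$ denotes the $n$-th power (pointwise product), not the iterate. *)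

(* Defs.v *)
From HB Require Import structures.
From mathcomp Require Import all_boot all_order all_algebra.
From mathcomp Require Import all_classical all_reals all_analysis.
From mathcomp.real_closed Require Import complex.

Set Implicit Arguments.
Unset Strict Implicit.
Unset Printing Implicit Defensive.

Import Order.TTheory GRing.Theory Num.Theory.
Import numFieldNormedType.Exports.

Local Open Scope classical_set_scope.
Local Open Scope ring_scope.
Local Open Scope complex_scope.

Definition unit_disc {R : realType} : set R[i] := [set z | `|z| < 1].

(* Functions on the disc are represented by total functions [R[i] -> R[i]];
   every notion below depends only on their values on the disc. *)
(* [R[i]^o] makes [R[i]] a normed module over the scalar field [R[i]], so that
   [derivable] and [derive1] are complex differentiation. *)
Definition holomorphic_on_disc (R : realType) (f : R[i] -> R[i]) : Prop :=
  forall z : R[i], unit_disc z -> derivable (f : R[i]^o -> R[i]^o) z 1.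

Definition plane_measure {R : realType} :=
  (@lebesgue_measure R \x @lebesgue_measure R)%E.

Definition dirichlet_integral (R : realType) (f : R[i] -> R[i]) : \bar R :=
  ((pi : R)^-1%:E *
   \int[plane_measure]_(p in [set p : R * R | unit_disc (p.1 +i* p.2)])
     (Normc.normc (derive1 (f : R[i]^o -> R[i]^o) (p.1 +i* p.2)) ^+ 2)%:E)%E.

Definition dirichlet_space {R : realType} : set (R[i] -> R[i]) :=
  [set f | holomorphic_on_disc f /\ (dirichlet_integral f < +oo)%E].

(* On [dirichlet_space] the Dirichlet integral is finite, so [fine] is
   harmless there. *)
Definition dirichlet_norm (R : realType) (f : R[i] -> R[i]) : R :=
  Num.sqrt (Normc.normc (f 0) ^+ 2 + fine (dirichlet_integral f)).

Definition composition_operator (R : realType) (phi : R[i] -> R[i])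
  (f : R[i] -> R[i]) : R[i] -> R[i] := f \o phi.

Definition bounded_on_dirichlet (R : realType)
    (T : (R[i] -> R[i]) -> (R[i] -> R[i])) : Prop :=
  (forall f, dirichlet_space f -> dirichlet_space (T f)) /\
  exists M : R, forall f, dirichlet_space f ->
    dirichlet_norm (T f) <= M * dirichlet_norm f.

Definition compact_on_dirichlet (R : realType)
    (T : (R[i] -> R[i]) -> (R[i] -> R[i])) : Prop :=
  (forall f, dirichlet_space f -> dirichlet_space (T f)) /\
  forall f : nat -> (R[i] -> R[i]),
    (forall n, dirichlet_space (f n)) ->
    (exists M : R, forall n, dirichlet_norm (f n) <= M) ->
    exists (k : nat -> nat) (g : R[i] -> R[i]),
      [/\ {homo k : m n / (m < n)%N}, dirichlet_space g &
          dirichlet_norm (T (f (k n)) \- g) @[n --> \oo] --> (0 : R)].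

(* Main.v *)
Require Import Defs.
From HB Require Import structures.
From mathcomp Require Import all_boot all_order all_algebra.
From mathcomp Require Import all_classical all_reals all_analysis.
From mathcomp.real_closed Require Import complex.
From mathcomp Require Import measurable_realfun.
From mathcomp Require Import ring lra.

(** Both parts reduce to one nonnegative function on the disc, the kernel
    [carleson_kernel].  For f holomorphic on the disc, |f' w|^2 is at most a
    constant over (1 - |w|)^2 times the integral of |f'|^2 over the disc of
    centre w and radius (1 - |w|) / 2 ([bergman_point]).  Putting w = phi z,
    multiplying by |phi' z|^2, integrating over z and exchanging the two
    integrals by Tonelli's theorem gives ([area_comp_kernel])

      int |(f o phi)'|^2  <=  int |f' q|^2 K q dq,

    where K q is the integral of 128 |phi' z|^2 / (1 - |phi z|)^2 over the z
    with |q - phi z| <= (1 - |phi z|) / 2.  For such z the numbers 1 - |phi z|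
    and d = 1 - |q| are comparable.  If n is the integer just above 1 / (8 d),
    then |phi z|^(n - 1) is bounded below and n is at least a multiple of
    1 / (1 - |phi z|), so the integrand is at most a constant times
    |n phi^(n-1) phi'|^2 = |(phi^n)'|^2.  Hence K q <= 192^2 int |(phi^n)'|^2
    with an n that tends to infinity as |q| tends to 1
    ([carleson_kernel_le_pow]).

    If the Dirichlet integrals of the powers of phi are bounded, K is bounded,
    and so is the composition operator for the Dirichlet seminorm; the value
    at 0 is controlled by the growth of Dirichlet functions
    ([bounded_composition]).  If they tend to 0, K tends to 0 at the unit
    circle ([carleson_kernel_tail]).  A sequence f_n bounded in the Dirichlet
    space then converges pointwise along an ultrafilter beyond every index;
    Taylor bounds uniform in n make the limit holomorphic, with derivative the
    limit of the f_n', and make the convergence of the f_n' uniform on every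
    disc of radius less than 1.  The limit has a finite Dirichlet integral.
    After composition with phi the distance to the limit tends to 0: the
    kernel estimate is cut at a radius beyond which K is small and below which
    f_n' is uniformly close to its limit ([compact_composition]).

    The function theory rests on Goursat's theorem, applied to contour
    integrals over squares.  The sides of squares are segments, which keeps
    integrals along paths elementary, and squares of varying size sweep out
    the plane by parallel lines, which turns Cauchy's formula into a mean
    value inequality for area integrals ([area_submean]).  The integral of
    f z / (z - w) dz over a square of centre w does not depend on its size;
    this yields Cauchy's formulas for f and f', Cauchy's estimate, and the
    differentiability of f'.  Constants are not optimised anywhere. *)

Set Implicit Arguments.
Unset Strict Implicit.
Unset Printing Implicit Defensive.
Import Order.TTheory GRing.Theory Num.Theory.
Import numFieldNormedType.Exports.
Local Open Scope classical_set_scope.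
Local Open Scope ring_scope.
Local Open Scope complex_scope.
Local Notation N := (@Normc.normc _).
Local Notation cRe := (@complex.Re _).
Local Notation cIm := (@complex.Im _).

(** * The complex modulus and complex derivatives *)

Section ComplexNorm.
Variable R : realType.
Implicit Types (z w : R[i]) (x y : R).

Lemma normrE z : `|z| = (N z)%:C.
Proof. by []. Qed.

Lemma N_ge0 z : 0 <= N z.
Proof. by case: z => a b; rewrite sqrtr_ge0. Qed.

Lemma N_sqr z : N z ^+ 2 = cRe z ^+ 2 + cIm z ^+ 2.
Proof. by case: z => a b /=; rewrite sqr_sqrtr// addr_ge0 ?sqr_ge0. Qed.

Lemma Re_le_N z : `|cRe z| <= N z.
Proof.
rewrite -(@ler_pXn2r _ 2)// ?nnegrE ?N_ge0//.
by rewrite N_sqr real_normK ?num_real// lerDl sqr_ge0.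
Qed.

Lemma Im_le_N z : `|cIm z| <= N z.
Proof.
rewrite -(@ler_pXn2r _ 2)// ?nnegrE ?N_ge0//.
by rewrite N_sqr real_normK ?num_real// lerDr sqr_ge0.
Qed.

Lemma N_real x : N (x%:C) = `|x|.
Proof. by rewrite /= expr0n addr0 sqrtr_sqr. Qed.

Lemma N_triangle z w : N (z + w) <= N z + N w.
Proof. exact: le_normcD. Qed.

Lemma N_le_ReIm z : N z <= `|cRe z| + `|cIm z|.
Proof.
rewrite -(@ler_pXn2r _ 2)// ?nnegrE ?N_ge0 ?addr_ge0//.
rewrite N_sqr sqrrD !real_normK ?num_real// -addrA lerD2l lerDr.
by rewrite mulrn_wge0// mulr_ge0.
Qed.

Lemma N_realM x z : 0 <= x -> N (x%:C * z) = x * N z.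
Proof. by move=> x0; rewrite Normc.normcM N_real ger0_norm. Qed.

Lemma N_nat n : N (n%:R : R[i]) = n%:R.
Proof. by rewrite -(rmorph_nat (real_complex R)) N_real ger0_norm. Qed.

Lemma N_exp z n : N (z ^+ n) = N z ^+ n.
Proof.
elim: n => [|n IH]; first by rewrite !expr0 Normc.normc1.
by rewrite !exprS Normc.normcM IH.
Qed.

End ComplexNorm.

Section ComplexCalculus.
Variable R : realType.
Local Notation C := (R[i]^o).
Implicit Types (f g : C -> C) (z w d : C).

Lemma N_lt_real z (e : R) : (`|z| < e%:C) = (N z < e).
Proof. by rewrite normrE ltcR. Qed.

Lemma N_distC z w : N (z - w) = N (w - z).
Proof. by rewrite -normcN opprB. Qed.

Lemma nbhs_N z (P : set C) :
  nbhs z P <-> exists2 e : R, 0 < e & forall y, N (y - z) < e -> P y.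
Proof.
split=> [/nbhs_ballP[e /= e0 zP]|[e e0 zP]].
  have [er ei] : 0 < cRe e /\ cIm e = 0.
    by move: e0; rewrite ltcE/= => /andP[/eqP -> ->].
  exists (cRe e) => // y yz; apply: zP; rewrite -ball_normE /ball_ /=.
  by rewrite (complexE e) ei mulr0 addr0 N_lt_real N_distC.
apply/nbhs_ballP; exists (e%:C) => /=; first by rewrite ltcR.
by move=> y; rewrite -ball_normE /ball_ /= N_lt_real N_distC; exact: zP.
Qed.

Lemma cvgN_le {T : Type} (F : set_system T) (FF : Filter F) (u : T -> C) z :
  u @ F --> z <-> forall e : R, 0 < e -> \forall t \near F, N (u t - z) <= e.
Proof.
split=> [uz e e0|H].
  have : nbhs z [set y | N (y - z) <= e].
    by apply/nbhs_N; exists e => // y /ltW.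
  exact: uz.
apply/cvg_ballP => e; rewrite ltcE/= => /andP[/eqP ei er].
rewrite (complexE e) ei mulr0 addr0.
near=> t; rewrite -ball_normE /ball_ /= N_lt_real N_distC.
rewrite (@le_lt_trans _ _ (cRe e / 2))//; last by rewrite ltr_pdivrMr// mulr_natr mulr2n ltrDl.
by near: t; apply: H; rewrite divr_gt0.
Unshelve. all: by end_near. Qed.

(** Differentiability without a quotient: compositions, restrictions to lines
    and limits of families of functions are estimated in this form. *)
Lemma is_derive_eps f z d : is_derive z 1 f d <->
  forall e : R, 0 < e -> exists2 dl : R, 0 < dl &
    forall h, N h < dl -> N (f (z + h) - f z - d * h) <= e * N h.
Proof.
split=> [[df <-] e e0|H].
  move: df => /cvg_ex[l lP].
  have dl : 'D_1 f z = l by exact/cvg_lim.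
  rewrite dl; move: lP => /cvgN_le /(_ _ e0).
  rewrite near_withinE => /nbhs_N[dl0 dl00 HH]; exists dl0 => // h hdl.
  have [->|h0] := eqVneq h 0; first by rewrite addr0 subrr mulr0 subr0 Normc.normc0 mulr0.
  have := HH h; rewrite subr0 => /(_ hdl h0); rewrite /= => Hh.
  have -> : f (z + h) - f z - l * h = (h^-1 *: (f (h *: 1 + z) - f z) - l) * h.
    by rewrite mulrBl [X in _ = X - _]mulrC /GRing.scale/= mulrA mulfV// mul1r mulr1 (addrC h).
  by rewrite Normc.normcM ler_wpM2r ?N_ge0.
suff : (fun h : C => h^-1 *: (f (h *: 1 + z) - f z)) @ 0^' --> d.
  by move=> Hl; split; [apply/cvg_ex; exists d|exact/cvg_lim].
apply/cvgN_le => e e0; have [dl dl0 Hdl] := H _ e0.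
rewrite near_withinE; apply/nbhs_N; exists dl => // h; rewrite subr0 => hdl h0.
have := Hdl _ hdl.
have -> : f (z + h) - f z - d * h = (h^-1 *: (f (h *: 1 + z) - f z) - d) * h.
  by rewrite mulrBl [X in _ = X - _]mulrC /GRing.scale/= mulrA mulfV// mul1r mulr1 (addrC h).
rewrite Normc.normcM ler_pM2r// lt_neqAle N_ge0 andbT eq_sym.
by apply: contra h0 => /eqP/Normc.eq0_normc ->.
Qed.

Lemma is_derive_continuous f z d : is_derive z 1 f d -> {for z, continuous f}.
Proof.
by move=> [df _]; apply: differentiable_continuous; apply/derivable1_diffP.
Qed.

Lemma derivable_is_derive1 f z : derivable f z 1 -> is_derive z 1 f (derive1 f z).
Proof. by move=> /derivableP; rewrite derive1E. Qed.

Lemma is_derive1E f z d : is_derive z 1 f d -> derivable f z 1 /\ derive1 f z = d.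
Proof. by move=> [df <-]; rewrite derive1E. Qed.

Lemma continuous_real_complex : continuous (fun t : R => t%:C : C).
Proof.
move=> t; apply/cvgN_le => e e0; near=> s.
rewrite -(rmorphB (@real_complex_def R (Phant R))) N_real; near: s.
by apply: cvgr_distC_le => //; exact: cvg_id.
Unshelve. all: by end_near. Qed.

Lemma continuous_Re : continuous (cRe : C -> R).
Proof.
move=> z; apply/(@cvgrPdist_le _ _ _ (nbhs (z : C)) (nbhs_filter (z : C))) => e e0.
apply/nbhs_N; exists e => // y /ltW yz.
rewrite distrC; apply: le_trans yz.
by rewrite (le_trans _ (Re_le_N _))//; case: y z => ? ? [].
Qed.

Lemma continuous_Im : continuous (cIm : C -> R).
Proof.
move=> z; apply/(@cvgrPdist_le _ _ _ (nbhs (z : C)) (nbhs_filter (z : C))) => e e0.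
apply/nbhs_N; exists e => // y /ltW yz.
rewrite distrC; apply: le_trans yz.
by rewrite (le_trans _ (Im_le_N _))//; case: y z => ? ? [].
Qed.

Lemma continuous_N : continuous (N : C -> R).
Proof.
move=> z; apply/(@cvgrPdist_le _ _ _ (nbhs (z : C)) (nbhs_filter (z : C))) => e e0.
apply/nbhs_N; exists e => // y /ltW yz.
apply: le_trans yz; rewrite ler_norml; apply/andP; split.
  by rewrite lerNl opprB lerBlDr (le_trans _ (N_triangle _ _))// subrK.
by rewrite N_distC lerBlDr (le_trans _ (N_triangle _ _))// subrK.
Qed.

End ComplexCalculus.

(** * Complex-valued integrals over the unit interval *)

Section ComplexIntegral.
Variable R : realType.
Local Notation C := (R[i]^o).
Local Notation mu := (@lebesgue_measure R).
Implicit Types (F G : R -> C).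

(** Two-sided continuity, also at 0 and 1: the paths below are restrictions
    of functions of a real variable, and this form is stable by composition. *)
Definition pcont F := forall t : R, 0 <= t <= 1 -> {for t, continuous F}.

Definition cint F : C :=
  (\int[mu]_(t in `[0, 1]) cRe (F t)) +i* (\int[mu]_(t in `[0, 1]) cIm (F t)).

Lemma pcont_comp (h : C -> R) F : continuous h -> pcont F ->
  {within `[0, 1], continuous (h \o F)}.
Proof.
move=> ch cF; apply/continuous_in_subspaceT => t; rewrite inE/= in_itv/= => t01.
by apply: continuous_comp; [exact: cF|exact: ch].
Qed.

Lemma cont01_integrable (f : R -> R) : {within `[0, 1], continuous f} ->
  mu.-integrable `[0, 1] (EFin \o f).
Proof.
move=> cf; apply: continuous_compact_integrable => //.
exact: segment_compact.
Qed.

Lemma pcont_integrable (h : C -> R) F : continuous h -> pcont F ->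
  mu.-integrable `[0, 1] (EFin \o (h \o F)).
Proof. by move=> ch cF; apply: cont01_integrable; exact: pcont_comp. Qed.

Let iRe F := fun cF => @pcont_integrable _ F (@continuous_Re R) cF.
Let iIm F := fun cF => @pcont_integrable _ F (@continuous_Im R) cF.

Lemma eq_cint F G : (forall t, 0 <= t <= 1 -> F t = G t) -> cint F = cint G.
Proof.
by move=> FG; congr (_ +i* _); apply: eq_Rintegral => t; rewrite inE/= in_itv/= => ?;
  rewrite FG.
Qed.

Lemma cintD F G : pcont F -> pcont G ->
  cint (fun t => F t + G t) = cint F + cint G.
Proof.
move=> cF cG; rewrite /cint /=; congr (_ +i* _).
  rewrite -RintegralD//; [|exact: iRe|exact: iRe].
  by apply: eq_Rintegral => t _; case: (F t) => ? ?; case: (G t).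
rewrite -RintegralD//; [|exact: iIm|exact: iIm].
by apply: eq_Rintegral => t _; case: (F t) => ? ?; case: (G t).
Qed.

Lemma integrable01Zl (k : R) (f : R -> R) : mu.-integrable `[0, 1] (EFin \o f) ->
  mu.-integrable `[0, 1] (EFin \o (fun x => k * f x)).
Proof.
move=> h; have := @integrableZl _ _ _ mu `[0,1]%classic (measurable_itv _) k (EFin \o f) h.
by apply: eq_integrable.
Qed.

Lemma cintZ (c : C) F : pcont F -> cint (fun t => c * F t) = c * cint F.
Proof.
move=> cF; rewrite /cint; case: c => a b /=; congr (_ +i* _).
  rewrite -RintegralZl//; last exact: iRe.
  rewrite -RintegralZl//; last exact: iIm.
  rewrite -RintegralB//; [|exact/integrable01Zl/iRe|exact/integrable01Zl/iIm].
  by apply: eq_Rintegral => t _; case: (F t).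
rewrite -RintegralZl//; last exact: iIm.
rewrite -RintegralZl//; last exact: iRe.
rewrite -RintegralD//; [|exact/integrable01Zl/iIm|exact/integrable01Zl/iRe].
by apply: eq_Rintegral => t _; case: (F t).
Qed.

(** Real and imaginary parts are bounded separately by the integral of the
    modulus; hence the factor 2. *)
Lemma le_cint_int F : pcont F ->
  ((N (cint F))%:E <= 2%:E * \int[mu]_(t in `[0%R, 1%R]) (N (F t))%:E)%E.
Proof.
move=> cF.
have iN := @pcont_integrable _ F (@continuous_N R) cF.
have fN : (\int[mu]_(t in `[0%R, 1%R]) (N (F t))%:E \is a fin_num)%E.
  exact: integrable_fin_num iN.
rewrite -(fineK fN) -EFinM lee_fin.
have -> : 2 * fine (\int[mu]_(t in `[0%R, 1%R]) (N (F t))%:E)%E =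
   \int[mu]_(t in `[0, 1]) N (F t) + \int[mu]_(t in `[0, 1]) N (F t).
  by rewrite mulr_natl mulr2n.
apply: (le_trans (N_le_ReIm _)); apply: lerD.
  apply: (le_trans (le_normr_Rintegral _ (iRe cF))) => //.
  apply: le_Rintegral => //; first exact: integrable_norm (iRe cF).
  by move=> t _; exact: Re_le_N.
apply: (le_trans (le_normr_Rintegral _ (iIm cF))) => //.
apply: le_Rintegral => //; first exact: integrable_norm (iIm cF).
by move=> t _; exact: Im_le_N.
Qed.

Lemma le_cint F (M : R) : pcont F -> (forall t, 0 <= t <= 1 -> N (F t) <= M) ->
  N (cint F) <= 2 * M.
Proof.
move=> cF FM; rewrite -lee_fin; apply: (le_trans (le_cint_int cF)).
rewrite EFinM lee_pmul2l// ?lte_fin//.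
apply: (@le_trans _ _ (\int[mu]_(t in `[0%R, 1%R]) (cst M%:E t))%E).
  apply: ge0_le_integral => //=.
  - by move=> t _; rewrite lee_fin N_ge0.
  - have := @pcont_integrable _ F (@continuous_N R) cF.
    by move=> /integrableP[].
rewrite integral_cst//= lebesgue_measure_itv/= lte_fin ltr01 -EFinB subr0 mule1.
exact: lexx.
Qed.

Lemma Rintegral_half_interval (g : R -> R) (a : R) :
  (forall t, a <= t <= a + 2^-1 -> {for t, continuous g}) ->
  \int[mu]_(t in `[a, a + 2^-1]) g t = 2^-1 * \int[mu]_(t in `[0, 1]) g (a + t / 2).
Proof.
move=> cg; pose A := fun t : R => a + t / 2.
have dA (t : R) : is_derive t 1 A 2^-1.
  apply: is_derive_eq; rewrite add0r. by rewrite !scaler0 add0r mul1r /GRing.scale/= mulr1.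
have dA1 : derive1 A = cst 2^-1.
  by apply/funext => t; rewrite derive1E; have [_ ->] := dA t.
have cA : continuous A.
  by move=> t; apply: differentiable_continuous; apply/derivable1_diffP; have [] := dA t.
have A0 : A 0 = a by rewrite /A mul0r addr0.
have A1 : A 1 = a + 2^-1 by rewrite /A mul1r.
have pc : {within `[0, 1], continuous (g \o A)}.
  apply/continuous_in_subspaceT => t; rewrite inE/= in_itv/= => /andP[t0 t1].
  apply: continuous_comp; first exact: cA.
  by apply: cg; rewrite /A; apply/andP; split; lra.
rewrite -RintegralZl//; last exact: cont01_integrable.
rewrite /Rintegral; congr fine; rewrite -{1}A0 -A1.
rewrite (@integration_by_substitution_increasing _ A g 0 1)//.
- by apply: eq_integral => t _; rewrite dA1 /= mulrC.
- by move=> x y _ _ xy; rewrite /A; lra.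
- by rewrite dA1 => t _; exact: cst_continuous.
- by rewrite dA1; exact: is_cvg_cst.
- by rewrite dA1; exact: is_cvg_cst.
- split => //.
    by apply: cvg_at_right_filter; exact: cA.
  by apply: cvg_at_left_filter; exact: cA.
- apply/continuous_in_subspaceT => t; rewrite inE/= in_itv/= A0 A1.
  exact: cg.
Qed.
End ComplexIntegral.

(** * Integrals along segments *)

Section Segments.
Variable R : realType.
Local Notation C := (R[i]^o).
Local Notation mu := (@lebesgue_measure R).
Implicit Types (F G : R -> C) (f g : C -> C) (a b m z : C).

Lemma RtoCM (x y : R) : (x * y)%:C = x%:C * y%:C :> C.
Proof. by rewrite rmorphM. Qed.

Lemma RtoCD (x y : R) : (x + y)%:C = x%:C + y%:C :> C.
Proof. by rewrite rmorphD. Qed.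

Lemma RtoCV (x : R) : (x^-1)%:C = (x%:C)^-1 :> C.
Proof. by rewrite fmorphV. Qed.

Lemma RtoCn (n : nat) : (n%:R : R)%:C = n%:R :> C.
Proof. by rewrite rmorph_nat. Qed.

Lemma RtoC_half : (2^-1 : R)%:C = 2^-1 :> C.
Proof. by rewrite RtoCV RtoCn. Qed.

Lemma Rintegral_halves (g : R -> R) :
  (forall t, 0 <= t <= 1 -> {for t, continuous g}) ->
  \int[mu]_(t in `[0, 1]) g t = 2^-1 * \int[mu]_(t in `[0, 1]) g (t / 2) +
    2^-1 * \int[mu]_(t in `[0, 1]) g (2^-1 + t / 2).
Proof.
move=> cg.
have ig : mu.-integrable `[0, 1] (EFin \o g).
  apply: cont01_integrable; apply/continuous_in_subspaceT => t.
  by rewrite inE/= in_itv/=; exact: cg.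
rewrite -Rintegral_half_interval => [|t /andP[t0 t1]]; last by apply: cg; apply/andP; split; lra.
have -> : \int[mu]_(t in `[0, 1]) g (t / 2) = \int[mu]_(t in `[0, 1]) g (0 + t / 2).
  by apply: eq_Rintegral => t _; rewrite add0r.
rewrite -Rintegral_half_interval => [|t /andP[t0 t1]]; last by apply: cg; apply/andP; split; lra.
have l0 : (BLeft 0 <= BRight (2^-1 : R))%O by rewrite bnd_simp; lra.
have l1 : (BRight (2^-1 : R) <= BRight 1)%O by rewrite bnd_simp; lra.
have := Rintegral_itvB ig l0 l1.
rewrite Rintegral_itv_obnd_cbnd; last first.
  by apply: integrableS ig => //; apply: subset_itvr; rewrite bnd_simp; lra.
have -> : 2^-1 + 2^-1 = 1 :> R by lra.
by rewrite add0r => <-; rewrite addrC subrK.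
Qed.

Lemma cint_halves F : pcont F ->
  cint F = 2^-1%:C * cint (fun t => F (t / 2)) + 2^-1%:C * cint (fun t => F (2^-1 + t / 2)).
Proof.
move=> cF; rewrite /cint (@Rintegral_halves (cRe \o F)); last first.
  by move=> t t01; apply: continuous_comp; [exact: cF|exact: continuous_Re].
rewrite (@Rintegral_halves (cIm \o F)); last first.
  by move=> t t01; apply: continuous_comp; [exact: cF|exact: continuous_Im].
apply/eqP; rewrite eq_complex /=; apply/andP.
by split; apply/eqP; rewrite !mul0r ?subr0 ?addr0.
Qed.

Lemma cint_cst c : cint (fun _ => c) = c :> C.
Proof.
rewrite /cint; case: c => u v /=.
by rewrite !Rintegral_cst//= lebesgue_measure_itv/= lte_fin ltr01/= oppr0 addr0 !mulr1.
Qed.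

Lemma pcont_id : pcont (fun t : R => t%:C : C).
Proof. by move=> t _; exact: continuous_real_complex. Qed.

Lemma pcont_cst c : pcont (fun _ => c : C).
Proof. by move=> t _; exact: cst_continuous. Qed.

Lemma pcontD F G : pcont F -> pcont G -> pcont (fun t => F t + G t).
Proof. by move=> cF cG t t01; apply: cvgD; [exact: cF|exact: cG]. Qed.

Lemma pcontM F G : pcont F -> pcont G -> pcont (fun t => F t * G t).
Proof. by move=> cF cG t t01; apply: cvgM; [exact: cF|exact: cG]. Qed.

(** Halving the interval gives the equation I = I / 4 + (1/2 + I / 2) / 2 for
    this integral, which determines it without a primitive. *)
Lemma cint_id : cint (fun t : R => t%:C : C) = 2^-1%:C.
Proof.
have := cint_halves pcont_id.
have -> : cint (fun t : R => (t / 2)%:C) = 2^-1%:C * cint (fun t : R => t%:C) :> C.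
  by rewrite -cintZ; [apply: eq_cint => t _; rewrite -rmorphM mulrC|exact: pcont_id].
have -> : cint (fun t : R => (2^-1 + t / 2)%:C) = 2^-1%:C + 2^-1%:C * cint (fun t : R => t%:C) :> C.
  rewrite -cintZ; last exact: pcont_id.
  rewrite -[X in _ = X + _]cint_cst -cintD.
  - by apply: eq_cint => t _; rewrite -rmorphM -rmorphD mulrC.
  - exact: pcont_cst.
  - by apply: pcontM; [exact: pcont_cst|exact: pcont_id].
set I := cint _ => H.
have e2 := RtoC_half.
rewrite e2 in H *.
transitivity (2 * (I - (2^-1 * (2^-1 * I) + 2^-1 * (2^-1 + 2^-1 * I))) + 2^-1 : R[i]).
  by field.
by rewrite -H subrr mulr0 add0r.
Qed.

Definition segint f a b : C := (b - a) * cint (fun t => f (a + t%:C * (b - a))).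

Definition segment_continuous f a b := forall t : R, 0 <= t <= 1 ->
  {for (a + t%:C * (b - a)), continuous f}.

Lemma pcont_segment f a b : segment_continuous f a b -> pcont (fun t => f (a + t%:C * (b - a))).
Proof.
move=> cf t t01.
have := cf _ t01; apply: continuous_comp; apply: cvgD; first exact: cvg_cst.
by apply: cvgM; [exact: continuous_real_complex|exact: cvg_cst].
Qed.

(** Only midpoints are needed: the subdivisions below always bisect. *)
Lemma segint_split f a b m : a + b = m + m -> segment_continuous f a b ->
  segint f a b = segint f a m + segint f m b.
Proof.
move=> abm cf.
have e2 := RtoC_half.
have bE : b = m + m - a by rewrite -abm addrAC subrr add0r.
rewrite /segint (cint_halves (pcont_segment cf)) mulrDr !mulrA; congr (_ * _ + _ * _).
- by rewrite e2 bE; field.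
- apply: eq_cint => t _; congr f.
  by rewrite bE RtoCM e2; field.
- by rewrite e2 bE; field.
apply: eq_cint => t _; congr f.
by rewrite bE RtoCD RtoCM e2; field.
Qed.

Lemma le_segint f a b (M : R) : segment_continuous f a b ->
  (forall t : R, 0 <= t <= 1 -> N (f (a + t%:C * (b - a))) <= M) ->
  N (segint f a b) <= 2 * M * N (b - a).
Proof.
move=> cf fM; rewrite /segint Normc.normcM mulrC ler_wpM2r ?N_ge0//.
by apply: le_cint => //; exact: pcont_segment.
Qed.

Lemma segintB f g a b : segment_continuous f a b -> segment_continuous g a b ->
  segint (fun z => f z - g z) a b = segint f a b - segint g a b.
Proof.
move=> cf cg; rewrite /segint -mulrBr; congr (_ * _).
rewrite -[X in _ = _ + X]mulN1r -cintZ; last exact: pcont_segment.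
rewrite -cintD; [|exact: pcont_segment|].
  by apply: eq_cint => t _; rewrite mulN1r.
by apply: pcontM; [exact: pcont_cst|exact: pcont_segment].
Qed.

(** The midpoint rule is exact on affine functions, so that their integrals
    around closed polygons vanish by algebra. *)
Lemma segint_affine (u v : C) a b :
  segint (fun z => u + v * z) a b = (b - a) * (u + v * ((a + b) / 2)).
Proof.
rewrite /segint; congr (_ * _).
transitivity (cint (fun t : R => (u + v * a) + (v * (b - a)) * t%:C) : C).
  by apply: eq_cint => t _; ring.
have e2 := RtoC_half.
rewrite cintD; [|exact: pcont_cst|by apply: pcontM; [exact: pcont_cst|exact: pcont_id]].
rewrite cintZ; last exact: pcont_id.
by rewrite cint_cst cint_id e2; field.
Qed.

End Segments.

(** * Goursat's theorem for quadrilaterals *)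

Section Goursat.
Variables (R : realType).
Local Notation C := (R[i]^o).
Variables (f : C -> C) (p0 p1 p2 p3 : C).

(** The bilinear map from the unit square onto the quadrilateral of vertices
    p0, p1, p2, p3.  Squares of parameters have images with straight sides,
    so bisecting the parameters proves Goursat's theorem for quadrilaterals
    as for rectangles. *)
Definition bilin (x y : R) : C :=
  p0 + x%:C * (p1 - p0) + y%:C * (p3 - p0) + (x * y)%:C * (p0 - p1 + p2 - p3).

Hypothesis df : forall x y : R, 0 <= x <= 1 -> 0 <= y <= 1 ->
  exists d, is_derive (bilin x y) 1 f d.

Let J (g : C -> C) (x y s : R) :=
  segint g (bilin x y) (bilin (x + s) y) +
  segint g (bilin (x + s) y) (bilin (x + s) (y + s)) -
  segint g (bilin x (y + s)) (bilin (x + s) (y + s)) -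
  segint g (bilin x y) (bilin x (y + s)).

Let bilin_h (x y s t : R) :
  bilin x y + t%:C * (bilin (x + s) y - bilin x y) = bilin (x + t * s) y.
Proof. by rewrite /bilin !(RtoCM, RtoCD); ring. Qed.

Let bilin_v (x y s t : R) :
  bilin x y + t%:C * (bilin x (y + s) - bilin x y) = bilin x (y + t * s).
Proof. by rewrite /bilin !(RtoCM, RtoCD); ring. Qed.

Let between (x s t : R) : 0 <= x -> x + s <= 1 -> 0 <= s -> 0 <= t <= 1 ->
  0 <= x + t * s <= 1.
Proof.
move=> x0 xs s0 /andP[t0 t1]; have ts0 := mulr_ge0 t0 s0.
by have := ler_wpM2r s0 t1; rewrite mul1r => ?; apply/andP; split; lra.
Qed.

Let cont_h (x y s : R) : 0 <= x -> x + s <= 1 -> 0 <= s -> 0 <= y <= 1 ->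
  segment_continuous f (bilin x y) (bilin (x + s) y).
Proof.
move=> x0 xs s0 y01 t t01; rewrite bilin_h.
by have [d /is_derive_continuous] := df (between x0 xs s0 t01) y01.
Qed.

Let cont_v (x y s : R) : 0 <= y -> y + s <= 1 -> 0 <= s -> 0 <= x <= 1 ->
  segment_continuous f (bilin x y) (bilin x (y + s)).
Proof.
move=> x0 xs s0 y01 t t01; rewrite bilin_v.
by have [d /is_derive_continuous] := df y01 (between x0 xs s0 t01).
Qed.

(** The integrals along the inner sides cancel in pairs. *)
Let J_split (x y s : R) : 0 <= x -> x + (s + s) <= 1 -> 0 <= y -> y + (s + s) <= 1 ->
  0 <= s ->
  J f x y (s + s) = J f x y s + J f (x + s) y s + J f x (y + s) s + J f (x + s) (y + s) s.
Proof.
move=> x0 x1 y0 y1 s0; rewrite /J.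
have ss0 : 0 <= s + s by rewrite addr_ge0.
have mh u v : bilin u v + bilin (u + (s + s)) v = bilin (u + s) v + bilin (u + s) v.
  by rewrite /bilin !(RtoCM, RtoCD); ring.
have mv u v : bilin u v + bilin u (v + (s + s)) = bilin u (v + s) + bilin u (v + s).
  by rewrite /bilin !(RtoCM, RtoCD); ring.
rewrite (segint_split (mh x y)); last by apply: cont_h => //; apply/andP; split; lra.
rewrite (segint_split (mh x (y + (s + s)))); last by apply: cont_h => //; apply/andP; split; lra.
rewrite (segint_split (mv x y)); last by apply: cont_v => //; apply/andP; split; lra.
rewrite (segint_split (mv (x + (s + s)) y)); last by apply: cont_v => //; apply/andP; split; lra.
have -> : x + s + s = x + (s + s) by rewrite addrA.
have -> : y + s + s = y + (s + s) by rewrite addrA.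
repeat match goal with |- context [segint f ?a ?b] => generalize (segint f a b); intro end.
ring.
Qed.

Let L : R := N (p1 - p0) + N (p3 - p0) + 2 * N (p0 - p1 + p2 - p3).

Let L0 : 0 <= L.
Proof. by rewrite /L !addr_ge0 ?N_ge0// mulr_ge0// N_ge0. Qed.

Let bilin_lip (x y x' y' s : R) : 0 <= x <= 1 -> 0 <= y' <= 1 ->
  `|x' - x| <= s -> `|y' - y| <= s ->
  N (bilin x' y' - bilin x y) <= L * s.
Proof.
move=> /andP[x0 x1] /andP[y0 y1] hx hy.
have -> : bilin x' y' - bilin x y = (x' - x)%:C * (p1 - p0) + (y' - y)%:C * (p3 - p0)
   + (x * (y' - y) + y' * (x' - x))%:C * (p0 - p1 + p2 - p3).
  by rewrite /bilin !(RtoCM, RtoCD) !rmorphN/=; ring.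
apply: (le_trans (N_triangle _ _)); rewrite /L !mulrDl; apply: lerD.
  apply: (le_trans (N_triangle _ _)); apply: lerD.
    by rewrite Normc.normcM N_real mulrC ler_wpM2l ?N_ge0.
  by rewrite Normc.normcM N_real mulrC ler_wpM2l ?N_ge0.
rewrite Normc.normcM N_real; set D := N _.
have -> : 1 * D * s + 1 * D * s = (s + s) * D by ring.
rewrite ler_wpM2r ?N_ge0//.
apply: (le_trans (ler_normD _ _)); rewrite !normrM (ger0_norm x0) (ger0_norm y0).
have := ler_wpM2r (normr_ge0 (y' - y)) x1; have := ler_wpM2r (normr_ge0 (x' - x)) y1.
lra.
Qed.

(** The affine part of f at the point of parameters (X, Y) has a zero
    integral by [segint_affine].  On the image of the square the remainder is
    at most e1 times L s, and each of the four sides has length at most L s. *)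
Let J_small (X Y : R) (e : R) : 0 <= X <= 1 -> 0 <= Y <= 1 -> 0 < e ->
  exists2 dl : R, 0 < dl & forall x y s, 0 <= x -> x + s <= 1 -> 0 <= y -> y + s <= 1 ->
    0 < s < dl -> x <= X <= x + s -> y <= Y <= y + s -> N (J f x y s) <= e * s ^+ 2.
Proof.
move=> X01 Y01 e0; have [d dfp] := df X01 Y01.
set p := bilin X Y in dfp.
(* four sides, each with the factor 2 of [le_segint], give 8 L^2 e1 s^2 *)
pose e1 := e / (8 * (L ^+ 2 + 1)).
have D0 : 0 < 8 * (L ^+ 2 + 1) by rewrite mulr_gt0// ltr_wpDl// sqr_ge0.
have e10 : 0 < e1 by rewrite divr_gt0.
move/is_derive_eps : (dfp) => /(_ _ e10)[d0 d00 H].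
have L10 : 0 < L + 1 by rewrite ltr_wpDl.
exists (d0 / (L + 1)); first by rewrite divr_gt0.
move=> x y s x0 xs y0 ys /andP[s0 sd] /andP[xX Xx] /andP[yY Yy].
have s0' := ltW s0.
pose af (z : C) : C := (f p - d * p) + d * z.
pose r (z : C) := f z - af z.
have caf (z : C) : {for z, continuous af}.
  apply: (@continuousD _ _ _ (fun _ => f p - d * p) (fun z => d * z)).
    exact: cst_continuous.
  apply: (@continuousM _ _ (fun _ => d) id); first exact: cst_continuous.
  by move=> ?; exact: cvg_id.
have crb (x' y' : R) : x <= x' <= x + s -> y <= y' <= y + s -> N (r (bilin x' y')) <= e1 * (L * s).
  move=> /andP[h1 h2] /andP[h3 h4].
  have Hn : N (bilin x' y' - p) <= L * s.
    by apply: bilin_lip => //; rewrite ?ler_norml; apply/andP; split; lra.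
  have pE : p + (bilin x' y' - p) = bilin x' y' by rewrite addrC subrK.
  have := H (bilin x' y' - p); rewrite pE => /(_ _)/wrap[|].
    apply: (le_lt_trans Hn); move: sd; rewrite ltr_pdivlMr// mulrC mulrDl mul1r; lra.
  move=> Hd; have -> : r (bilin x' y') = f (bilin x' y') - f p - d * (bilin x' y' - p).
    by rewrite /r /af; ring.
  by apply: (le_trans Hd); rewrite ler_pM2l.
have Jaf : J af x y s = 0.
  by rewrite /J !segint_affine; field.
have xs1 : 0 <= x + s <= 1 by apply/andP; split; lra.
have ys1 : 0 <= y + s <= 1 by apply/andP; split; lra.
have x01 : 0 <= x <= 1 by apply/andP; split; lra.
have y01 : 0 <= y <= 1 by apply/andP; split; lra.
have segr (a b : C) : segment_continuous f a b -> segint r a b = segint f a b - segint af a b.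
  by move=> cf; exact (@segintB R f af a b cf (fun t _ => caf _)).
have JrE : J f x y s = J r x y s.
  rewrite -[LHS]subr0 -Jaf /J.
  have h1 := segr (bilin x y) (bilin (x + s) y) (cont_h x0 xs s0' y01).
  have h2 := segr (bilin x (y + s)) (bilin (x + s) (y + s)) (cont_h x0 xs s0' ys1).
  have h3 := segr (bilin x y) (bilin x (y + s)) (cont_v y0 ys s0' x01).
  have h4 := segr (bilin (x + s) y) (bilin (x + s) (y + s)) (cont_v y0 ys s0' xs1).
  rewrite h1 h2 h3 h4.
  have ab (a1 a2 a3 a4 b1 b2 b3 b4 : C) : a1 + a2 - a3 - a4 - (b1 + b2 - b3 - b4) =
      (a1 - b1) + (a2 - b2) - (a3 - b3) - (a4 - b4) by ring.
  exact: ab.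
have cr (a b : C) : segment_continuous f a b -> segment_continuous r a b.
  by move=> cf t t01; apply: (@continuousB _ _ _ f af); [exact: cf|exact: caf].
have segh y' : y <= y' <= y + s -> 0 <= y' <= 1 -> N (segint r (bilin x y') (bilin (x + s) y'))
    <= 2 * (e1 * (L * s)) * (L * s).
  move=> yy' y'01; apply: (@le_trans _ _ (2 * (e1 * (L * s)) * N (bilin (x + s) y' - bilin x y'))).
    apply: le_segint; first by apply: cr; exact: cont_h.
    move=> t t01; rewrite bilin_h; apply: crb => //.
    case/andP : t01 => t0 t1; have ts0 := mulr_ge0 t0 s0'.
    by have := ler_wpM2r s0' t1; rewrite mul1r => ?; apply/andP; split; lra.
  rewrite ler_wpM2l//; first by apply: mulr_ge0 => //; apply: mulr_ge0; [exact: ltW|exact: mulr_ge0].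
  by apply: bilin_lip => //; rewrite ?subrr ?normr0// addrC addKr ger0_norm.
have segv x' : x <= x' <= x + s -> 0 <= x' <= 1 -> N (segint r (bilin x' y) (bilin x' (y + s)))
    <= 2 * (e1 * (L * s)) * (L * s).
  move=> yy' y'01; apply: (@le_trans _ _ (2 * (e1 * (L * s)) * N (bilin x' (y + s) - bilin x' y))).
    apply: le_segint; first by apply: cr; exact: cont_v.
    move=> t t01; rewrite bilin_v; apply: crb => //.
    case/andP : t01 => t0 t1; have ts0 := mulr_ge0 t0 s0'.
    by have := ler_wpM2r s0' t1; rewrite mul1r => ?; apply/andP; split; lra.
  rewrite ler_wpM2l//; first by apply: mulr_ge0 => //; apply: mulr_ge0; [exact: ltW|exact: mulr_ge0].
  by apply: bilin_lip => //; rewrite ?subrr ?normr0// addrC addKr ger0_norm.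
have subN_le (a b : C) (c c' : R) : N a <= c -> N b <= c' -> N (a - b) <= c + c'.
  by move=> ac bc; rewrite (le_trans (N_triangle _ _))// normcN lerD.
have addN_le (a b : C) (c c' : R) : N a <= c -> N b <= c' -> N (a + b) <= c + c'.
  by move=> ac bc; rewrite (le_trans (N_triangle _ _))// lerD.
rewrite JrE /J; pose B := 2 * (e1 * (L * s)) * (L * s).
have yl : y <= y <= y + s by apply/andP; split; lra.
have yr : y <= y + s <= y + s by apply/andP; split; lra.
have xl : x <= x <= x + s by apply/andP; split; lra.
have xr : x <= x + s <= x + s by apply/andP; split; lra.
apply: (@le_trans _ _ (B + B + B + B)).
  apply: (subN_le); last exact: segv.
  apply: (subN_le); last exact: segh.
  by apply: (addN_le); [exact: segh|exact: segv].
have -> : B + B + B + B = 8 * L ^+ 2 * e1 * s ^+ 2 by rewrite /B; ring.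
rewrite ler_wpM2r ?sqr_ge0//.
have -> : e = 8 * (L ^+ 2 + 1) * e1 by rewrite /e1 mulrC divfK// gt_eqF.
by rewrite ler_wpM2r ?(ltW e10)//; lra.
Qed.

(** If the boundary integral were nonzero, of norm eta, one quarter of the
    square would keep at least a quarter of its norm at each bisection.  The
    squares so chosen shrink to a point, where [J_small] with e = eta / 2 is
    contradicted. *)
Lemma goursat :
  segint f p0 p1 + segint f p1 p2 - segint f p3 p2 - segint f p0 p3 = 0.
Proof.
have r0 : (0 : R)%:C = 0 :> C by [].
have r1 : (1 : R)%:C = 1 :> C by [].
have e00 : p0 = bilin 0 0 by rewrite /bilin RtoCM r0; ring.
have e10 : p1 = bilin (0 + 1) 0 by rewrite /bilin RtoCM add0r r0 r1; ring.
have e01 : p3 = bilin 0 (0 + 1) by rewrite /bilin RtoCM add0r r0 r1; ring.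
have e11 : p2 = bilin (0 + 1) (0 + 1) by rewrite /bilin RtoCM add0r r1; ring.
rewrite [p0 in LHS]e00 [p1 in LHS]e10 [p2 in LHS]e11 [p3 in LHS]e01 -/(J f 0 0 1).
apply: Normc.eq0_normc; apply/eqP; rewrite eq_le N_ge0 andbT leNgt; apply/negP.
set eta := N (J f 0 0 1) => eta0.
pose s n : R := 2^-1 ^+ n.
have sS n : s n.+1 + s n.+1 = s n by rewrite /s exprS -mulrDl (_ : 2^-1 + 2^-1 = 1) ?mul1r//; lra.
have s0 n : 0 < s n by rewrite exprn_gt0.
pose good n (q : R * R) := [/\ 0 <= q.1, q.1 + s n <= 1, 0 <= q.2, q.2 + s n <= 1 &
  eta * s n ^+ 2 <= N (J f q.1 q.2 (s n))].
(* a pair (n, q) carries the rank and the corner of the current square;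
   the next corner q is chosen among those of its four quarters *)
have step (a : nat * (R * R)) : exists q : R * R, good a.1 a.2 ->
    [/\ good a.1.+1 q, a.2.1 <= q.1 <= a.2.1 + s a.1.+1 & a.2.2 <= q.2 <= a.2.2 + s a.1.+1].
  have [gd|ngd] := pselect (good a.1 a.2); last by exists (0, 0).
  case: a gd => n [x y] /= [/= x0 x1 y0 y1].
  have sn0 := s0 n.+1; have sn0' := ltW sn0.
  have x1' := x1; have y1' := y1; rewrite -sS in x1' y1'.
  rewrite -sS J_split//; set m := s n.+1.
  move=> Jb.
  have [//|h] := pselect (exists q : R * R, [/\ good n.+1 q, x <= q.1 <= x + m & y <= q.2 <= y + m]).
    by move=> [q qP]; exists q.
  have lt i j : (i == 0) || (i == m) -> (j == 0) || (j == m) ->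
      N (J f (x + i) (y + j) m) < eta * m ^+ 2.
    move=> hi hj; rewrite ltNge; apply/negP => hJ; apply: h; exists (x + i, y + j).
    have i0 : 0 <= i <= m.
      by case/orP : hi => /eqP ->; rewrite lexx ?sn0'.
    have j0 : 0 <= j <= m.
      by case/orP : hj => /eqP ->; rewrite lexx ?sn0'.
    case/andP : i0 => ? ?; case/andP : j0 => ? ?.
    have := sS n; rewrite -/m => smm.
    by split => /=; [split => //=; rewrite -/m|apply/andP; split|apply/andP; split]; lra.
  have := lt 0 0; have := lt m 0; have := lt 0 m; have := lt m m.
  rewrite !eqxx ?orbT !addr0 => /(_ isT isT) h1 /(_ isT isT) h2 /(_ isT isT) h3 /(_ isT isT) h4.
  move: Jb; rewrite leNgt => /negP; case.
  rewrite (_ : eta * (m + m) ^+ 2 = eta * m ^+ 2 + eta * m ^+ 2 + eta * m ^+ 2 + eta * m ^+ 2); last by ring.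
  apply: (le_lt_trans (N_triangle _ _)); apply: ltrD; last exact: h1.
  apply: (le_lt_trans (N_triangle _ _)); apply: ltrD; last exact: h2.
  apply: (le_lt_trans (N_triangle _ _)); apply: ltrD; last exact: h3.
  exact: h4.
have [F FP] := choice step.
pose q := fix q n := if n is n'.+1 then F (n', q n') else (0, 0) : R * R.
have gq n : good n (q n).
  elim: n => [|n IH]; first by split => /=; rewrite /s ?expr0 ?expr1n ?mulr1 ?add0r ?lexx.
  by have [] := FP (n, q n) IH.
have qS n : (q n).1 <= (q n.+1).1 /\ (q n.+1).1 + s n.+1 <= (q n).1 + s n.
  have [_ /andP[? ?] _] := FP (n, q n) (gq n); have := sS n; split => //=; simpl in *; lra.
have qS2 n : (q n).2 <= (q n.+1).2 /\ (q n.+1).2 + s n.+1 <= (q n).2 + s n.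
  have [_ _ /andP[? ?]] := FP (n, q n) (gq n); have := sS n; split => //=; simpl in *; lra.
have nested (u : nat -> R) : (forall n, 0 <= u n <= 1) ->
    (forall n, u n <= u n.+1 /\ u n.+1 + s n.+1 <= u n + s n) ->
    exists X, forall n, u n <= X <= u n + s n.
  move=> u01 uS.
  have mono n k : u n <= u (n + k)%N /\ u (n + k)%N + s (n + k)%N <= u n + s n.
    elim: k => [|k [IH1 IH2]]; first by rewrite addn0.
    by rewrite addnS; have [? ?] := uS (n + k)%N; split; lra.
  have ub : has_ubound (range u) by exists 1 => _ [n _ <-]; case/andP : (u01 n).
  have ne : (range u) !=set0 by exists (u 0%N), 0%N.
  exists (sup (range u)) => n; apply/andP; split.
    by apply: ub_le_sup => //; exists n.
  apply: ge_sup => // _ [k _ <-].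
  have [nk|/ltnW kn] := leqP n k.
    by have [] := mono n (k - n)%N; rewrite subnKC//; have := s0 k; lra.
  by have [] := mono k (n - k)%N; rewrite subnKC//; have := s0 n; lra.
have [|X XP] := nested (fun n => (q n).1) _ qS.
  by move=> n; have [? ? _ _ _] := gq n; have := s0 n => ?; apply/andP; split; lra.
have [|Y YP] := nested (fun n => (q n).2) _ qS2.
  by move=> n; have [_ _ ? ? _] := gq n; have := s0 n => ?; apply/andP; split; lra.
have s00 : s 0%N = 1 by rewrite /s expr0.
have X01 : 0 <= X <= 1 by have := XP 0%N; rewrite s00 /= add0r.
have Y01 : 0 <= Y <= 1 by have := YP 0%N; rewrite s00 /= add0r.
have eta20 : 0 < eta / 2 by rewrite divr_gt0.
have [dl dl0 H] := J_small X01 Y01 eta20.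
have [n sn] : exists n, s n < dl.
  have : s n @[n --> \oo] --> 0 by apply: cvg_expr; rewrite ger0_norm; lra.
  move=> /cvgrPdist_lt /(_ _ dl0)[n _ /(_ n)/(_ (leqnn _))].
  by rewrite sub0r normrN ger0_norm ?(ltW (s0 n))// => h; exists n.
have [g1 g2 g3 g4 g5] := gq n.
have := H _ _ _ g1 g2 g3 g4 _ (XP n) (YP n); rewrite s0 sn => /(_ isT) h.
have := le_trans g5 h; rewrite ler_pM2r ?exprn_gt0//.
lra.
Qed.
End Goursat.

(** * Contour integrals over squares *)

Section Square.
Variables (R : realType).
Local Notation C := (R[i]^o).
Local Notation mu := (@lebesgue_measure R).

Definition iC : C := Complex 0 1.

Lemma iC2 : iC * iC = -1.
Proof. by apply/eqP; rewrite eq_complex /=; apply/andP; split; apply/eqP; ring. Qed.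

Lemma N_iC : N iC = 1.
Proof. by rewrite /= expr0n add0r expr1n sqrtr1. Qed.

(** The right side of the square of vertices 1 - i, 1 + i, -1 + i, -1 - i,
    run upwards.  Multiplication by i, -1 and -i gives the other sides. *)
Definition side (t : R) : C := 1 - iC + t%:C * (2 * iC).

Lemma sideE t : side t = Complex 1 (2 * t - 1).
Proof.
apply/eqP; rewrite /side eq_complex /=; apply/andP.
by split; apply/eqP; rewrite ?mulr0n; ring.
Qed.

Lemma N_side_sqr t : N (side t) ^+ 2 = 1 + (2 * t - 1) ^+ 2.
Proof. by rewrite N_sqr sideE /= expr1n. Qed.

Lemma N_side t : 0 <= t <= 1 -> 1 <= N (side t) <= 2.
Proof.
move=> /andP[t0 t1]; have := N_side_sqr t; have := N_ge0 (side t).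
set n := N _ => n0 nE.
have sq0 := sqr_ge0 (2 * t - 1).
have tt : 0 <= t * (1 - t) by rewrite mulr_ge0 ?subr_ge0.
have n1 : 1 <= n ^+ 2 by rewrite nE lerDl.
have n2 : n ^+ 2 <= 2 ^+ 2 by rewrite nE; nra.
rewrite -(@ler_pXn2r _ 2 _ 1)// ?nnegrE// expr1n n1/=.
by rewrite -(@ler_pXn2r _ 2)// nnegrE.
Qed.

Definition on_square (z : C) := exists2 t : R, 0 <= t <= 1 &
  [\/ z = side t, z = iC * side t, z = - side t | z = - (iC * side t)].

Lemma on_square_N z : on_square z -> 1 <= N z <= 2.
Proof.
by move=> [t /N_side ?] [->|->|->|->]; rewrite ?normcN ?Normc.normcM ?N_iC ?mul1r.
Qed.

Lemma on_square_neq0 z : on_square z -> z != 0.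
Proof.
move=> /on_square_N /andP[z1 _]; apply/eqP => z0.
by move: z1; rewrite z0 Normc.normc0 ler10.
Qed.

Lemma side_neq0 t : side t != 0.
Proof.
by rewrite sideE eq_complex /= oner_eq0.
Qed.

(** On the four sides of the square dz / z has the same expression
    2 i dt / side t, since the sides differ by constant factors.  This is
    therefore the integrand of F z dz / z on the contour, in the parameter t. *)
Definition side_sum (F : C -> C) (t : R) : C := (2 * iC / side t) *
  (F (side t) + F (iC * side t) + F (- side t) + F (- (iC * side t))).

Definition sqint (F : C -> C) : C := cint (side_sum F).

Definition sqcont (F : C -> C) := forall z, on_square z -> {for z, continuous F}.

Lemma continuous_side : continuous side.
Proof.
move=> t; apply: cvgD; first exact: cvg_cst.
by apply: cvgM; [exact: continuous_real_complex|exact: cvg_cst].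
Qed.

Lemma pcont_side_sum F : sqcont F -> pcont (side_sum F).
Proof.
move=> cF t t01.
have c1 := @continuous_side t.
have c2 : {for t, continuous (fun t => iC * side t : C)}.
  by apply: cvgM; [exact: cvg_cst|exact: c1].
have on k : [\/ k = side t, k = iC * side t, k = - side t | k = - (iC * side t)] -> on_square k.
  by move=> ?; exists t.
have F1 (g : R -> C) : {for t, continuous g} -> {for g t, continuous F} ->
    {for t, continuous (fun t => F (g t) : C)}.
  by move=> cg cFg; exact: continuous_comp cg cFg.
have c3 : {for t, continuous (fun t => - side t : C)} .
  by apply: continuousN; exact: c1.
have c4 : {for t, continuous (fun t => - (iC * side t) : C)} .
  by apply: continuousN; exact: c2.
have f1 := F1 side c1 (cF _ (on _ (Or41 _ _ _ erefl))).
have f2 := F1 (fun t => iC * side t) c2 (cF _ (on _ (Or42 _ _ _ erefl))).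
have f3 := F1 (fun t => - side t) c3 (cF _ (on _ (Or43 _ _ _ erefl))).
have f4 := F1 (fun t => - (iC * side t)) c4 (cF _ (on _ (Or44 _ _ _ erefl))).
apply: cvgM; first by apply: cvgM; [exact: cvg_cst|apply: cvgV; [exact: side_neq0|exact: c1]].
exact: (continuousD (continuousD (continuousD f1 f2) f3) f4).
Qed.

Lemma eq_sqint F G : (forall z, on_square z -> F z = G z) -> sqint F = sqint G.
Proof.
move=> FG; apply: eq_cint => t t01; rewrite /side_sum !FG//; exists t => //.
- by constructor 4.
- by constructor 3.
- by constructor 2.
- by constructor 1.
Qed.

Lemma sqintD F G : sqcont F -> sqcont G ->
  sqint (fun z => F z + G z) = sqint F + sqint G.
Proof.
move=> cF cG; rewrite /sqint -cintD; [|exact: pcont_side_sum|exact: pcont_side_sum].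
by apply: eq_cint => t _; rewrite /side_sum; ring.
Qed.

Lemma sqintZ (c : C) F : sqcont F -> sqint (fun z => c * F z) = c * sqint F.
Proof.
move=> cF; rewrite /sqint -cintZ; last exact: pcont_side_sum.
by apply: eq_cint => t _; rewrite /side_sum; ring.
Qed.

Lemma N_side_sum F t : 0 <= t <= 1 -> N (side_sum F t) <=
  2 * (N (F (side t)) + N (F (iC * side t)) + N (F (- side t)) + N (F (- (iC * side t)))).
Proof.
move=> t01; rewrite /side_sum !Normc.normcM Normc.normcV N_iC mulr1.
have -> : N (2 : C) = 2 by exact: N_nat.
apply: ler_pM; rewrite ?N_ge0//.
- by rewrite mulr_ge0// invr_ge0 N_ge0.
- have /andP[h _] := N_side t01.
  by rewrite ler_piMr// invf_le1// (lt_le_trans _ h).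
do 2 (apply: (le_trans (N_triangle _ _)); rewrite lerD2r).
exact: N_triangle.
Qed.

Lemma le_sqint F (M : R) : sqcont F -> (forall z, on_square z -> N (F z) <= M) ->
  N (sqint F) <= 16 * M.
Proof.
move=> cF FM; have -> : 16 * M = 2 * (8 * M) by ring.
apply: le_cint; first exact: pcont_side_sum.
move=> t t01; apply: (le_trans (N_side_sum F t01)).
have h1 : N (F (side t)) <= M by apply: FM; exists t => //; constructor 1.
have h2 : N (F (iC * side t)) <= M by apply: FM; exists t => //; constructor 2.
have h3 : N (F (- side t)) <= M by apply: FM; exists t => //; constructor 3.
have h4 : N (F (- (iC * side t))) <= M by apply: FM; exists t => //; constructor 4.
lra.
Qed.

(** The integral of dz / z around the square, that is 2 pi i.  The bound
    [N_kappa] on its modulus stands for its exact value. *)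
Definition kappa : C := sqint (fun _ => 1).

Lemma sqcont_cst c : sqcont (fun _ => c).
Proof. by move=> z _; exact: cst_continuous. Qed.

Lemma sqint_cst c : sqint (fun _ => c) = c * kappa.
Proof.
rewrite /kappa -sqintZ; last exact: sqcont_cst.
by apply: eq_sqint => z _; rewrite mulr1.
Qed.

(** Opposite points of the square have opposite contributions. *)
Lemma sqint_inv : sqint (fun z => z^-1) = 0.
Proof.
transitivity (cint (fun _ => 0 : C)); last exact: cint_cst.
apply: eq_cint => t _; by rewrite /side_sum !invrN addrAC addrK subrr mulr0.
Qed.

(** The imaginary part of the integrand is 8 / |side t|^2, and
    |side t|^2 <= 2. *)
Lemma N_kappa : 4 <= N kappa.
Proof.
apply: le_trans (le_trans (ler_norm _) (Im_le_N _)).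
rewrite /kappa /sqint /cint /=.
have -> : 4 = \int[mu]_(t in `[0, 1]) (4 : R).
  by rewrite Rintegral_cst//= lebesgue_measure_itv/= lte_fin ltr01/= oppr0 addr0 mulr1.
apply: le_Rintegral => //.
- apply: cont01_integrable; apply/continuous_in_subspaceT => t _; exact: cst_continuous.
- exact: (pcont_integrable (@continuous_Im R) (pcont_side_sum (@sqcont_cst 1))).
move=> t tI; have t01 : 0 <= t <= 1 by move: tI; rewrite /= in_itv.
change (4 <= cIm (side_sum (fun _ => 1) t)).
have -> : side_sum (fun _ => 1) t = (8 / N (side t) ^+ 2)%:C * (Complex (2 * t - 1) 1).
  rewrite /side_sum RtoCM RtoCV.
  have -> : (N (side t) ^+ 2)%:C = side t * Complex 1 (1 - 2 * t).
    rewrite N_side_sqr sideE; apply/eqP; rewrite eq_complex /=.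
    by apply/andP; split; apply/eqP; ring.
  have h0 : Complex 1 (1 - 2 * t) != 0 :> C by rewrite eq_complex /= oner_eq0.
  have -> : Complex (2 * t - 1) 1 = iC * Complex 1 (1 - 2 * t) :> C.
    by apply/eqP; rewrite eq_complex /=; apply/andP; split; apply/eqP; ring.
  by rewrite (RtoCn R 8); field; rewrite h0 side_neq0.
have ImM (a b : R) : cIm (a%:C * Complex b 1 : C) = a by rewrite /= mul0r addr0 mulr1.
rewrite ImM.
case/andP : (N_side t01) => ? ?.
case/andP : t01 => t0 t1.
by rewrite N_side_sqr ler_pdivlMr; [nra|rewrite ltr_pwDl// sqr_ge0].
Qed.

Lemma kappa_neq0 : kappa != 0.
Proof. by apply/eqP => k0; have := N_kappa; rewrite k0 Normc.normc0; lra. Qed.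

End Square.

(** * Cauchy's formulas on squares *)

Section Cauchy.
Variables (R : realType).
Local Notation C := (R[i]^o).
Local Notation I := (@iC R).
Implicit Types (f g : C -> C) (w z c : C).

Lemma continuous_compC (h g : C -> C) z :
  {for z, continuous h} -> {for h z, continuous g} ->
  {for z, continuous (fun q => g (h q) : C)}.
Proof. exact: continuous_comp. Qed.

Lemma continuous_compR (h : R -> C) g t :
  {for t, continuous h} -> {for h t, continuous g} ->
  {for t, continuous (fun q => g (h q) : C)}.
Proof. exact: continuous_comp. Qed.

(** The region between two squares of centre w is a union of four trapezoids,
    one for each side; they avoid w, so that Goursat's theorem applies to a
    function singular at w.  Here c is a corner of the square of half-side 1,
    of modulus sqrt 2. *)
Lemma trapezoid_zero g w c (s' s rho : R) : N c ^+ 2 = 2 -> 0 < s' -> s' <= s -> 2 * s < rho ->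
  (forall z, 0 < N (z - w) < rho -> exists d, is_derive z 1 g d) ->
  segint g (w + s'%:C * c) (w + s%:C * c) + segint g (w + s%:C * c) (w + s%:C * (I * c))
  - segint g (w + s'%:C * (I * c)) (w + s%:C * (I * c)) - segint g (w + s'%:C * c) (w + s'%:C * (I * c)) = 0.
Proof.
move=> c2 s'0 ss sr dg; apply: goursat => x y /andP[x0 x1] /andP[y0 y1]; apply: dg.
set b := bilin _ _ _ _ _ _.
have s1 : 0 <= x * (s - s') by rewrite mulr_ge0// subr_ge0.
have s2 : x * (s - s') <= s - s' by rewrite ler_piMl// subr_ge0.
have -> : b - w = (s' + x * (s - s'))%:C * (c * Complex (1 - y) y).
  have -> : Complex (1 - y) y = 1 - y%:C + y%:C * I :> C.
    by apply/eqP; rewrite eq_complex /=; apply/andP; split; apply/eqP; ring.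
  have -> : (s' + x * (s - s'))%:C = s'%:C + x%:C * (s%:C - s'%:C) :> C.
    by rewrite RtoCD RtoCM rmorphB.
  by rewrite /b /bilin RtoCM; ring.
rewrite N_realM ?addr_ge0 ?(ltW s'0)//.
set n := N _.
have n2 : n ^+ 2 = 2 * ((1 - y) ^+ 2 + y ^+ 2).
  by rewrite /n Normc.normcM exprMn c2 N_sqr.
have n0 : 0 <= n by exact: N_ge0.
have yy : 0 <= y * (1 - y) by rewrite mulr_ge0// subr_ge0.
have nl : 1 <= n ^+ 2 by rewrite n2; have := sqr_ge0 (1 - 2 * y); lra.
have nu : n ^+ 2 <= 2 ^+ 2 by rewrite n2; nra.
have n1 : 1 <= n by rewrite -(@ler_pXn2r _ 2 _ 1)// ?nnegrE// expr1n.
have n3 : n <= 2 by rewrite -(@ler_pXn2r _ 2)// nnegrE.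
apply/andP; split; first by rewrite mulr_gt0//; lra.
apply: le_lt_trans sr; rewrite mulrC; apply: ler_pM => //; lra.
Qed.

Let c0 : C := 1 - I.

Let c0E : c0 = Complex 1 (-1).
Proof. by apply/eqP; rewrite eq_complex /=; apply/andP; split; apply/eqP; ring. Qed.

Lemma on_square_cont g w (s rho : R) : 0 < s -> 2 * s < rho ->
  (forall z, 0 < N (z - w) < rho -> {for z, continuous g}) ->
  sqcont (fun q => g (w + s%:C * q)).
Proof.
move=> s0 sr cg q qs; have /andP[q1 q2] := on_square_N qs.
apply: (@continuous_compC (fun q : C => w + s%:C * q)); last first.
  apply: cg; rewrite addrAC subrr add0r N_realM ?(ltW s0)//.
  apply/andP; split; first by rewrite mulr_gt0//; lra.
  by apply: le_lt_trans sr; rewrite mulrC ler_wpM2r// ltW.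
by apply: continuousD; [exact: cst_continuous|apply: continuousM; [exact: cst_continuous|move=> ?; exact: cvg_id]].
Qed.

Let iCE (z : C) : I * (I * z) = - z.
Proof. by rewrite mulrA iC2 mulN1r. Qed.

Let c0_corner t : side t = c0 + t%:C * (I * c0 - c0).
Proof.
have := iC2 R; rewrite /side /c0 => h.
have -> : I * (1 - I) = I - I * I by ring.
by rewrite h; ring.
Qed.

(** The factor s q compensates the weight dz / z of [sqint], which leaves the
    plain contour integral of g over the square of half-side s. *)
Lemma sqint_seg g w (s rho : R) : 0 < s -> 2 * s < rho ->
  (forall z, 0 < N (z - w) < rho -> {for z, continuous g}) ->
  sqint (fun q => s%:C * q * g (w + s%:C * q)) =
  segint g (w + s%:C * c0) (w + s%:C * (I * c0)) +
  segint g (w + s%:C * (I * c0)) (w + s%:C * (I * (I * c0))) +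
  segint g (w + s%:C * (I * (I * c0))) (w + s%:C * (I * (I * (I * c0)))) +
  segint g (w + s%:C * (I * (I * (I * c0)))) (w + s%:C * (I * (I * (I * (I * c0))))).
Proof.
move=> s0 sr cg; have cG := on_square_cont s0 sr cg.
have pc (k : C) : (forall t : R, 0 <= t <= 1 -> on_square (k * side t)) ->
    pcont (fun t => g (w + s%:C * (k * side t)) : C).
  move=> kon t t01; have := cG _ (kon _ t01).
  apply: (@continuous_compR (fun t : R => k * side t : C) (fun q => g (w + s%:C * q))).
  by apply: continuousM; [exact: cst_continuous|exact: continuous_side].
have segE (k : C) : (forall t : R, 0 <= t <= 1 -> on_square (k * side t)) ->
  segint g (w + s%:C * (k * c0)) (w + s%:C * (I * (k * c0))) =
  cint (fun t => (s%:C * k * (I * c0 - c0)) * g (w + s%:C * (k * side t))).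
  move=> kon; rewrite cintZ; last exact: pc.
  rewrite /segint; congr (_ * _); first by ring.
  by apply: eq_cint => t _; congr g; rewrite c0_corner; ring.
have o1 (t : R) : 0 <= t <= 1 -> on_square (1 * side t).
  by move=> t01; exists t => //; rewrite mul1r; constructor 1.
have o2 (t : R) : 0 <= t <= 1 -> on_square (I * side t).
  by move=> t01; exists t => //; constructor 2.
have o3 (t : R) : 0 <= t <= 1 -> on_square (-1 * side t).
  by move=> t01; exists t => //; rewrite mulN1r; constructor 3.
have o4 (t : R) : 0 <= t <= 1 -> on_square (- I * side t).
  by move=> t01; exists t => //; rewrite mulNr; constructor 4.
have e1 := segE _ o1; have e2 := segE _ o2; have e3 := segE _ o3; have e4 := segE _ o4.
have E1 : 1 * c0 = c0 by rewrite mul1r.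
have E3 : -1 * c0 = I * (I * c0) by rewrite iCE mulN1r.
have E4 : - I * c0 = I * (I * (I * c0)) by rewrite iCE mulNr.
rewrite E1 in e1; rewrite E3 in e3; rewrite E4 in e4.
rewrite e1 e2 e3 e4.
have pcc (k : C) kon a : pcont (fun t => a * g (w + s%:C * (k * side t))) :=
  pcontM (@pcont_cst R a) (pc k kon).
rewrite -cintD; [|exact: (pcc _ o1)|exact: (pcc _ o2)].
rewrite -cintD; [|exact: (pcontD (pcc _ o1 _) (pcc _ o2 _))|exact: (pcc _ o3)].
rewrite -cintD; [|exact: (pcontD (pcontD (pcc _ o1 _) (pcc _ o2 _)) (pcc _ o3 _))|exact: (pcc _ o4)].
apply: eq_cint => t t01.
have cc : I * c0 - c0 = 2 * I.
  rewrite /c0; have -> : I * (1 - I) = I - I * I by ring.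
  by rewrite iC2; ring.
rewrite /side_sum cc mul1r !mulN1r !mulNr.
set g1 := g (w + s%:C * side t); set g2 := g (w + s%:C * (I * side t)).
set g3 := g _; set g4 := g _.
have q00 : side t != 0 by exact: side_neq0.
by field.
Qed.

(** In the sum of the four trapezoid identities the oblique sides cancel. *)
Lemma sqint_indep g w (s s' rho : R) : 0 < s' -> s' <= s -> 2 * s < rho ->
  (forall z, 0 < N (z - w) < rho -> exists d, is_derive z 1 g d) ->
  sqint (fun q => s%:C * q * g (w + s%:C * q)) =
  sqint (fun q => s'%:C * q * g (w + s'%:C * q)).
Proof.
move=> s'0 ss sr dg.
have cg z : 0 < N (z - w) < rho -> {for z, continuous g}.
  by move=> /dg[d]; exact: is_derive_continuous.
have sr' : 2 * s' < rho by apply: le_lt_trans sr; rewrite ler_pM2l.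
rewrite (sqint_seg (lt_le_trans s'0 ss) sr cg) (sqint_seg s'0 sr' cg).
have n0 : N c0 ^+ 2 = 2 by rewrite c0E N_sqr/= expr1n sqrrN expr1n.
have nI z : N z ^+ 2 = 2 -> N (I * z) ^+ 2 = 2 by rewrite Normc.normcM N_iC mul1r.
have := trapezoid_zero n0 s'0 ss sr dg.
have := trapezoid_zero (nI _ n0) s'0 ss sr dg.
have := trapezoid_zero (nI _ (nI _ n0)) s'0 ss sr dg.
have := trapezoid_zero (nI _ (nI _ (nI _ n0))) s'0 ss sr dg.
have c4 : I * (I * (I * (I * c0))) = c0 by rewrite !iCE opprK.
rewrite c4.
have ab (r0 r1 r2 r3 a0 a1 a2 a3 b0 b1 b2 b3 : C) :
  r3 + a3 - r0 - b3 = 0 -> r2 + a2 - r3 - b2 = 0 -> r1 + a1 - r2 - b1 = 0 ->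
  r0 + a0 - r1 - b0 = 0 -> a0 + a1 + a2 + a3 = b0 + b1 + b2 + b3.
  move=> h3 h2 h1 h0; apply/eqP; rewrite -subr_eq0; apply/eqP.
  transitivity ((r3 + a3 - r0 - b3) + (r2 + a2 - r3 - b2) + (r1 + a1 - r2 - b1) + (r0 + a0 - r1 - b0)).
    by ring.
  by rewrite h0 h1 h2 h3 !addr0.
exact: ab.
Qed.

(** An integral independent of the size of the square is computed on small
    squares, where the integrand is close to a model G of known integral. *)
Lemma sqint_lim (F G : R -> C -> C) (L : C) (s : R) : 0 < s ->
  (forall s', 0 < s' <= s -> sqint (F s) = sqint (F s')) ->
  (forall s', 0 < s' <= s -> sqcont (F s') /\ sqcont (G s') /\ sqint (G s') = L) ->
  (forall e : R, 0 < e -> exists2 dl : R, 0 < dl & forall s', 0 < s' < dl -> forall q, on_square q ->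
     N (F s' q - G s' q) <= e) ->
  sqint (F s) = L.
Proof.
move=> s0 FF cFG H; apply/eqP; rewrite -subr_eq0; apply/eqP/Normc.eq0_normc/eqP.
rewrite eq_le N_ge0 andbT leNgt; apply/negP; set e := N _ => e0.
have e320 : 0 < e / 32 by rewrite divr_gt0.
have [dl dl0 Hdl] := H _ e320.
pose s' := Num.min s (dl / 2).
have s'0 : 0 < s' by rewrite lt_min s0 divr_gt0.
have s's : 0 < s' <= s by rewrite s'0 ge_min lexx.
have s'd : 0 < s' < dl by rewrite s'0 gt_min ltr_pdivrMr// mulr_natr mulr2n ltrDl dl0 orbT.
have [cF [cG GL]] := cFG _ s's.
have : e <= 16 * (e / 32).
  have cG' : sqcont (fun q => -1 * G s' q).
    by move=> z zs; apply: continuousM; [exact: cst_continuous|exact: cG].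
  rewrite {1}(_ : e = N (sqint (fun q => F s' q + -1 * G s' q))); last first.
    by rewrite (sqintD cF cG') (sqintZ _ cG) GL mulN1r -(FF _ s's).
  apply: le_sqint.
    by move=> z zs; apply: continuousD; [exact: cF|exact: cG'].
  move=> q qs; rewrite mulN1r. exact: Hdl.
lra.
Qed.

Lemma is_deriveVsub w z : z != w -> exists d, is_derive z 1 (fun z : C => (z - w)^-1) d.
Proof.
move=> zw; have d1 : derivable (fun z : C => z - w) z 1.
  by apply: derivableB; [exact: derivable_id|exact: derivable_cst].
have : derivable (fun z : C => (z - w)^-1) z 1.
  by apply: derivableV => //; rewrite subr_eq0.
by move=> /derivableP; eexists; eassumption.
Qed.

Lemma N_gt0_neq z w : 0 < N (z - w) -> z != w.
Proof. by move=> h; apply/eqP => zw; move: h; rewrite zw subrr Normc.normc0 ltxx. Qed.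

Section Formulas.
Variables (f f' : C -> C) (w : C) (rho s : R).
Hypotheses (s0 : 0 < s) (sr : 2 * s < rho).
Hypothesis df : forall z, N (z - w) < rho -> is_derive z 1 f (f' z).

Let cf z : 0 < N (z - w) < rho -> {for z, continuous f}.
Proof. by move=> /andP[_ zr]; apply: is_derive_continuous (df zr). Qed.

Let s'P (s' : R) : 0 < s' <= s -> 0 < s' /\ 2 * s' < rho.
Proof.
by move=> /andP[s'0 s's]; split => //; apply: le_lt_trans sr; rewrite ler_pM2l.
Qed.

Lemma N_center : N (w - w) < rho.
Proof. by rewrite subrr Normc.normc0 (le_lt_trans _ sr)// mulr_ge0// ltW. Qed.

(** By [sqint_indep] for f z / (z - w); on small squares f is close to the
    constant f w. *)
Lemma cauchy_value : sqint (fun q => f (w + s%:C * q)) = f w * kappa R.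
Proof.
apply: (@sqint_lim (fun s q => f (w + s%:C * q)) (fun _ _ => f w)); first exact: s0.
- move=> s' /[dup] s's /s'P[s'0 sr'].
  have s'le : s' <= s by case/andP : s's.
  have dg (z : C) : 0 < N (z - w) < rho -> exists d, is_derive z 1 (fun z : C => f z * (z - w)^-1) d.
    move=> /andP[z0 zr]; have [d Hd] := is_deriveVsub (N_gt0_neq z0).
    by eexists; exact: (@is_deriveM _ _ f _ _ _ _ _ (df zr) Hd).
  have := sqint_indep s'0 s'le sr dg.
  have E (r : R) : 0 < r -> sqint (fun q => r%:C * q * (f (w + r%:C * q) / (w + r%:C * q - w))) =
      sqint (fun q => f (w + r%:C * q)).
    move=> r0; apply: eq_sqint => q qs; have qn0 := on_square_neq0 qs.
    have r0' : r%:C != 0 :> C by rewrite eq_complex /= gt_eqF.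
    rewrite addrAC subrr add0r; field.
    by rewrite qn0 r0'.
  by rewrite !E.
- move=> s' /s'P[s'0 sr']; split; first exact: (on_square_cont s'0 sr' cf).
  split; first exact: sqcont_cst.
  exact: sqint_cst.
- move=> e e0; have := is_derive_continuous (df N_center).
  move=> /cvgN_le/(_ _ e0)/nbhs_N[dl dl0 H].
  exists (dl / 2); first by rewrite divr_gt0.
  move=> s' /andP[s'0 s'd] q qs; apply: H.
  rewrite addrAC subrr add0r N_realM ?(ltW s'0)//.
  have /andP[_ q2] := on_square_N qs.
  apply: (@le_lt_trans _ _ (s' * 2)); first by rewrite ler_wpM2l// ltW.
  by rewrite -ltr_pdivlMr.
Qed.

(** By [sqint_indep] for f z / (z - w)^2; on small squares f z / (z - w) is
    close to f w / (z - w) + f' w, whose first term has integral 0 by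
    [sqint_inv]. *)
Lemma cauchy_derivative : sqint (fun q => f (w + s%:C * q) / (s%:C * q)) = f' w * kappa R.
Proof.
have cV (r : R) (a : C) : 0 < r -> sqcont (fun q => a / (r%:C * q)).
  move=> r0 q qs; apply: continuousM; first exact: cst_continuous.
  apply: continuousV.
    by rewrite mulf_neq0 ?(on_square_neq0 qs)// eq_complex /= gt_eqF.
  by apply: continuousM; [exact: cst_continuous|move=> ?; exact: cvg_id].
apply: (@sqint_lim (fun s q => f (w + s%:C * q) / (s%:C * q))
   (fun s q => f w / (s%:C * q) + f' w)); first exact: s0.
- move=> s' /[dup] s's /s'P[s'0 sr'].
  have s'le : s' <= s by case/andP : s's.
  have dg (z : C) : 0 < N (z - w) < rho -> exists d, is_derive z 1 (fun z : C => f z * ((z - w)^-1 * (z - w)^-1)) d.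
    move=> /andP[z0 zr]; have [d Hd] := is_deriveVsub (N_gt0_neq z0).
    by eexists; exact: (@is_deriveM _ _ f _ _ _ _ _ (df zr) (@is_deriveM _ _ _ _ _ _ _ _ Hd Hd)).
  have := sqint_indep s'0 s'le sr dg.
  have E (r : R) : 0 < r -> sqint (fun q => r%:C * q * (f (w + r%:C * q) *
        ((w + r%:C * q - w)^-1 * (w + r%:C * q - w)^-1))) =
      sqint (fun q => f (w + r%:C * q) / (r%:C * q)).
    move=> r0; apply: eq_sqint => q qs; have qn0 := on_square_neq0 qs.
    have r0' : r%:C != 0 :> C by rewrite eq_complex /= gt_eqF.
    rewrite addrAC subrr add0r; field.
    by rewrite qn0 r0'.
  by rewrite !E.
- move=> s' /s'P[s'0 sr']; split.
    move=> q qs; apply: continuousM; first exact: (on_square_cont s'0 sr' cf).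
    have := cV s' 1 s'0 q qs.
    by rewrite (_ : (fun q => 1 / _) = fun q => (s'%:C * q)^-1)//; apply/funext => ?; rewrite mul1r.
  split.
    by move=> q qs; apply: continuousD; [exact: cV|exact: cst_continuous].
  rewrite sqintD; [|exact: cV|exact: sqcont_cst].
  rewrite sqint_cst.
  have -> : sqint (fun q => f w / (s'%:C * q)) = f w / s'%:C * sqint (fun q => q^-1).
    rewrite -sqintZ.
      by apply: eq_sqint => q qs; rewrite invfM mulrA.
    by move=> q qs; apply: continuousV; [exact: on_square_neq0|move=> ?; exact: cvg_id].
  by rewrite sqint_inv mulr0 add0r.
- move=> e e0; move: (df N_center) => /is_derive_eps/(_ _ e0)[dl dl0 H].
  exists (dl / 2); first by rewrite divr_gt0.
  move=> s' /andP[s'0 s'd] q qs; have := H (s'%:C * q).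
  have /andP[q1 q2] := on_square_N qs.
  have sq0 : s'%:C * q != 0.
    by rewrite mulf_neq0 ?(on_square_neq0 qs)// eq_complex /= gt_eqF.
  have Nsq : 0 < N (s'%:C * q) by rewrite N_realM ?(ltW s'0)// mulr_gt0//; lra.
  move=> /(_ _)/wrap[|].
    rewrite N_realM ?(ltW s'0)//.
    apply: (@le_lt_trans _ _ (s' * 2)); first by rewrite ler_wpM2l// ltW.
    by rewrite -ltr_pdivlMr.
  have -> : f (w + s'%:C * q) - f w - f' w * (s'%:C * q) =
    (f (w + s'%:C * q) / (s'%:C * q) - (f w / (s'%:C * q) + f' w)) * (s'%:C * q).
    move: sq0; set u := s'%:C * q => sq0; field.
    by rewrite sq0.
  by rewrite Normc.normcM ler_pM2r.
Qed.

(** The constant is 16 / 4, from [le_sqint] and [N_kappa]. *)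
Lemma cauchy_estimate (M : R) : (forall z, N (z - w) <= 2 * s -> N (f z) <= M) ->
  N (f' w) <= 4 * M / s.
Proof.
move=> fM.
have M0 : 0 <= M by apply: le_trans (fM w _); rewrite ?N_ge0// subrr Normc.normc0 mulr_ge0// ltW.
have : N (f' w) * N (kappa R) <= 16 * (M / s).
  rewrite -Normc.normcM -cauchy_derivative; apply: le_sqint.
    move=> q qs; apply: continuousM; first exact: (on_square_cont s0 sr cf).
    apply: continuousV.
      by rewrite mulf_neq0 ?(on_square_neq0 qs)// eq_complex /= gt_eqF.
    by apply: continuousM; [exact: cst_continuous|move=> ?; exact: cvg_id].
  move=> q qs; have /andP[q1 q2] := on_square_N qs.
  rewrite Normc.normcM Normc.normcV N_realM ?(ltW s0)//.
  apply: ler_pM; rewrite ?N_ge0 ?invr_ge0 ?mulr_ge0 ?N_ge0 ?(ltW s0)//.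
    by apply: fM; rewrite addrAC subrr add0r N_realM ?(ltW s0)// mulrC ler_wpM2r// ltW.
  by rewrite lef_pV2 ?posrE ?mulr_gt0 ?ler_peMr// ?(ltW s0)//; lra.
have := N_kappa R; have := N_ge0 (f' w).
rewrite -[X in _ -> _ -> _ -> _ <= X]mulrA.
set k := N (kappa R); set n := N _; set m := M / s => n0 k4 h.
have := ler_wpM2l n0 k4; lra.
Qed.

End Formulas.
End Cauchy.

(** * Regularity of holomorphic functions *)

Section Regularity.
Variables (R : realType).
Local Notation C := (R[i]^o).
Local Notation I := (@iC R).
Implicit Types (f g : C -> C) (w z c : C).

Lemma real_is_derive_eps (g : R -> R) (t d : R) :
  (forall e : R, 0 < e -> exists2 dl : R, 0 < dl &
    forall h, `|h| < dl -> `|g (t + h) - g t - d * h| <= e * `|h|) ->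
  is_derive t 1 g d.
Proof.
move=> H.
suff : (fun h : R => h^-1 *: (g (h *: 1 + t) - g t)) @ 0^' --> d.
  by move=> Hl; split; [apply/cvg_ex; exists d|exact/cvg_lim].
apply/cvgrPdist_le => e e0; have [dl dl0 Hdl] := H _ e0.
rewrite near_withinE; near=> h => h0.
have hd : `|h| < dl by near: h; apply: (@nbhs0_lt _ R^o _ dl0).
have := Hdl h hd.
have -> : g (t + h) - g t - d * h = (h^-1 *: (g (h *: 1 + t) - g t) - d) * h.
  rewrite mulrBl [X in _ = X - _]mulrC /GRing.scale/= mulrA mulfV// mul1r mulr1.
  by rewrite (addrC h).
by rewrite normrM ler_pM2r ?normr_gt0// distrC.
Unshelve. all: by end_near. Qed.

Lemma is_derive_path (p : C -> R) f (a u d : C) (t : R) :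
  (forall z z', p (z - z') = p z - p z') -> (forall z, `|p z| <= N z) ->
  (forall (r : R) z, p (r%:C * z) = r * p z) ->
  is_derive (a + t%:C * u) 1 f d ->
  is_derive t 1 (fun t => p (f (a + t%:C * u))) (p (d * u)).
Proof.
move=> pB pN pZ /is_derive_eps df; apply: real_is_derive_eps => e e0.
have u0 : 0 < N u + 1 by rewrite ltr_wpDl// N_ge0.
have [dl dl0 H] := df (e / (N u + 1)) (divr_gt0 e0 u0).
exists (dl / (N u + 1)); first exact: divr_gt0.
move=> h; rewrite ltr_pdivlMr// => hdl.
have hu : N (h%:C * u) <= `|h| * (N u + 1).
  by rewrite Normc.normcM N_real ler_wpM2l// lerDl.
have := H _ (le_lt_trans hu hdl).
rewrite (_ : a + t%:C * u + h%:C * u = a + (t + h)%:C * u); last by rewrite RtoCD; ring.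
rewrite -pB (_ : p (d * u) * h = p (d * (h%:C * u))); last first.
  by rewrite mulrCA pZ mulrC.
rewrite -pB => Hh; apply: (le_trans (pN _)); apply: (le_trans Hh).
apply: (@le_trans _ _ (e / (N u + 1) * (`|h| * (N u + 1)))).
  by rewrite ler_wpM2l// ltW// divr_gt0.
by rewrite mulrA mulrAC divfK// gt_eqF.
Qed.

(** The real mean value theorem applies to one real coordinate p of f along
    the segment. *)
Lemma mean_value_proj (p : C -> R) f f' (a b : C) (L : R) :
  (forall z z', p (z - z') = p z - p z') -> (forall z, `|p z| <= N z) ->
  (forall (r : R) z, p (r%:C * z) = r * p z) ->
  (forall t : R, 0 <= t <= 1 -> is_derive (a + t%:C * (b - a)) 1 f (f' (a + t%:C * (b - a)))) ->
  (forall t : R, 0 <= t <= 1 -> N (f' (a + t%:C * (b - a))) <= L) ->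
  `|p (f b) - p (f a)| <= L * N (b - a).
Proof.
move=> pB pN pZ df fL; pose g t := p (f (a + t%:C * (b - a))).
have dg (t : R) : 0 <= t <= 1 -> is_derive t 1 g (p (f' (a + t%:C * (b - a)) * (b - a))).
  by move=> t01; exact (is_derive_path pB pN pZ (df _ t01)).
have cg : {within `[0, 1], continuous g}.
  apply/continuous_in_subspaceT => t; rewrite inE/= in_itv/= => t01.
  have := dg _ t01; move=> [h _].
  by apply: differentiable_continuous; apply/derivable1_diffP.
have dg' (t : R) : t \in `]0, 1[%R -> is_derive t 1 g (p (f' (a + t%:C * (b - a)) * (b - a))).
  by rewrite in_itv/= => /andP[t0 t1]; apply: dg; rewrite !ltW.
have [c] := MVT ltr01 dg' cg.
rewrite in_itv/= => /andP[c0 c1]; rewrite /g subr0 mulr1.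
have -> : a + (1 : R)%:C * (b - a) = b by rewrite mul1r addrC subrK.
have -> : a + (0 : R)%:C * (b - a) = a by rewrite mul0r addr0.
move=> ->; apply: (le_trans (pN _)); rewrite Normc.normcM ler_wpM2r ?N_ge0//.
by apply: fL; rewrite !ltW.
Qed.

Lemma ReB z z' : cRe (z - z') = cRe z - cRe z'.
Proof. by case: z; case: z'. Qed.

Lemma ImB z z' : cIm (z - z') = cIm z - cIm z'.
Proof. by case: z; case: z'. Qed.

Lemma ReZ (r : R) z : cRe (r%:C * z) = r * cRe z.
Proof. by case: z => a b /=; rewrite mul0r subr0. Qed.

Lemma ImZ (r : R) z : cIm (r%:C * z) = r * cIm z.
Proof. by case: z => a b /=; rewrite mul0r addr0. Qed.

Lemma mean_value f f' (a b : C) (L : R) :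
  (forall t : R, 0 <= t <= 1 -> is_derive (a + t%:C * (b - a)) 1 f (f' (a + t%:C * (b - a)))) ->
  (forall t : R, 0 <= t <= 1 -> N (f' (a + t%:C * (b - a))) <= L) ->
  N (f b - f a) <= 2 * L * N (b - a).
Proof.
move=> df fL; apply: (le_trans (N_le_ReIm _)).
rewrite ReB ImB -mulrA mulr_natl mulr2n; apply: lerD.
  exact: (mean_value_proj ReB (@Re_le_N R) ReZ df fL).
exact: (mean_value_proj ImB (@Im_le_N R) ImZ df fL).
Qed.

Lemma N_segment (a b w : C) (t rho : R) : 0 <= t <= 1 -> N (a - w) < rho -> N (b - w) < rho ->
  N (a + t%:C * (b - a) - w) < rho.
Proof.
move=> /andP[t0 t1] ha hb.
have -> : a + t%:C * (b - a) - w = (1 - t)%:C * (a - w) + t%:C * (b - w).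
  by rewrite rmorphB; ring.
apply: (le_lt_trans (N_triangle _ _)); rewrite !N_realM ?subr_ge0//.
have [t1'|t1'] := ltP t 1.
  apply: (@lt_le_trans _ _ ((1 - t) * rho + t * rho)); last by rewrite -mulrDl subrK mul1r.
  by apply: ltr_leD; [rewrite ltr_pM2l// subr_gt0|rewrite ler_wpM2l// ltW].
have -> : t = 1 by apply/eqP; rewrite eq_le t1 t1'.
by rewrite subrr mul0r add0r mul1r.
Qed.

Lemma mean_value_ball f f' w (rho L : R) (a b : C) :
  (forall z, N (z - w) < rho -> is_derive z 1 f (f' z)) ->
  (forall z, N (z - w) < rho -> N (f' z) <= L) ->
  N (a - w) < rho -> N (b - w) < rho -> N (f b - f a) <= 2 * L * N (b - a).
Proof.
move=> df fL ha hb; apply: (@mean_value _ f').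
  by move=> t t01; apply: df; exact: N_segment.
by move=> t t01; apply: fL; exact: N_segment.
Qed.

Lemma is_derive_linear (c z : C) : is_derive z 1 (fun z : C => c * z) c.
Proof.
apply/is_derive_eps => e e0; exists 1 => // h _.
have -> : c * (z + h) - c * z - c * h = 0 by ring.
by rewrite Normc.normc0 mulr_ge0 ?N_ge0// ltW.
Qed.

(** The mean value inequality for z |-> f z - f' u * z on the segment from u to
    u + h, where its derivative f' z - f' u is at most L |h|. *)
Lemma taylor_bound f f' w (rho L : R) (u h : C) : 0 <= L ->
  (forall z, N (z - w) < rho -> is_derive z 1 f (f' z)) ->
  (forall z z', N (z - w) < rho -> N (z' - w) < rho -> N (f' z - f' z') <= L * N (z - z')) ->
  N (u - w) < rho -> N (u + h - w) < rho ->
  N (f (u + h) - f u - f' u * h) <= 2 * L * N h ^+ 2.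
Proof.
move=> L0 df fL hu huh.
have dg (z : C) : N (z - w) < rho -> is_derive z 1 (fun z : C => f z - f' u * z) (f' z - f' u).
  move=> zr; have := df _ zr => Hf.
  exact: (@is_deriveB _ _ _ f _ _ _ _ _ Hf (is_derive_linear (f' u) z)).
have -> : f (u + h) - f u - f' u * h = (f (u + h) - f' u * (u + h)) - (f u - f' u * u) by ring.
have uh : u + h - u = h by ring.
rewrite -[X in _ <= _ * N X ^+ 2]uh expr2 !mulrA -[2 * L * _]mulrA.
apply: (@mean_value (fun z => f z - f' u * z) (fun z => f' z - f' u)).
  by move=> t t01; apply: dg; exact: N_segment.
move=> t t01; have hz := N_segment t01 hu huh.
apply: (le_trans (fL _ _ hz hu)); rewrite ler_wpM2l//.
rewrite addrAC subrr add0r; case/andP : t01 => t0 t1.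
by rewrite N_realM// ler_piMl// N_ge0.
Qed.

Lemma continuous_toC : continuous (fun p : R * R => Complex p.1 p.2 : C).
Proof.
move=> p.
have -> : (fun p : R * R => Complex p.1 p.2 : C) = (fun p => p.1%:C + p.2%:C * I).
  apply/funext => q; apply/eqP; rewrite eq_complex /=.
  by apply/andP; split; apply/eqP; ring.
have c1 : {for p, continuous (fun q : R * R => q.1%:C : C)}.
  by apply: (@continuous_comp _ _ _ fst); [exact: cvg_fst|exact: continuous_real_complex].
have c2 : {for p, continuous (fun q : R * R => q.2%:C : C)}.
  by apply: (@continuous_comp _ _ _ snd); [exact: cvg_snd|exact: continuous_real_complex].
exact: (cvgD c1 (cvgM c2 (cvg_cst _))).
Qed.

(** The disc of radius r lies in the square of half-side r, which is compact
    as a product of segments and lies in the disc of radius 2 r. *)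
Lemma locally_bounded f w (r : R) : 0 < r ->
  (forall z, N (z - w) <= 2 * r -> {for z, continuous f}) ->
  exists M : R, forall z, N (z - w) <= r -> N (f z) <= M.
Proof.
move=> r0 cf.
pose K : set (R * R) := `[- r, r]%classic `*` `[- r, r]%classic.
have cK : compact K by apply: compact_setX; exact: segment_compact.
have K0 : K !=set0 by exists (0, 0); split; rewrite /= in_itv/= oppr_le0 ltW.
pose g (p : R * R) := N (f (w + Complex p.1 p.2)).
have cg : {within K, continuous g}.
  apply/continuous_in_subspaceT => p; rewrite inE => -[].
  rewrite /= !in_itv/= -!ler_norml => p1 p2.
  apply: (@continuous_comp _ _ _ (fun p : R * R => f (w + Complex p.1 p.2))); last exact: continuous_N.
  apply: (@continuous_comp _ _ _ (fun p : R * R => w + Complex p.1 p.2 : C)); last first.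
    apply: cf; rewrite addrAC subrr add0r.
    by apply: (le_trans (N_le_ReIm _)) => /=; rewrite mulr_natl mulr2n lerD.
  by apply: continuousD; [exact: cst_continuous|exact: continuous_toC].
have [p _ pM] := compact_EVT_max K0 cK cg.
exists (g p) => z zr; have -> : f z = f (w + Complex (cRe (z - w)) (cIm (z - w))).
  have cE (u : C) : Complex (cRe u) (cIm u) = u by case: u.
  by rewrite cE addrC subrK.
apply: (pM (cRe (z - w), cIm (z - w))); rewrite inE; split; rewrite /= in_itv/= -ler_norml.
  exact: le_trans (Re_le_N _) zr.
exact: le_trans (Im_le_N _) zr.
Qed.

Section Derivative.
Variables (f f' : C -> C) (w : C) (rho : R).
Hypothesis rho0 : 0 < rho.
Hypothesis df : forall z, N (z - w) < rho -> is_derive z 1 f (f' z).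

(** Cauchy's estimate for f bounds f' near w, and Cauchy's estimate for
    v |-> f (v + z) - f (v + z') then shows that f' is Lipschitz there.  The
    resulting second-order Taylor bound allows differentiation under the
    integral sign in Cauchy's formula for f'. *)
Lemma derivative_differentiable : exists d, is_derive w 1 f' d.
Proof.
have tri z z' r r' : N (z - z') < r -> N (z' - w) <= r' -> N (z - w) < r + r'.
  move=> h1 h2; have -> : z - w = (z - z') + (z' - w) by ring.
  by apply: (le_lt_trans (N_triangle _ _)); exact: ltr_leD.
have tri' z z' r r' : N (z - z') <= r -> N (z' - w) < r' -> N (z - w) < r + r'.
  move=> h1 h2; have -> : z - w = (z - z') + (z' - w) by ring.
  by apply: (le_lt_trans (N_triangle _ _)); exact: ler_ltD.
have r0 : 0 < rho := rho0.
have [|z zr|M HM] := @locally_bounded f w (rho / 4); first lra.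
  by apply: (is_derive_continuous (df _)); apply: (le_lt_trans zr); lra.
(* discs of radius 4 s around w, enlarged by contours of radius 2 s, stay in
   the disc of radius rho / 4 = 8 s, where f is bounded *)
pose s := rho / 32.
have s0 : 0 < s by rewrite /s; lra.
have s23 : 2 * s < 3 * s by rewrite ltr_pM2r// ltr_nat.
pose L1 := 4 * M / s.
have f'b (z : C) : N (z - w) < 4 * s -> N (f' z) <= L1.
  move=> zw; rewrite /L1.
  apply: (@cauchy_estimate R f f' z (3 * s) s s0 s23 _ M).
    move=> z' hz'; apply: df; have := tri _ _ _ _ hz' (ltW zw); rewrite /s; lra.
  move=> z' hz'; apply: HM; have := tri' _ _ _ _ hz' zw; rewrite /s; lra.
have L10 : 0 <= L1 by apply: le_trans (f'b w _); rewrite ?N_ge0// subrr Normc.normc0; lra.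
pose L2 := 4 * (2 * L1) / (s / 4).
have L20 : 0 <= L2 by rewrite /L2; apply: divr_ge0; [do 2 (apply: mulr_ge0 => //)|lra].
have f'l (z z' : C) : N (z - w) < 3 * s -> N (z' - w) < 3 * s -> N (f' z - f' z') <= L2 * N (z - z').
  move=> hz hz'.
  have dF (v : C) : N (v - 0) < s -> is_derive v 1 (fun v : C => f (v + z) - f (v + z')) (f' (v + z) - f' (v + z')).
    rewrite subr0 => hv.
    have dsh (y : C) : N (y - w) < 3 * s -> is_derive v 1 (fun v : C => f (v + y)) (f' (v + y)).
      move=> hy; have : is_derive (v + y) 1 f (f' (v + y)).
        apply: df; have -> : v + y - w = v + (y - w) by ring.
        by apply: (le_lt_trans (N_triangle _ _)); have := ltrD hv hy; rewrite /s; lra.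
      move=> /is_derive_eps Hd; apply/is_derive_eps => e /Hd[dl dl0 H].
      exists dl => // h /H; rewrite (_ : v + y + h = v + h + y)//; ring.
    exact: (@is_deriveB _ _ _ (fun v : C => f (v + z)) _ _ _ _ _ (dsh _ hz) (dsh _ hz')).
  have s4 : 0 < s / 4 by lra.
  have s42 : 2 * (s / 4) < s by lra.
  have Fb (v : C) : N (v - 0) <= 2 * (s / 4) -> N (f (v + z) - f (v + z')) <= 2 * L1 * N (z - z').
    rewrite subr0 => hv.
    have hy (y : C) : N (y - w) < 3 * s -> N (v + y - w) < 4 * s.
      move=> yw; have -> : v + y - w = v + (y - w) by ring.
      by apply: (le_lt_trans (N_triangle _ _)); have := ler_ltD hv yw; lra.
    have -> : z - z' = v + z - (v + z') by ring.
    have dball (y : C) : N (y - w) < 4 * s -> is_derive y 1 f (f' y).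
      by move=> yw; apply: df; apply: (lt_trans yw); rewrite /s; lra.
    exact: (mean_value_ball dball f'b (hy _ hz') (hy _ hz)).
  have := cauchy_estimate s4 s42 dF Fb.
  rewrite !add0r => h; apply: (le_trans h).
  by rewrite /L2 le_eqVlt; apply/orP; left; apply/eqP; ring.
have f'c (z : C) : N (z - w) < 3 * s -> {for z, continuous f'}.
  move=> zw; apply/(@cvgN_le _ _ _ (nbhs_filter z)) => e e0; apply/nbhs_N.
  have L21 : 0 < L2 + 1 by lra.
  exists (Num.min (3 * s - N (z - w)) (e / (L2 + 1))).
    by rewrite lt_min subr_gt0 zw divr_gt0.
  move=> y; rewrite lt_min ltr_pdivlMr// => /andP[y1 y2].
  have yw : N (y - w) < 3 * s.
    have -> : y - w = (y - z) + (z - w) by ring.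
    by apply: (le_lt_trans (N_triangle _ _)); lra.
  apply: (le_trans (f'l _ _ yw zw)); rewrite mulrC; apply: le_trans (ltW y2).
  by rewrite ler_wpM2l ?N_ge0//; lra.
(* d is the derivative that Cauchy's formula predicts when it is applied to f' *)
pose G (q : C) := f' (w + s%:C * q) / (s%:C * q).
pose d := sqint G / kappa R.
have sV : sqcont (fun q => (s%:C * q)^-1).
  move=> q qs; apply: continuousV.
    by rewrite mulf_neq0 ?(on_square_neq0 qs)// eq_complex /= gt_eqF.
  by apply: continuousM; [exact: cst_continuous|move=> ?; exact: cvg_id].
have cG : sqcont G.
  move=> q qs; apply: continuousM; last exact: sV.
  apply: (@on_square_cont R f' w s (3 * s) s0 s23 _ q qs).
  by move=> z /andP[_]; exact: f'c.
have key (h : C) : N h < s / 2 -> N (f' (w + h) - f' w - d * h) <= 8 * L2 / s * N h ^+ 2.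
  move=> hs.
  have d0 (z : C) : N (z - w) < 3 * s -> is_derive z 1 f (f' z).
    by move=> zw; apply: df; apply: (lt_trans zw); rewrite /s; lra.
  have dh (z : C) : N (z - (w + h)) < 3 * s -> is_derive z 1 f (f' z).
    move=> zw; apply: df; have -> : z - w = (z - (w + h)) + h by ring.
    by apply: (le_lt_trans (N_triangle _ _)); have := ltrD zw hs; rewrite /s; lra.
  have c0 (g : C -> C) (w' : C) : (forall z, N (z - w') < 3 * s -> {for z, continuous g}) ->
      sqcont (fun q => g (w' + s%:C * q)).
    by move=> cg; apply: (on_square_cont s0 s23) => z /andP[_]; exact: cg.
  have cf0 := c0 f w (fun z zw => is_derive_continuous (d0 z zw)).
  have cfh := c0 f (w + h) (fun z zw => is_derive_continuous (dh z zw)).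
  have cF0 : sqcont (fun q => f (w + s%:C * q) / (s%:C * q)).
    by move=> q qs; apply: continuousM; [exact: cf0|exact: sV].
  have cFh : sqcont (fun q => f (w + h + s%:C * q) / (s%:C * q)).
    by move=> q qs; apply: continuousM; [exact: cfh|exact: sV].
  have cZ (c : C) (g : C -> C) : sqcont g -> sqcont (fun q => c * g q).
    by move=> cg q qs; apply: continuousM; [exact: cst_continuous|exact: cg].
  (* T is the integrand of Cauchy's formula for f' (w + h) - f' w - d * h *)
  pose T (q : C) := f (w + h + s%:C * q) / (s%:C * q) +
    -1 * (f (w + s%:C * q) / (s%:C * q)) + - h * G q.
  have cFF : sqcont (fun q => f (w + h + s%:C * q) / (s%:C * q) +
      -1 * (f (w + s%:C * q) / (s%:C * q))).
    by move=> q qs; apply: continuousD; [exact: cFh|exact: cZ].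
  have cT : sqcont T.
    by move=> q qs; apply: continuousD; [exact: cFF|exact: cZ].
  have TE : sqint T = (f' (w + h) - f' w - d * h) * kappa R.
    rewrite (sqintD cFF (cZ _ _ cG)) (sqintD cFh (cZ _ _ cF0)) (sqintZ _ cF0) (sqintZ _ cG).
    rewrite (cauchy_derivative s0 s23 dh) (cauchy_derivative s0 s23 d0) /d; have := kappa_neq0 R.
    by move=> k0; field.
  have Tb q : on_square q -> N (T q) <= 2 * L2 / s * N h ^+ 2.
    move=> qs; have /andP[q1 q2] := on_square_N qs.
    have Nsq : N (s%:C * q) = s * N q by rewrite N_realM// ltW.
    have sq0 : s%:C * q != 0.
      by rewrite mulf_neq0 ?(on_square_neq0 qs)// eq_complex /= gt_eqF.
    have -> : T q = (f (w + s%:C * q + h) - f (w + s%:C * q) - f' (w + s%:C * q) * h) / (s%:C * q).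
      rewrite /T /G (addrAC w h); move: sq0; set u := s%:C * q => sq0; field.
      exact: sq0.
    have h1 : N (w + s%:C * q - w) < 3 * s.
      rewrite addrAC subrr add0r Nsq; apply: le_lt_trans s23.
      by rewrite mulrC ler_wpM2r// ltW.
    have h2 : N (w + s%:C * q + h - w) < 3 * s.
      have -> : w + s%:C * q + h - w = s%:C * q + h by ring.
      apply: (le_lt_trans (N_triangle _ _)); rewrite Nsq.
      by have := ler_wpM2l (ltW s0) q2; lra.
    rewrite Normc.normcM Normc.normcV Nsq [X in _ <= X]mulrAC; apply: ler_pM.
    - exact: N_ge0.
    - by rewrite invr_ge0; apply: mulr_ge0; [exact: ltW|exact: N_ge0].
    - exact: (taylor_bound L20 d0 f'l h1 h2).
    - have qp : 0 < N q by apply: lt_le_trans q1.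
      by rewrite lef_pV2 ?posrE ?mulr_gt0// ler_peMr// ltW.
  have := le_sqint cT Tb; rewrite TE Normc.normcM.
  have := N_kappa R; set k := N (kappa R); set n := N _ => k4.
  have n0 : 0 <= n := N_ge0 _.
  have -> : 8 * L2 / s * N h ^+ 2 = 4 * (2 * L2 / s * N h ^+ 2) by ring.
  by have := ler_wpM2l n0 k4; lra.
exists d; apply/is_derive_eps => e e0.
have B0 : 0 <= 8 * L2 / s by apply: divr_ge0; [exact: mulr_ge0|exact: ltW].
pose B := 8 * L2 / s + 1.
have Bp : 0 < B by rewrite /B ltr_wpDl.
exists (Num.min (s / 2) (e / B)); first by rewrite lt_min !divr_gt0.
move=> h; rewrite lt_min => /andP[h1]; rewrite (ltr_pdivlMr _ _ Bp) => h2.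
have kh := key _ h1.
have eh : 8 * L2 / s * N h ^+ 2 <= e * N h.
  rewrite expr2 mulrA ler_wpM2r ?N_ge0// mulrC.
  by apply: le_trans (ltW h2); rewrite ler_wpM2l ?N_ge0// /B; lra.
exact: le_trans kh eh.
Qed.
End Derivative.
End Regularity.

(** * Borel sets of the plane and affine substitutions *)

Section PlaneMeasure.
Variable R : realType.
Local Notation C := (R[i]^o).
Local Notation mu := (@lebesgue_measure R).
Local Notation RT := (measurableTypeR R).

Definition toC (p : R * R) : C := Complex p.1 p.2.

(** An open set is the union of the countably many rational boxes that it
    contains. *)
Lemma open_measurable_plane (U : set (R * R)) : open U -> measurable (U : set (RT * RT)).
Proof.
move=> oU.
(* boxes not contained in U are replaced by the empty set, so that the union
   is indexed by all quadruples of rationals *)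
pose box (q : (rat * rat) * (rat * rat)) : set (RT * RT) :=
  `]ratr q.1.1, ratr q.1.2[%classic `*` `]ratr q.2.1, ratr q.2.2[%classic.
have -> : U = \bigcup_q (if `[< box q `<=` U >] then box q else set0).
  apply/seteqP; split=> [p Up|p [q _]]; last first.
    by case: asboolP => // qU /qU.
  have : nbhs p U by exact: open_nbhs_nbhs.
  move=> [[A B] [/= pA pB] ABU].
  have rbox (x : R) (V : set R) : nbhs x V -> exists a b : rat,
      [/\ ratr a < x, x < ratr b & `]ratr a, ratr b[%classic `<=` V].
    move=> /nbhs_ballP[e /= e0 eV].
    have xe : x - e < x by rewrite ltrBlDr ltrDl.
    have ex : x < x + e by rewrite ltrDl.
    have [a /itvP ha] := rat_in_itvoo xe; have [b /itvP hb] := rat_in_itvoo ex.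
    exists a, b; split; rewrite ?ha ?hb// => y /=; rewrite in_itv/= => /andP[ay yb].
    apply: eV; rewrite /ball/= ltr_distlC; apply/andP; split.
      by apply: lt_trans ay; rewrite ha.
    by apply: (lt_trans yb); rewrite hb.
  have [a [b [ha hb abA]]] := rbox _ _ pA; have [c [d [hc hd cdB]]] := rbox _ _ pB.
  exists ((a, b), (c, d)) => //; case: asboolP => [_|].
    by split; rewrite /= in_itv/= ?ha ?hb ?hc ?hd.
  by case=> q [/= q1 q2]; apply: ABU; split; [exact: abA|exact: cdB].
apply: countable_bigcupT_measurable => // q; case: ifPn => // _.
by apply: measurableX => //; exact: measurable_itv.
Qed.

Lemma continuous_measurable_plane (U : set (R * R)) (F : R * R -> R) : open U ->
  (forall p, U p -> {for p, continuous F}) -> measurable_fun (U : set (RT * RT)) F.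
Proof.
move=> oU cF; apply: (measurability _ (RGenOpens.measurableE R)).
move=> _ [_ [a [b ->] <-]]; apply: open_measurable_plane.
rewrite openE => p [Up Fp]; rewrite /interior.
apply: filterI; first exact: open_nbhs_nbhs.
apply: cF => //; apply: open_nbhs_nbhs; split => //; exact: interval_open.
Qed.

Lemma continuous_dist (w : C) : continuous (fun p : R * R => N (toC p - w)).
Proof.
move=> p; apply: (@continuous_comp _ _ _ (fun p : R * R => toC p - w : C)).
  by apply: cvgB; [exact: continuous_toC|exact: cvg_cst].
exact: continuous_N.
Qed.

Lemma measurable_closed_ball (w : C) (r : R) :
  measurable [set p : RT * RT | N (toC p - w) <= r].
Proof.
rewrite -(setCK [set p | _]); apply: measurableC; apply: open_measurable_plane.
have -> : ~` [set p : RT * RT | N (toC p - w) <= r] =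
    (fun p : R * R => N (toC p - w)) @^-1` [set x | r < x].
  by apply/seteqP; split => p /=; rewrite ltNge => /negP.
by apply: open_comp; [move=> p _; exact: continuous_dist|exact: open_gt].
Qed.

Definition affine (a b : R) : RT -> RT := fun x => a + b * x.

Lemma measurable_affine (a b : R) : measurable_fun [set: RT] (affine a b).
Proof.
by apply: continuous_measurable_fun => x; apply: cvgD; [exact: cvg_cst|apply: cvgM; [exact: cvg_cst|exact: cvg_id]].
Qed.

Definition affine_measure (a b : R) : {measure set RT -> \bar R} :=
  measure_function_pushforward__canonical__measure_function_Measure mu (measurable_affine a b).

(** By uniqueness of Lebesgue measure, from its values on half-open
    intervals; for b < 0 the preimage of such an interval is closed on the
    other side. *)
Lemma lebesgue_affine (a b : R) (A : set R) : b != 0 -> measurable (A : set RT) ->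
  mu A = mscale (NngNum (normr_ge0 b)) (affine_measure a b) A.
Proof.
move=> b0 mA.
apply: (@lebesgue_measure_unique R (mscale (NngNum (normr_ge0 b)) (affine_measure a b))) => // _ [[x y]] _ <-.
change (mu `]x, y]%classic = `|b|%:E * mu ((fun z : R => (a + b * z)%R) @^-1` `]x, y]%classic))%E.
have [xy|yx] := ltP x y; last first.
  by rewrite set_itv_ge ?preimage_set0 ?measure0 ?mule0// bnd_simp -leNgt//.
move: b0; rewrite neq_lt => /orP[b0|b0].
  have -> : (fun x : R => a + b * x) @^-1` `]x, y]%classic = `[((y - a) / b), ((x - a) / b)[%classic.
    by apply/seteqP; split => z; rewrite /= !in_itv/= ler_ndivrMr// ltr_ndivlMr// => /andP[h1 h2];
      apply/andP; split; lra.
  rewrite !lebesgue_measure_itv/= !lte_fin xy ltr_ndivlMr// divfK ?lt_eqF// ltrD2r xy.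
  rewrite -EFinB -EFinM ltr0_norm//; congr EFin.
  by field; rewrite lt_eqF.
have -> : (fun x : R => a + b * x) @^-1` `]x, y]%classic = `]((x - a) / b), ((y - a) / b)]%classic.
  by apply/seteqP; split => z; rewrite /= !in_itv/= ler_pdivlMr// ltr_pdivrMr// => /andP[h1 h2];
    apply/andP; split; lra.
rewrite !lebesgue_measure_itv/= !lte_fin xy ltr_pdivrMr// divfK ?gt_eqF// ltrD2r xy.
rewrite -EFinB -EFinM gtr0_norm//; congr EFin.
by field; rewrite gt_eqF.
Qed.

Lemma integral_affine (a b : R) (F : RT -> \bar R) : b != 0 ->
  measurable_fun setT F -> (forall x, 0 <= F x)%E ->
  (\int[mu]_x F (a + b * x)%R = `|b|^-1%:E * \int[mu]_x F x)%E.
Proof.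
move=> b0 mF F0.
transitivity (\int[affine_measure a b]_y F y)%E.
  by rewrite /affine_measure/= ge0_integral_pushforward//; exact: measurable_affine.
rewrite (eq_measure_integral (mscale (NngNum (normr_ge0 b)) (affine_measure a b)) (m1 := mu)); last first.
  by move=> A mA _; exact: lebesgue_affine.
rewrite ge0_integral_mscale//= muleA -EFinM mulVf ?mul1e// normr_eq0//.
Qed.

End PlaneMeasure.

(** * The area mean value inequality *)

Section Submean.
Variable R : realType.
Local Notation C := (R[i]^o).
Local Notation I := (@iC R).
Local Notation mu := (@lebesgue_measure R).
Local Notation mu2 := (@plane_measure R).
Local Notation RT := (measurableTypeR R).

(** The whole line contains the image of the segment, and the substitution
    contributes 1 / |b| <= 1 / r. *)
Lemma line_integral_le (H : RT -> \bar R) (x0 b r : R) :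
  measurable_fun setT H -> (forall x, 0 <= H x)%E -> 0 < r -> r <= `|b| ->
  (\int[mu]_(t in `[0%R, 1%R]) H (x0 + b * t)%R <= r^-1%:E * \int[mu]_x H x)%E.
Proof.
move=> mH H0 r0 rb.
have b0 : b != 0 by rewrite -normr_gt0 (lt_le_trans r0).
have mHb : measurable_fun setT (fun t : RT => H (x0 + b * t)%R).
  exact: (measurableT_comp mH (measurable_affine x0 b)).
apply: (@le_trans _ _ (\int[mu]_t H (x0 + b * t)%R)%E).
  by apply: ge0_subset_integral => //; exact: measurable_itv.
rewrite integral_affine//; apply: lee_wpmul2r; first exact: integral_ge0.
by rewrite lee_fin lef_pV2// posrE (lt_le_trans r0).
Qed.

Section Ball.
Variables (f f' : C -> C) (w : C) (rho r : R).
Hypotheses (r0 : 0 < r) (rr : 2 * r < rho).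
Hypothesis df : forall z, N (z - w) < rho -> is_derive z 1 f (f' z).

Let B : set (RT * RT) := [set p | N (toC p - w) <= 2 * r].

Let mB : measurable B.
Proof. exact: measurable_closed_ball. Qed.

(** The modulus of f is cut off outside a closed disc, so that integrals along
    whole lines make sense and Tonelli's theorem holds on the plane. *)
Let H : RT * RT -> \bar R := (fun p => (N (f (toC p)))%:E) \_ B.

Let H0 p : (0 <= H p)%E.
Proof. by rewrite /H /patch; case: ifPn => // _; rewrite lee_fin N_ge0. Qed.

Let mH : measurable_fun setT H.
Proof.
apply/(measurable_restrictT _ mB).
pose U : set (R * R) := [set p | N (toC p - w) < rho].
have oU : open U.
  have -> : U = (fun p : R * R => N (toC p - w)) @^-1` [set x | x < rho] by [].
  by apply: open_comp; [move=> p _; exact: continuous_dist|exact: open_lt].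
apply/measurable_EFinP.
apply: (@measurable_funS _ _ _ _ (U : set (RT * RT))); first exact: open_measurable_plane.
  by move=> p; rewrite /B /U /= => /le_lt_trans; apply.
apply: continuous_measurable_plane => // p Up.
have c1 : {for p, continuous (fun p : R * R => f (toC p) : C)}.
  exact: (continuous_comp (@continuous_toC R p) (is_derive_continuous (df Up))).
exact: (continuous_comp c1 (@continuous_N R _)).
Qed.

Let Hx x := (\int[mu]_y H (x, y))%E.
Let Hy y := (\int[mu]_x H (x, y))%E.

Let mHx : measurable_fun setT Hx.
Proof. exact: measurable_fun_fubini_tonelli_F. Qed.

Let mHy : measurable_fun setT Hy.
Proof. exact: measurable_fun_fubini_tonelli_G. Qed.

Let Hx0 x : (0 <= Hx x)%E. Proof. by apply: integral_ge0. Qed.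
Let Hy0 x : (0 <= Hy x)%E. Proof. by apply: integral_ge0. Qed.

(** Cauchy's formula bounds |f w| by the integrals of |f| over the sides of
    the square of half-side s, each of which is dominated by the integral of
    H along the line that carries the side. *)
Let square_estimate (s : R) : r / 2 <= s <= r ->
  ((N (f w))%:E <= r^-1%:E * (Hx (cRe w + s)%R + Hy (cIm w + s)%R + Hx (cRe w - s)%R + Hy (cIm w - s)%R))%E.
Proof.
move=> /andP[s1 s2].
have r0' : 0 < r := r0.
have s0 : 0 < s by apply: lt_le_trans s1; rewrite divr_gt0.
have sr : 2 * s < rho by apply: le_lt_trans rr; rewrite ler_pM2l.
have cf (z : C) : 0 < N (z - w) < rho -> {for z, continuous f}.
  by move=> /andP[_ zr]; exact: is_derive_continuous (df zr).
pose F (q : C) := f (w + s%:C * q).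
have cF : sqcont F by exact: on_square_cont s0 sr cf.
pose H1 (t : RT) := H (cRe w + s, (cIm w - s) + (2 * s) * t).
pose H2 (t : RT) := H ((cRe w + s) + (- (2 * s)) * t, cIm w + s).
pose H3 (t : RT) := H (cRe w - s, (cIm w + s) + (- (2 * s)) * t).
pose H4 (t : RT) := H ((cRe w - s) + (2 * s) * t, cIm w - s).
have mHc (a b : RT -> RT) : measurable_fun setT a -> measurable_fun setT b ->
    measurable_fun setT (fun t => H (a t, b t)).
  by move=> ma mb; apply: (measurableT_comp mH); exact: measurable_fun_pair.
have m1 : measurable_fun setT H1 by apply: mHc => //; exact: measurable_affine.
have m2 : measurable_fun setT H2 by apply: mHc => //; exact: measurable_affine.
have m3 : measurable_fun setT H3 by apply: mHc => //; exact: measurable_affine.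
have m4 : measurable_fun setT H4 by apply: mHc => //; exact: measurable_affine.
have HE (t : R) (q : C) (x y : R) : on_square q -> w + s%:C * q = Complex x y ->
    (N (F q))%:E = H (x, y).
  move=> qs qE; rewrite /H /patch mem_set; last first.
    rewrite /B /= /toC/= -qE addrAC subrr add0r N_realM ?(ltW s0)// mulrC.
    have /andP[_ q2] := on_square_N qs.
    by apply: ler_pM => //; rewrite ?N_ge0// ltW.
  by rewrite /F qE.
have wE : w = Complex (cRe w) (cIm w) by case: w.
have E1 t : 0 <= t <= 1 -> (N (F (side t)))%:E = H1 t.
  move=> t01; apply: HE => //; first by exists t => //; constructor 1.
  rewrite [in LHS]wE sideE; apply/eqP; rewrite eq_complex /=.
  by apply/andP; split; apply/eqP; ring.
have E2 t : 0 <= t <= 1 -> (N (F (I * side t)))%:E = H2 t.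
  move=> t01; apply: HE => //; first by exists t => //; constructor 2.
  rewrite [in LHS]wE sideE; apply/eqP; rewrite eq_complex /=.
  by apply/andP; split; apply/eqP; ring.
have E3 t : 0 <= t <= 1 -> (N (F (- side t)))%:E = H3 t.
  move=> t01; apply: HE => //; first by exists t => //; constructor 3.
  rewrite [in LHS]wE sideE; apply/eqP; rewrite eq_complex /=.
  by apply/andP; split; apply/eqP; ring.
have E4 t : 0 <= t <= 1 -> (N (F (- (I * side t))))%:E = H4 t.
  move=> t01; apply: HE => //; first by exists t => //; constructor 4.
  rewrite [in LHS]wE sideE; apply/eqP; rewrite eq_complex /=.
  by apply/andP; split; apply/eqP; ring.
have mI := @measurable_itv R `[0, 1].
have mS (k : RT -> \bar R) : measurable_fun setT k -> measurable_fun (`[0, 1]%classic : set RT) k.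
  by move=> mk; exact: measurable_funS mk.
have sum0 (t : R) : (0 <= H1 t + H2 t + H3 t + H4 t)%E.
  by rewrite !adde_ge0// /H1 /H2 /H3 /H4; exact: H0.
have msum : measurable_fun setT (fun t : RT => H1 t + H2 t + H3 t + H4 t)%E.
  by do 3 (apply: emeasurable_funD => //).
have step1 : ((N (sqint F))%:E <= 2%:E * (2%:E * (\int[mu]_(t in `[0%R, 1%R]) (H1 t + H2 t + H3 t + H4 t))))%E.
  apply: (le_trans (le_cint_int (pcont_side_sum cF))).
  apply: lee_wpmul2l => //.
  rewrite -(ge0_integralZl_EFin mu mI (fun t _ => sum0 t) (mS _ msum))//.
  apply: ge0_le_integral => //.
  - by move=> t _; rewrite lee_fin N_ge0.
  - by have /integrableP[] := pcont_integrable (@continuous_N R) (pcont_side_sum cF).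
  - by apply: mS; exact: measurable_funeM.
  - move=> t; rewrite /= in_itv/= => t01.
    by rewrite -E1// -E2// -E3// -E4// -!EFinD -EFinM lee_fin N_side_sum.
have step2 : (\int[mu]_(t in `[0%R, 1%R]) (H1 t + H2 t + H3 t + H4 t) =
   \int[mu]_(t in `[0%R, 1%R]) H1 t + \int[mu]_(t in `[0%R, 1%R]) H2 t +
   \int[mu]_(t in `[0%R, 1%R]) H3 t + \int[mu]_(t in `[0%R, 1%R]) H4 t)%E.
  have z1 (t : RT) : (0 <= H1 t)%E by exact: H0.
  have z2 (t : RT) : (0 <= H2 t)%E by exact: H0.
  have z3 (t : RT) : (0 <= H3 t)%E by exact: H0.
  have z4 (t : RT) : (0 <= H4 t)%E by exact: H0.
  have m12 := emeasurable_funD m1 m2; have m123 := emeasurable_funD m12 m3.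
  rewrite (ge0_integralD mu mI _ (mS _ m123) (fun t _ => z4 t) (mS _ m4)); last first.
    by move=> t _; rewrite /= !adde_ge0.
  rewrite (ge0_integralD mu mI _ (mS _ m12) (fun t _ => z3 t) (mS _ m3)); last first.
    by move=> t _; rewrite /= !adde_ge0.
  by rewrite (ge0_integralD mu mI (fun t _ => z1 t) (mS _ m1) (fun t _ => z2 t) (mS _ m2)).
have b1 : r <= `|2 * s| by rewrite ger0_norm; lra.
have b2 : r <= `|- (2 * s)| by rewrite normrN.
have step3 : (\int[mu]_(t in `[0%R, 1%R]) (H1 t + H2 t + H3 t + H4 t) <=
  r^-1%:E * (Hx (cRe w + s)%R + Hy (cIm w + s)%R + Hx (cRe w - s)%R + Hy (cIm w - s)%R))%E.
  have ri : (0 <= r^-1%:E)%E by rewrite lee_fin invr_ge0 ltW.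
  have l1 := @line_integral_le (fun y => H (cRe w + s, y)) (cIm w - s) _ _
    (mHc _ _ (measurable_cst _) (@measurable_id _ _ _)) (fun y => H0 _) r0 b1.
  have l2 := @line_integral_le (fun x => H (x, cIm w + s)) (cRe w + s) _ _
    (mHc _ _ (@measurable_id _ _ _) (measurable_cst _)) (fun y => H0 _) r0 b2.
  have l3 := @line_integral_le (fun y => H (cRe w - s, y)) (cIm w + s) _ _
    (mHc _ _ (measurable_cst _) (@measurable_id _ _ _)) (fun y => H0 _) r0 b2.
  have l4 := @line_integral_le (fun x => H (x, cIm w - s)) (cRe w - s) _ _
    (mHc _ _ (@measurable_id _ _ _) (measurable_cst _)) (fun y => H0 _) r0 b1.
  have mD (a b c d : \bar R) : (0 <= a -> 0 <= b -> 0 <= c -> 0 <= d ->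
      r^-1%:E * (a + b + c + d) = r^-1%:E * a + r^-1%:E * b + r^-1%:E * c + r^-1%:E * d)%E.
    by move=> a0 b0 c0 d0; rewrite !ge0_muleDr ?adde_ge0.
  rewrite step2 (mD _ _ _ _ (Hx0 _) (Hy0 _) (Hx0 _) (Hy0 _)).
  exact: (leeD (leeD (leeD l1 l2) l3) l4).
have step4 : (4%:E * (N (f w))%:E <= (N (sqint F))%:E)%E.
  rewrite (cauchy_value s0 sr df) -EFinM lee_fin Normc.normcM mulrC.
  by rewrite ler_wpM2l ?N_ge0// N_kappa.
have := le_trans step4 step1.
have -> : (2%:E * (2%:E * \int[mu]_(t in `[0%R, 1%R]) (H1 t + H2 t + H3 t + H4 t)) =
   4%:E * \int[mu]_(t in `[0%R, 1%R]) (H1 t + H2 t + H3 t + H4 t))%E.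
  by rewrite muleA -EFinM; congr (_%:E * _)%E; lra.
by rewrite lee_pmul2l ?lte_fin// => /le_trans; apply.
Qed.

(** The inequality [square_estimate] is integrated over r / 2 <= s <= r: the
    lines carrying the sides sweep out the plane, and each of the four terms
    contributes at most the area integral. *)
Lemma area_submean : ((N (f w))%:E <= (8 / r ^+ 2)%:E *
   \int[mu2]_(p in [set p | (N (toC p - w) <= 2 * r)%R]) (N (f (toC p)))%:E)%E.
Proof.
have r0' : 0 < r := r0.
have -> : (\int[mu2]_(p in [set p | (N (toC p - w) <= 2 * r)%R]) (N (f (toC p)))%:E =
   \int[mu2]_p H p)%E by rewrite [LHS]integral_mkcond.
set J := (\int[mu2]_p H p)%E.
have JE1 : J = (\int[mu]_x Hx x)%E by rewrite /J /plane_measure fubini_tonelli1.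
have JE2 : J = (\int[mu]_x Hy x)%E by rewrite /J /plane_measure fubini_tonelli2.
pose S (s : R) := (Hx (cRe w + 1 * s)%R + Hy (cIm w + 1 * s)%R + Hx (cRe w + -1 * s)%R + Hy (cIm w + -1 * s)%R)%E.
have mc (K : RT -> \bar R) (a b : R) : measurable_fun setT K -> measurable_fun setT (fun t : RT => K (a + b * t)%R).
  by move=> mK; exact: (measurableT_comp mK (measurable_affine a b)).
have mS : measurable_fun setT S by do 3 (apply: emeasurable_funD; last exact: mc); exact: mc.
have S0 (s : RT) : (0 <= S s)%E.
  by apply: adde_ge0; [apply: adde_ge0; [apply: adde_ge0|]|];
    [exact: Hx0|exact: Hy0|exact: Hx0|exact: Hy0].
have IS : (\int[mu]_s S s = 4%:E * J)%E.
  have n1 := mc _ (cRe w) 1 mHx; have n2 := mc _ (cIm w) 1 mHy.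
  have n3 := mc _ (cRe w) (-1) mHx; have n4 := mc _ (cIm w) (-1) mHy.
  have n12 := emeasurable_funD n1 n2; have n123 := emeasurable_funD n12 n3.
  rewrite (ge0_integralD mu (measurableT) _ n123 (fun t _ => Hy0 _) n4); last first.
    by move=> t _; apply: adde_ge0; [apply: adde_ge0|]; [exact: Hx0|exact: Hy0|exact: Hx0].
  rewrite (ge0_integralD mu (measurableT) _ n12 (fun t _ => Hx0 _) n3); last first.
    by move=> t _; apply: adde_ge0; [exact: Hx0|exact: Hy0].
  rewrite (ge0_integralD mu (measurableT) (fun t _ => Hx0 _) n1 (fun t _ => Hy0 _) n2).
  have o1 : (1 : R) != 0 := oner_neq0 R.
  have o2 : (-1 : R) != 0 by rewrite oppr_eq0.
  rewrite (integral_affine (cRe w) o1 mHx Hx0) (integral_affine (cRe w) o2 mHx Hx0).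
  rewrite (integral_affine (cIm w) o1 mHy Hy0) (integral_affine (cIm w) o2 mHy Hy0).
  rewrite normrN1 normr1 invr1 -JE1 -JE2.
  rewrite (mul1e J).
  have J0 : (0 <= J)%E by exact: integral_ge0.
  have -> : 4%:E = (1%:E + 1%:E + 1%:E + 1%:E)%E :> \bar R by rewrite -!EFinD; congr EFin; lra.
  move: J J0 {JE1 JE2} => K K0.
  by rewrite !ge0_muleDl ?adde_ge0 ?lee_fin// !mul1e.
have : ((r / 2)%:E * (N (f w))%:E <= r^-1%:E * (4%:E * J))%E.
  rewrite -IS -(ge0_integralZl_EFin mu measurableT (fun s _ => S0 s) mS); last by rewrite invr_ge0 ltW.
  apply: (@le_trans _ _ (\int[mu]_(s in `[(r / 2)%R, r]) (r^-1%:E * S s))%E); last first.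
    apply: (@ge0_subset_integral _ _ _ mu `[(r / 2)%R, r]%classic setT); last by [].
    - exact: measurable_itv.
    - exact: measurableT.
    - exact: (measurable_funeM _ mS).
    - by move=> s _; apply: mule_ge0; [rewrite lee_fin invr_ge0 ltW|exact: S0].
  have -> : ((r / 2)%:E * (N (f w))%:E = \int[mu]_(s in `[(r / 2)%R, r]) (cst (N (f w))%:E s))%E.
    rewrite integral_cst; last exact: measurable_itv.
    rewrite /= lebesgue_measure_itv/= lte_fin.
    have -> : r / 2 < r by lra.
    by rewrite -EFinB muleC; congr (_ * _%:E)%E; lra.
  apply: ge0_le_integral; first exact: measurable_itv.
  - by move=> s _; rewrite lee_fin N_ge0.
  - exact: measurable_cst.
  - by apply: (measurable_funS measurableT) => //; exact: (measurable_funeM _ mS).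
  - move=> s; rewrite /= in_itv/= => hs.
    by have := square_estimate hs; rewrite /S !mul1r !mulN1r.
have -> : (8 / r ^+ 2)%:E = ((r / 2)^-1%:E * (r^-1%:E * 4%:E))%E.
  by rewrite -!EFinM; congr EFin; field; rewrite gt_eqF.
rewrite -!muleA => h.
rewrite -[X in (X <= _)%E]mul1e -[X in (X%:E * _ <= _)%E](@mulVf _ (r / 2)); last first.
  by rewrite gt_eqF// divr_gt0.
by rewrite EFinM -muleA; apply: lee_wpmul2l => //; rewrite lee_fin invr_ge0 divr_ge0 ?(ltW r0').
Qed.

End Ball.
End Submean.

(** * The kernel of a self-map of the disc *)

Section Carleson.
Variable R : realType.
Local Notation C := (R[i]^o).
Local Notation mu2 := (@plane_measure R).
Local Notation RT := (measurableTypeR R).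

(** The plane measure under a name of its own, to which the sigma-finiteness
    required by Tonelli's theorem for pairs of points of the plane is
    attached. *)
Definition area_measure : set (RT * RT) -> \bar R :=
  (@lebesgue_measure R \x @lebesgue_measure R)%E.

HB.instance Definition _ := Measure.on area_measure.

Let area_measure_sigma_finite : sigma_finite setT area_measure.
Proof.
have /sigma_finiteP[F [TF ndF Foo]] := sigma_finiteT (@lebesgue_measure R).
exists (fun n => F n `*` F n).
  rewrite -setXTT TF predeqE => -[x y]; split.
    move=> [/= [n _ Fnx] [k _ Gky]]; exists (maxn n k) => //; split.
    - by move: x Fnx; exact/subsetPset/ndF/leq_maxl.
    - by move: y Gky; exact/subsetPset/ndF/leq_maxr.
  by move=> [n _ []/= ? ?]; split; exists n.
move=> k; have [? ?] := Foo k.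
split; first exact: measurableX.
by rewrite /area_measure product_measure1E// lte_mul_pinfty// ge0_fin_numE.
Qed.

HB.instance Definition _ := Measure_isSigmaFinite.Build _ _ _ area_measure
  area_measure_sigma_finite.

Let mu2s : {sigma_finite_measure set _ -> \bar R} := area_measure.

Definition disc : set (RT * RT) := [set p | N (toC p) < 1].

(** The derivative is part of the data, as an arbitrary function that is
    prescribed on the disc only. *)
Definition holo (f f' : C -> C) := forall z : C, N z < 1 -> is_derive z 1 f (f' z).

(** Taken at f', this is the area of the image of the disc under f, counted
    with multiplicity. *)
Definition area (f' : C -> C) : \bar R :=
  (\int[mu2]_(p in disc) (N (f' (toC p)) ^+ 2)%:E)%E.

Lemma cont_N_toC : continuous (fun p : R * R => N (toC p)).
Proof. by move=> p; exact: (continuous_comp (@continuous_toC R p) (@continuous_N R _)). Qed.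

Lemma open_disc : open (disc : set (R * R)).
Proof.
have -> : (disc : set (R * R)) = (fun p : R * R => N (toC p)) @^-1` [set x | x < 1] by [].
by apply: open_comp; [move=> p _; exact: cont_N_toC|exact: open_lt].
Qed.

Lemma measurable_disc : measurable disc.
Proof. exact: (open_measurable_plane open_disc). Qed.

Lemma measurable_disc_comp (h : C -> R) (f : C -> C) : continuous h ->
  (forall z : C, N z < 1 -> {for z, continuous f}) ->
  measurable_fun disc (fun p => h (f (toC p))).
Proof.
move=> ch cf; apply: continuous_measurable_plane; first exact: open_disc.
move=> p pD.
have c1 : {for p, continuous (fun p : R * R => f (toC p) : C)}.
  exact: (continuous_comp (@continuous_toC R p) (cf _ pD)).
exact: (continuous_comp c1 (ch _)).
Qed.

Lemma holo_derivative (f f' : C -> C) : holo f f' -> exists f'', holo f' f''.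
Proof.
move=> hf.
have H (z : C) : exists d, N z < 1 -> is_derive z 1 f' d.
  have [z1|z1] := pselect (N z < 1); last by exists 0.
  have z10 : 0 < 1 - N z by rewrite subr_gt0.
  have [|d dP] := @derivative_differentiable R f f' z (1 - N z) z10; last by exists d.
  move=> y yz; apply: hf; have -> : y = (y - z) + z by rewrite subrK.
  by apply: (le_lt_trans (N_triangle _ _)); rewrite -ltrBrDr.
have [f'' fP] := choice H.
by exists f'' => z; exact: fP.
Qed.

Lemma holo_continuous (f f' : C -> C) (z : C) : holo f f' -> N z < 1 -> {for z, continuous f}.
Proof. by move=> hf z1; exact: is_derive_continuous (hf _ z1). Qed.

(** The inequality [area_submean] for f^2 and r = (1 - |w|) / 4, where
    8 / r^2 = 128 / (1 - |w|)^2. *)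
Lemma bergman_point (f f' : C -> C) (w : C) : holo f f' -> N w < 1 ->
  ((N (f w) ^+ 2)%:E <= (128 / (1 - N w) ^+ 2)%:E *
    \int[mu2]_(p in [set p | (N (toC p - w) <= (1 - N w) / 2)%R]) (N (f (toC p)) ^+ 2)%:E)%E.
Proof.
move=> hf w1.
have w0 : 0 < 1 - N w by rewrite subr_gt0.
pose r := (1 - N w) / 4.
have r0 : 0 < r by rewrite /r divr_gt0.
have rr : 2 * r < 1 - N w by rewrite /r; lra.
have dff (z : C) : N (z - w) < 1 - N w -> is_derive z 1 (fun z : C => f z * f z) (f z * f' z + f z * f' z).
  move=> zw; have z1 : N z < 1.
    have -> : z = (z - w) + w by rewrite subrK.
    by apply: (le_lt_trans (N_triangle _ _)); rewrite -ltrBrDr.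
  exact: (@is_deriveM _ _ f f _ _ _ _ (hf _ z1) (hf _ z1)).
have := area_submean r0 rr dff.
rewrite Normc.normcM -expr2.
have -> : 8 / r ^+ 2 = 128 / (1 - N w) ^+ 2.
  by rewrite /r; field; rewrite gt_eqF.
have -> : 2 * r = (1 - N w) / 2 by rewrite /r; lra.
by under eq_integral do rewrite Normc.normcM -expr2.
Qed.

Section Kernel.
Variables (phi phi' : C -> C).
Hypothesis hphi : holo phi phi'.
Hypothesis phiD : forall z, N z < 1 -> N (phi z) < 1.

Let cphi (z : C) : N z < 1 -> {for z, continuous phi}.
Proof. exact: (holo_continuous hphi). Qed.

Let cphi' (z : C) : N z < 1 -> {for z, continuous phi'}.
Proof. by have [phi'' h] := holo_derivative hphi; exact: (holo_continuous h). Qed.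

(** The pairs (p, q) such that q belongs to the disc over which
    [bergman_point] integrates for the centre phi p. *)
Definition near_set : set ((RT * RT) * (RT * RT)) :=
  [set x | disc x.1 /\ N (toC x.2 - phi (toC x.1)) <= (1 - N (phi (toC x.1))) / 2].

(** No regularity of phi is known outside the disc; cutting off its
    coordinates there makes them measurable on the plane. *)
Let reD : RT * RT -> R := (fun p => cRe (phi (toC p))) \_ disc.
Let imD : RT * RT -> R := (fun p => cIm (phi (toC p))) \_ disc.

Let mreD : measurable_fun setT reD.
Proof. by apply/(measurable_restrictT _ measurable_disc); exact: (measurable_disc_comp (@continuous_Re R) cphi). Qed.

Let mimD : measurable_fun setT imD.
Proof. by apply/(measurable_restrictT _ measurable_disc); exact: (measurable_disc_comp (@continuous_Im R) cphi). Qed.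

Let measurable_N_plane : measurable_fun [set: RT * RT] (fun p => N (toC p)).
Proof. by apply: continuous_measurable_plane; [exact: openT|move=> p _; exact: cont_N_toC]. Qed.

Let mN2 d (T : measurableType d) (a b : T -> RT) : measurable_fun setT a -> measurable_fun setT b ->
  measurable_fun setT (fun x => N (toC (a x, b x)) : RT).
Proof.
by move=> ma mb; apply: (measurableT_comp measurable_N_plane); exact: measurable_fun_pair.
Qed.

Lemma measurable_near_set : measurable near_set.
Proof.
have -> : near_set = (fst @^-1` disc) `&`
   (fun x => (1 - N (toC (reD x.1, imD x.1))) / 2 - N (toC (x.2.1 - reD x.1, x.2.2 - imD x.1))) @^-1` [set x : R | 0 <= x].
  have E p : disc p -> toC (reD p, imD p) = phi (toC p).
    by move=> pD; rewrite /reD /imD /patch mem_set// /toC/=; case: (phi _).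
  have E2 p q : disc p -> toC (q.1 - reD p, q.2 - imD p) = toC q - phi (toC p).
    by move=> pD; rewrite /reD /imD /patch mem_set//; rewrite /toC/=; case: (phi _).
  have EE p q : disc p -> (1 - N (toC (reD p, imD p))) / 2 - N (toC (q.1 - reD p, q.2 - imD p)) =
      (1 - N (phi (toC p))) / 2 - N (toC q - phi (toC p)).
    by move=> pD; rewrite E// E2.
  apply/seteqP; split => [[p q] [pD H]|[p q] [pD]].
    split; first exact: pD.
    change (0 <= (1 - N (toC (reD p, imD p))) / 2 - N (toC (q.1 - reD p, q.2 - imD p))).
    by rewrite (EE p q pD) subr_ge0.
  change (0 <= (1 - N (toC (reD p, imD p))) / 2 - N (toC (q.1 - reD p, q.2 - imD p)) -> near_set (p, q)).
  by rewrite (EE p q pD) subr_ge0 => H; split.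
apply: measurableI.
  by rewrite -[X in measurable X]setTI; exact: (measurable_fst measurableT _ measurable_disc).
rewrite -[X in measurable X]setTI.
have m1 : measurable_fun setT (fun x : (RT * RT) * (RT * RT) => reD x.1).
  exact: (measurableT_comp mreD measurable_fst).
have m2 : measurable_fun setT (fun x : (RT * RT) * (RT * RT) => imD x.1).
  exact: (measurableT_comp mimD measurable_fst).
have m3 : measurable_fun setT (fun x : (RT * RT) * (RT * RT) => x.2.1).
  exact: (measurableT_comp measurable_fst measurable_snd).
have m4 : measurable_fun setT (fun x : (RT * RT) * (RT * RT) => x.2.2).
  exact: (measurableT_comp measurable_snd measurable_snd).
have mm : measurable_fun setT (fun x : (RT * RT) * (RT * RT) =>
   (1 - N (toC (reD x.1, imD x.1))) / 2 - N (toC (x.2.1 - reD x.1, x.2.2 - imD x.1)) : RT).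
  apply: measurable_funB; last by apply: mN2; exact: measurable_funB.
  apply: measurable_funM; last exact: measurable_cst.
  by apply: measurable_funB; [exact: measurable_cst|exact: mN2].
apply: mm => //; rewrite -set_itvcy; exact: measurable_itv.
Qed.

(** The factor of [bergman_point] at phi z times the Jacobian |phi' z|^2. *)
Definition weight : RT * RT -> R :=
  (fun p => 128 / (1 - N (phi (toC p))) ^+ 2 * N (phi' (toC p)) ^+ 2) \_ disc.

Lemma weight_ge0 p : 0 <= weight p.
Proof.
rewrite /weight patchE; case: ifPn => // _.
by apply: mulr_ge0; [apply: divr_ge0; [by []|exact: sqr_ge0]|exact: sqr_ge0].
Qed.

Lemma measurable_weight : measurable_fun setT weight.
Proof.
apply/(measurable_restrictT _ measurable_disc).
apply: continuous_measurable_plane; first exact: open_disc.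
move=> p pD.
have c1 : {for p, continuous (fun p : R * R => N (phi (toC p)))}.
  have c1 : {for p, continuous (fun p : R * R => phi (toC p) : C)}.
    exact: (continuous_comp (@continuous_toC R p) (cphi pD)).
  exact: (continuous_comp c1 (@continuous_N R _)).
have c2 : {for p, continuous (fun p : R * R => N (phi' (toC p)))}.
  have c2 : {for p, continuous (fun p : R * R => phi' (toC p) : C)}.
    exact: (continuous_comp (@continuous_toC R p) (cphi' pD)).
  exact: (continuous_comp c2 (@continuous_N R _)).
have d0 : (1 - N (phi (toC p))) ^+ 2 != 0.
  by rewrite expf_neq0// subr_eq0 gt_eqF// phiD.
have c3 : {for p, continuous (fun p : R * R => 1 - N (phi (toC p)))}.
  by apply: continuousB; [exact: cst_continuous|exact: c1].
have c4 : {for p, continuous (fun p : R * R => ((1 - N (phi (toC p))) ^+ 2)^-1)}.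
  by apply: continuousV => //; apply: continuousM; exact: c3.
apply: (@continuousM _ _ (fun p => 128 / (1 - N (phi (toC p))) ^+ 2)).
  by apply: continuousM; [exact: cst_continuous|exact: c4].
by apply: continuousM; exact: c2.
Qed.

(** Density at q of the image by phi of the measure of density [weight],
    spread over the discs of [near_set].  Its size governs the composition
    operator. *)
Definition carleson_kernel (q : RT * RT) : \bar R :=
  (\int[mu2]_p ((fun x => (weight x.1)%:E) \_ near_set) (p, q))%E.

Let mW : measurable_fun setT ((fun x => (weight x.1)%:E) \_ near_set).
Proof.
apply/(measurable_restrictT _ measurable_near_set).
apply: measurable_funTS; apply/measurable_EFinP.
exact: (measurableT_comp measurable_weight measurable_fst).
Qed.

Let W0 x : (0 <= ((fun x => (weight x.1)%:E) \_ near_set) x)%E.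
Proof. by rewrite /patch; case: ifPn => // _; rewrite lee_fin weight_ge0. Qed.

Lemma carleson_kernel_ge0 q : (0 <= carleson_kernel q)%E.
Proof. exact: integral_ge0. Qed.

Lemma measurable_carleson_kernel : measurable_fun setT carleson_kernel.
Proof. have := measurable_fun_fubini_tonelli_G (m1 := mu2s) _ mW W0. exact. Qed.

(** The distance of q to phi z is at most half of 1 - |phi z|, so that
    1 - |q| lies between one half and three halves of it. *)
Lemma near_set_disc p q : near_set (p, q) ->
  [/\ disc q, 1 - N (phi (toC p)) <= 2 * (1 - N (toC q)) &
     1 - N (toC q) <= 3 / 2 * (1 - N (phi (toC p)))].
Proof.
move=> [pD H]; have h1 := phiD pD.
have {}H : N (toC q - phi (toC p)) <= (1 - N (phi (toC p))) / 2 := H.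
have t1 : N (toC q) <= N (toC q - phi (toC p)) + N (phi (toC p)).
  by rewrite -{1}(subrK (phi (toC p)) (toC q)); exact: N_triangle.
have t2 : N (phi (toC p)) <= N (toC q - phi (toC p)) + N (toC q).
  by rewrite N_distC -{1}(subrK (toC q) (phi (toC p))); exact: N_triangle.
move: H t1 t2 h1; set a := N (toC q); set b := N (phi _); set c := N _ => H t1 t2 h1.
by split; [change (a < 1)| |]; lra.
Qed.

(** The inequality [bergman_point] at phi z is multiplied by |phi' z|^2 and
    integrated over z; Tonelli's theorem then integrates over z first. *)
Lemma area_comp_kernel (f f' : C -> C) : holo f f' ->
  (area (fun z => (f (phi z) * phi' z)%R)
    <= \int[mu2]_(q in disc) ((N (f (toC q)) ^+ 2)%:E * carleson_kernel q))%E.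
Proof.
move=> hf.
pose B : RT * RT -> R := (fun q => N (f (toC q)) ^+ 2) \_ disc.
have B0 q : 0 <= B q by rewrite /B /patch; case: ifPn => // _; rewrite sqr_ge0.
have mB : measurable_fun setT B.
  apply/(measurable_restrictT _ measurable_disc).
  apply: measurable_funX.
  exact: (measurable_disc_comp (@continuous_N R) (fun z => @holo_continuous _ _ z hf)).
pose W := (fun x : (RT * RT) * (RT * RT) => (weight x.1)%:E) \_ near_set.
pose Psi (x : (RT * RT) * (RT * RT)) := ((B x.2)%:E * W x)%E.
have Psi0 x : (0 <= Psi x)%E by rewrite /Psi mule_ge0 ?lee_fin//; exact: W0.
have mPsi : measurable_fun setT Psi.
  apply: emeasurable_funM; last exact: mW.
  by apply/measurable_EFinP; exact: (measurableT_comp mB measurable_snd).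
have -> : (\int[mu2]_(q in disc) ((N (f (toC q)) ^+ 2)%:E * carleson_kernel q) =
   \int[mu2]_q \int[mu2]_p Psi (p, q))%E.
  rewrite integral_mkcond; apply: eq_integral => q _.
  transitivity ((B q)%:E * carleson_kernel q)%E.
    by rewrite /B !patchE; case: ifPn => // _; rewrite mul0e.
  have mWq : measurable_fun setT (fun p : RT * RT => W (p, q)).
    apply: (measurableT_comp mW); apply: measurable_fun_pair => //; exact: measurable_cst.
  by rewrite /carleson_kernel -(ge0_integralZl_EFin mu2 measurableT (fun p _ => W0 (p, q)) mWq).
rewrite -(fubini_tonelli (m1 := mu2s) (m2 := mu2s) Psi mPsi Psi0).
rewrite /area integral_mkcond.
apply: ge0_le_integral => //.
- by move=> p _; rewrite patchE; case: ifPn => // _; rewrite lee_fin sqr_ge0.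
- apply/(measurable_restrictT _ measurable_disc); apply/measurable_EFinP/measurable_funX.
  apply: (measurable_disc_comp (@continuous_N R) (f := fun z : C => f (phi z) * phi' z)).
  move=> z z1; apply: continuousM; last exact: cphi'.
  apply: continuous_compC; first exact: cphi.
  exact: (holo_continuous hf (phiD z1)).
- exact: (measurable_fun_fubini_tonelli_F (m2 := mu2s) _ mPsi Psi0).
move=> p _; rewrite patchE; case: ifPn => [/set_mem pD|_]; last exact: integral_ge0.
have := bergman_point hf (phiD pD).
set w := phi (toC p) => Hw.
pose Sp : set (RT * RT) := [set q | N (toC q - w) <= (1 - N w) / 2].
have SpD q : Sp q -> disc q.
  by move=> Sq; have [] := @near_set_disc p q (conj pD Sq).
have mSp : measurable Sp.
  have <- : xsection near_set p = Sp.
    apply/seteqP; split => q; rewrite /xsection /=.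
      by move=> /set_mem[].
    by move=> Sq; apply/mem_set; split.
  exact: measurable_xsection measurable_near_set.
have PsiE q : Psi (p, q) = ((weight p)%:E * ((fun q => (B q)%:E) \_ Sp) q)%E.
  rewrite /Psi /W !patchE /=.
  have -> : ((p, q) \in near_set) = (q \in Sp).
    apply/idP/idP => /set_mem h; apply/mem_set; first by case: h.
    by split.
  by case: ifPn => _; rewrite ?mule0// muleC.
under eq_integral do rewrite PsiE.
have mBE : measurable_fun setT ((fun q => (B q)%:E) \_ Sp).
  by apply/(measurable_restrictT _ mSp); apply: measurable_funTS; exact/measurable_EFinP.
rewrite ge0_integralZl_EFin//; last 2 first.
- by move=> q _; rewrite patchE; case: ifPn => // _; rewrite lee_fin.
- exact: weight_ge0.
rewrite -integral_mkcond /weight patchE mem_set//.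
set a := 128 / _; set b := N (phi' _) ^+ 2.
have -> : (N (f w * phi' (toC p)) ^+ 2)%:E = (b%:E * (N (f w) ^+ 2)%:E)%E.
  by rewrite -EFinM Normc.normcM exprMn mulrC.
have mC (J : \bar R) : ((a * b)%:E * J = b%:E * (a%:E * J))%E.
  by rewrite muleA -EFinM (mulrC a b).
rewrite mC.
apply: lee_wpmul2l; first by rewrite lee_fin sqr_ge0.
apply: (le_trans Hw); rewrite le_eqVlt; apply/orP; left; apply/eqP; congr (_ * _)%E.
by apply: eq_integral => q /set_mem Sq; rewrite /B patchE mem_set//; exact: SpD.
Qed.

End Kernel.
End Carleson.

(** * Powers of the self-map and the kernel *)

Section Bounded.
Variable R : realType.
Local Notation C := (R[i]^o).
Local Notation mu2 := (@plane_measure R).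
Local Notation RT := (measurableTypeR R).
Local Notation disc := (@disc R).

Lemma unit_discE (z : C) : unit_disc z <-> N z < 1.
Proof. by rewrite /unit_disc /= (_ : 1 = (1 : R)%:C)// N_lt_real. Qed.

Lemma disc_setE : [set p : R * R | unit_disc (Complex p.1 p.2)] = disc.
Proof. by apply/seteqP; split => p /= /unit_discE. Qed.

Lemma area_ge0 (f : C -> C) : (0 <= area f)%E.
Proof. by apply: integral_ge0 => p _; rewrite lee_fin sqr_ge0. Qed.

Lemma dirichlet_integralE (f f' : C -> C) : holo f f' ->
  dirichlet_integral f = ((pi : R)^-1%:E * area f')%E.
Proof.
move=> hf; rewrite /dirichlet_integral disc_setE; congr (_ * _)%E.
by apply: eq_integral => p /set_mem pD; have [_ ->] := is_derive1E (hf _ pD).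
Qed.

Lemma dirichlet_spaceP (f f' : C -> C) : holo f f' ->
  dirichlet_space f <-> (area f' < +oo)%E.
Proof.
move=> hf; rewrite /dirichlet_space /= (dirichlet_integralE hf).
have p0 : (0 < (pi : R)^-1) by rewrite invr_gt0 pi_gt0.
have -> : ((pi : R)^-1%:E * area f' < +oo)%E <-> (area f' < +oo)%E.
  have := area_ge0 f'; case: (area f') => [r| |]//= _; first by rewrite -EFinM !ltry.
  by rewrite gt0_muley ?lte_fin.
split=> [[]//|aoo]; split => // z /unit_discE z1.
by have [] := is_derive1E (hf _ z1).
Qed.

Lemma dirichlet_holo (f : C -> C) : dirichlet_space f -> holo f (derive1 f).
Proof. by move=> [hf _] z z1; apply: derivable_is_derive1; apply: hf; exact/unit_discE. Qed.

Lemma dirichlet_area (f : C -> C) : dirichlet_space f -> (area (derive1 f) < +oo)%E.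
Proof. by move=> fD; apply/(dirichlet_spaceP (dirichlet_holo fD)). Qed.

Lemma chain_rule (f g : C -> C) (z a b : C) :
  is_derive z 1 g b -> is_derive (g z) 1 f a -> is_derive z 1 (fun z => f (g z)) (a * b).
Proof.
move=> dg df; apply/is_derive_eps => e e0.
have A0 : 0 < N a + 1 by rewrite ltr_wpDl// N_ge0.
have B0 : 0 < N b + 1 by rewrite ltr_wpDl// N_ge0.
(* e is shared equally between the error of f, amplified by |b| + 1, and that
   of g, amplified by |a| + 1 *)
pose e1 := e / (2 * (N b + 1)).
pose e2 := Num.min 1 (e / (2 * (N a + 1))).
have e10 : 0 < e1 by rewrite divr_gt0// mulr_gt0.
have e20 : 0 < e2 by rewrite lt_min ltr01/= divr_gt0// mulr_gt0.
move: (df) => /is_derive_eps/(_ _ e10)[d1 d10 H1].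
move: (dg) => /is_derive_eps/(_ _ e20)[d2 d20 H2].
exists (Num.min d2 (d1 / (N b + 1))); first by rewrite lt_min d20 divr_gt0.
move=> h; rewrite lt_min ltr_pdivlMr// => /andP[hd2 hd1].
have k2 := H2 _ hd2.
set k := g (z + h) - g z in k2 *.
have ke : N k <= (N b + 1) * N h.
  have -> : k = (k - b * h) + b * h by rewrite subrK.
  apply: (le_trans (N_triangle _ _)); rewrite mulrDl mul1r addrC Normc.normcM.
  rewrite lerD2l; apply: (le_trans k2).
  by rewrite ler_piMl ?N_ge0// /e2 ge_min lexx.
have := H1 k; rewrite /k (addrC (g z)) subrK -/k => /(_ _)/wrap[|k1].
  by apply: (le_lt_trans ke); rewrite mulrC.
have -> : f (g (z + h)) - f (g z) - a * b * h =
  (f (g (z + h)) - f (g z) - a * k) + a * (k - b * h) by ring.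
apply: (le_trans (N_triangle _ _)).
have -> : e * N h = e1 * ((N b + 1) * N h) + (N a + 1) * (e / (2 * (N a + 1)) * N h).
  by rewrite /e1; field; rewrite !gt_eqF.
apply: lerD.
  by apply: (le_trans k1); rewrite ler_wpM2l// ltW.
rewrite Normc.normcM; apply: ler_pM; rewrite ?N_ge0//; first by rewrite lerDl.
apply: (le_trans k2); rewrite ler_wpM2r ?N_ge0// /e2 ge_min lexx orbT//.
Qed.

Definition pow' (phi phi' : C -> C) (n : nat) (z : C) : C := n%:R * phi z ^+ n.-1 * phi' z.

Lemma holo_pow (phi phi' : C -> C) n : holo phi phi' ->
  holo (fun z => phi z ^+ n) (pow' phi phi' n).
Proof.
move=> hphi z z1; have := hphi _ z1 => h.
have := @is_deriveX _ _ phi n _ _ _ h; rewrite exprfctE; exact.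
Qed.

Section Phi.
Variables (phi phi' : C -> C).
Hypothesis hphi : holo phi phi'.
Hypothesis phiD : forall z : C, N z < 1 -> N (phi z) < 1.

Lemma holo_comp (f f' : C -> C) : holo f f' -> holo (fun z => f (phi z)) (fun z => f' (phi z) * phi' z).
Proof. by move=> hf z z1; apply: chain_rule; [exact: hphi|exact/hf/phiD]. Qed.

(** An exponent n with n d > 1/8 and (n - 1) d <= 1/8: large enough for n to
    dominate a multiple of 1 / d, and small enough for (1 - 2 d)^(2 (n - 1))
    to be at least 1/2 by Bernoulli's inequality. *)
Definition boundary_exponent (d : R) : nat := (Num.truncn (8 * d)^-1).+1.

Lemma boundary_exponent_gt (d : R) : 0 < d -> (8 * d)^-1 < (boundary_exponent d)%:R.
Proof.
move=> d0; have h : 0 <= (8 * d)^-1 by rewrite invr_ge0 mulr_ge0// ltW.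
by have /andP[_] := truncn_itv h.
Qed.

Lemma boundary_exponent_le (d : R) : 0 < d -> (boundary_exponent d).-1%:R <= (8 * d)^-1.
Proof.
move=> d0; have h : 0 <= (8 * d)^-1 by rewrite invr_ge0 mulr_ge0// ltW.
by have /andP[] := truncn_itv h.
Qed.

Lemma bernoulli (x : R) (m : nat) : 0 <= x <= 1 -> 1 - m%:R * (1 - x) <= x ^+ m.
Proof.
move=> /andP[x0 x1]; elim: m => [|m IH]; first by rewrite mul0r subr0 expr0.
rewrite exprS; have := ler_wpM2l x0 IH; apply: le_trans.
rewrite -natr1.
have : 0 <= m%:R * (1 - x) ^+ 2 by rewrite mulr_ge0// sqr_ge0.
lra.
Qed.

(** For the exponent n adapted to d, 12 (1 - |phi z|) n >= 1 and
    |phi z|^(2 (n - 1)) >= 1/2, so |(phi^n)' z|^2 is at least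
    |phi' z|^2 / (288 (1 - |phi z|)^2), and 128 * 288 = 192^2. *)
Lemma weight_le (d : R) (z : C) : 0 < d -> N z < 1 ->
  1 - N (phi z) <= 2 * d -> d <= 3 / 2 * (1 - N (phi z)) ->
  128 / (1 - N (phi z)) ^+ 2 * N (phi' z) ^+ 2 <=
  192 ^+ 2 * N (pow' phi phi' (boundary_exponent d) z) ^+ 2.
Proof.
move=> d0 z1 h1 h2; set n := boundary_exponent d; set x := N (phi z) in h1 h2 *.
have x0 : 0 <= x by exact: N_ge0.
have x1 : x < 1 by exact: phiD.
have hb := @bernoulli x n.-1.*2.
have {}hb : 1 / 2 <= x ^+ n.-1.*2.
  apply: le_trans (hb _); last by rewrite x0 ltW.
  have := boundary_exponent_le d0; rewrite -/n => hn.
  have : n.-1.*2%:R * (1 - x) <= 2 * (8 * d)^-1 * (2 * d).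
    apply: ler_pM => //; first by rewrite subr_ge0 ltW.
    by rewrite -muln2 natrM mulrC ler_pM2l.
  have -> : 2 * (8 * d)^-1 * (2 * d) = 1 / 2 by field; rewrite gt_eqF.
  by move=> h; lra.
have hn := boundary_exponent_gt d0; rewrite -/n in hn.
have nn : 0 < (n%:R : R) by rewrite ltr0n.
have nd : 1 < 8 * d * n%:R.
  by rewrite -ltr_pdivrMl ?mulr_gt0// mulr1.
rewrite /pow' !Normc.normcM !exprMn.
have -> : N (n%:R : C) = n%:R by exact: N_nat.
have -> : N (phi z ^+ n.-1) ^+ 2 = x ^+ n.-1.*2 by rewrite N_exp -exprM muln2.
rewrite [X in _ <= X]mulrA ler_wpM2r ?sqr_ge0//.
have y0 : 0 < 1 - x by rewrite subr_gt0.
rewrite ler_pdivrMr ?exprn_gt0//.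
set y := 1 - x in h1 h2 y0 *; set X := x ^+ _ in hb *; set m := n%:R in nd nn *.
have k1 : 1 < 12 * y * m.
  apply: (lt_le_trans nd).
  have := ler_wpM2r (ltW nn) h2; lra.
have k2 : 1 <= (12 * y * m) ^+ 2 by rewrite expr_ge1//; lra.
have k3 : (12 * y * m) ^+ 2 * (1 / 2) <= (12 * y * m) ^+ 2 * X by rewrite ler_wpM2l ?sqr_ge0.
have -> : 192 ^+ 2 * (m ^+ 2 * X) * y ^+ 2 = 256 * ((12 * y * m) ^+ 2 * X) by ring.
lra.
Qed.

Lemma measurable_area (f f' : C -> C) : holo f f' ->
  measurable_fun disc (fun p => (N (f (toC p)) ^+ 2)%:E).
Proof.
move=> hf; apply/measurable_EFinP; apply: measurable_funX.
exact: (measurable_disc_comp (@continuous_N R) (fun z => @holo_continuous _ _ _ z hf)).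
Qed.

(** On [near_set] the integrand of the kernel at q obeys [weight_le] for
    d = 1 - |q|, with an exponent that depends on q only. *)
Lemma carleson_kernel_le_pow (q : RT * RT) : disc q ->
  (carleson_kernel phi phi' q <= (192 ^+ 2)%:E * area (pow' phi phi' (boundary_exponent (1 - N (toC q)))))%E.
Proof.
move=> qD; set n := boundary_exponent _.
have [pp hpp] := holo_derivative (holo_pow n hphi).
have mp := measurable_area hpp.
rewrite /area -(ge0_integralZl_EFin mu2 (@measurable_disc R) _ mp)//; last first.
  by move=> p _; rewrite lee_fin sqr_ge0.
rewrite [leRHS]integral_mkcond /carleson_kernel.
have d0 : 0 < 1 - N (toC q) by rewrite subr_gt0.
apply: ge0_le_integral => //.
- by move=> p _; rewrite patchE; case: ifPn => // _; rewrite lee_fin weight_ge0.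
- have mW : measurable_fun setT ((fun x : (RT * RT) * (RT * RT) => (weight phi phi' x.1)%:E) \_ (near_set phi)).
    apply/(measurable_restrictT _ (measurable_near_set hphi)).
    apply: measurable_funTS; apply/measurable_EFinP.
    exact: (measurableT_comp (measurable_weight hphi phiD) measurable_fst).
  apply: (measurableT_comp mW); apply: measurable_fun_pair => //; exact: measurable_cst.
- apply/(measurable_restrictT _ (@measurable_disc R)); exact: (measurable_funeM _ mp).
move=> p _; rewrite !patchE; case: ifPn => [/set_mem npq|_]; last first.
  by case: ifPn => // _; rewrite mule_ge0// lee_fin sqr_ge0.
have pD : disc p by case: npq.
have [_ h1 h2] := near_set_disc phiD npq.
by rewrite mem_set// /weight patchE mem_set// -EFinM lee_fin weight_le.
Qed.

Section AreaBound.
Variable K : R.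
Hypothesis K0 : 0 <= K.
Hypothesis kernelK : forall q, disc q -> (carleson_kernel phi phi' q <= K%:E)%E.

(** A bound on the kernel is a bound on the operator in the Dirichlet
    seminorm, by [area_comp_kernel] applied to f'. *)
Lemma area_comp_le (f f' : C -> C) : holo f f' ->
  (area (fun z => (f' (phi z) * phi' z)%R) <= K%:E * area f')%E.
Proof.
move=> hf; have [f'' hf'] := holo_derivative hf.
apply: (le_trans (area_comp_kernel hphi phiD hf')).
have mf := measurable_area hf'.
rewrite /area -(ge0_integralZl_EFin mu2 (@measurable_disc R) _ mf)//; last first.
  by move=> p _; rewrite lee_fin sqr_ge0.
apply: ge0_le_integral.
- exact: measurable_disc.
- by move=> p _; rewrite mule_ge0 ?lee_fin ?sqr_ge0//; exact: carleson_kernel_ge0.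
- apply: emeasurable_funM => //.
  exact: (measurable_funTS (measurable_carleson_kernel hphi phiD)).
- exact: (measurable_funeM _ mf).
move=> q qD; rewrite muleC; apply: lee_wpmul2r; first by rewrite lee_fin sqr_ge0.
exact: kernelK.
Qed.

End AreaBound.
End Phi.

(** By [bergman_point] for f', since 128 <= 12^2. *)
Lemma derivative_growth (f f' : C -> C) (a : R) (w : C) : holo f f' ->
  (area f' <= a%:E)%E -> N w < 1 -> N (f' w) <= 12 * Num.sqrt a / (1 - N w).
Proof.
move=> hf fa w1; have [f'' hf'] := holo_derivative hf.
have w0 : 0 < 1 - N w by rewrite subr_gt0.
have a0 : 0 <= a by rewrite -lee_fin (le_trans _ fa)// area_ge0.
have := bergman_point hf' w1.
set B := [set p | _]; move=> h.
have BD : B `<=` disc.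
  move=> p hB; change (N (toC p) < 1).
  have {}hB : N (toC p - w) <= (1 - N w) / 2 := hB.
  have := N_triangle (toC p - w) w; rewrite subrK.
  by set x := N (toC p); set y := N (toC p - w) in hB *; lra.
have mB : measurable B by exact: measurable_closed_ball.
have h2 : ((N (f' w) ^+ 2)%:E <= (128 / (1 - N w) ^+ 2)%:E * a%:E)%E.
  apply: (le_trans h); apply: lee_wpmul2l.
    by rewrite lee_fin divr_ge0// sqr_ge0.
  apply: le_trans fa; apply: ge0_subset_integral => //.
  - exact: measurable_disc.
  - exact: (measurable_area hf').
  - by move=> p _; rewrite lee_fin sqr_ge0.
rewrite -EFinM lee_fin in h2.
rewrite -(@ler_pXn2r _ 2)// ?nnegrE ?N_ge0//; last first.
  by apply: divr_ge0; [apply: mulr_ge0 => //; exact: sqrtr_ge0|exact: ltW].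
apply: (le_trans h2); rewrite expr_div_n exprMn sqr_sqrtr// mulrAC.
rewrite ler_wpM2r ?invr_ge0 ?sqr_ge0//; lra.
Qed.

(** The bound of [derivative_growth] is integrated along the radius. *)
Lemma value_growth (f f' : C -> C) (a : R) (w : C) : holo f f' ->
  (area f' <= a%:E)%E -> N w < 1 -> N (f w - f 0) <= 24 * Num.sqrt a / (1 - N w).
Proof.
move=> hf fa w1.
have w0 : 0 < 1 - N w by rewrite subr_gt0.
have tw (t : R) : 0 <= t <= 1 -> N (0 + t%:C * (w - 0)) <= N w.
  by move=> /andP[t0 t1]; rewrite add0r subr0 N_realM// ler_piMl// N_ge0.
have B0 : 0 <= 12 * Num.sqrt a / (1 - N w).
  by apply: divr_ge0; [apply: mulr_ge0 => //; exact: sqrtr_ge0|exact: ltW].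
have := @mean_value _ f f' 0 w (12 * Num.sqrt a / (1 - N w)).
move=> /(_ _)/wrap[|/(_ _)/wrap[|h]].
- by move=> t t01; apply: hf; exact: le_lt_trans (tw _ t01) w1.
- move=> t t01; have tw1 := tw _ t01.
  apply: (le_trans (derivative_growth hf fa (le_lt_trans tw1 w1))).
  apply: ler_wpM2l; first by apply: mulr_ge0 => //; exact: sqrtr_ge0.
  by rewrite lef_pV2 ?posrE ?subr_gt0//; [rewrite lerD2l lerN2|exact: le_lt_trans tw1 w1].
apply: (le_trans h); rewrite subr0.
apply: (@le_trans _ _ (2 * (12 * Num.sqrt a / (1 - N w)))).
  by apply: ler_piMr; [exact: mulr_ge0|exact: ltW].
by rewrite le_eqVlt; apply/orP; left; apply/eqP; ring.
Qed.

End Bounded.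

(** * Bounded composition operators *)

Section BoundedOperators.
Variable R : realType.
Local Notation C := (R[i]^o).
Local Notation disc := (@disc R).

Lemma dirichlet_normE (f f' : C -> C) (a : R) : holo f f' -> area f' = a%:E ->
  dirichlet_norm f = Num.sqrt (N (f 0) ^+ 2 + (pi : R)^-1 * a).
Proof. by move=> hf fa; rewrite /dirichlet_norm (dirichlet_integralE hf) fa -EFinM. Qed.

Lemma area_fin (f' : C -> C) (a : R) : (area f' <= a%:E)%E ->
  exists2 b : R, area f' = b%:E & 0 <= b <= a.
Proof.
have := area_ge0 f'; case: (area f') => [b| |]//.
by rewrite !lee_fin => b0 ba; exists b => //; rewrite b0.
Qed.

Lemma N0_lt1 : N (0 : C) < 1.
Proof. by rewrite Normc.normc0. Qed.

Section Phi.
Variables (phi phi' : C -> C).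
Hypothesis hphi : holo phi phi'.
Hypothesis phiD : forall z : C, N z < 1 -> N (phi z) < 1.

Lemma carleson_kernel_bound (M : R) :
  (forall n, (0 < n)%N -> (area (pow' phi phi' n) <= M%:E)%E) ->
  forall q, disc q -> (carleson_kernel phi phi' q <= (192 ^+ 2 * M)%:E)%E.
Proof.
move=> aM q qD; apply: (le_trans (carleson_kernel_le_pow hphi phiD qD)).
rewrite (EFinM (192 ^+ 2) M); apply: lee_wpmul2l; first by rewrite lee_fin sqr_ge0.
exact: aM.
Qed.

(** The Dirichlet seminorm is controlled by [area_comp_le], and the value at
    0 of f o phi, that is f (phi 0), by [value_growth]. *)
Lemma bounded_composition (K : R) : 0 <= K ->
  (forall q, disc q -> (carleson_kernel phi phi' q <= K%:E)%E) ->
  bounded_on_dirichlet (composition_operator phi).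
Proof.
move=> K0 kK.
have p0 : 0 < (pi : R) := pi_gt0 R.
have area_comp_fin (f : C -> C) : dirichlet_space f -> exists2 a : R, area (derive1 f) = a%:E &
    exists2 b : R, area (fun z => derive1 f (phi z) * phi' z) = b%:E & 0 <= a /\ 0 <= b <= K * a.
  move=> fD; have hf := dirichlet_holo fD.
  have := dirichlet_area fD; have := area_ge0 (derive1 f).
  have := area_comp_le hphi phiD K0 kK hf.
  case: (area (derive1 f)) => [a| |]// ab a0 _; exists a => //.
  rewrite -EFinM in ab; have [b bE bb] := area_fin ab.
  by exists b => //; split.
split=> [f fD|].
  have [a aE [b bE _]] := area_comp_fin _ fD.
  apply/(dirichlet_spaceP (holo_comp hphi phiD (dirichlet_holo fD))).
  by rewrite bE ltry.
have w1 : N (phi 0) < 1 by apply: phiD; exact: N0_lt1.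
have w0 : 0 < 1 - N (phi 0) by rewrite subr_gt0.
(* with c the constant of [value_growth] at phi 0, the square of |f (phi 0)|
   is at most 2 |f 0|^2 + 2 c^2 a, and a is pi times the Dirichlet integral *)
pose c := 24 / (1 - N (phi 0)).
pose M2 := 2 + 2 * c ^+ 2 * pi + K.
exists (Num.sqrt M2) => f fD.
have hf := dirichlet_holo fD.
have [a aE [b bE [a0 /andP[b0 ba]]]] := area_comp_fin _ fD.
rewrite (dirichlet_normE hf aE) (dirichlet_normE (holo_comp hphi phiD hf) bE).
have c0 : 0 <= 2 * c ^+ 2 * pi by apply: mulr_ge0; [apply: mulr_ge0 => //; exact: sqr_ge0|exact: ltW].
have M20 : 0 <= M2 by rewrite /M2; apply: addr_ge0 => //; exact: addr_ge0.
rewrite -sqrtrM// ler_sqrt; last first.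
  apply: mulr_ge0 => //; apply: addr_ge0; first exact: sqr_ge0.
  by apply: mulr_ge0 => //; rewrite invr_ge0 ltW.
have g : N (f (phi 0)) <= N (f 0) + c * Num.sqrt a.
  have -> : f (phi 0) = (f (phi 0) - f 0) + f 0 by rewrite subrK.
  apply: (le_trans (N_triangle _ _)); rewrite addrC lerD2l.
  have aE' : (area (derive1 (f : C -> C)) <= a%:E)%E by rewrite aE.
  by have := value_growth hf aE' w1; rewrite /c mulrAC.
have g2 : N (f (phi 0)) ^+ 2 <= 2 * N (f 0) ^+ 2 + 2 * c ^+ 2 * a.
  have g' : N (f (phi 0)) ^+ 2 <= (N (f 0) + c * Num.sqrt a) ^+ 2.
    by rewrite ler_pXn2r// nnegrE ?N_ge0// (le_trans _ g)// N_ge0.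
  apply: (le_trans g'); have := sqr_sqrtr a0.
  set s := Num.sqrt a; set x := N (f 0) => <-.
  have := sqr_ge0 (x - c * s); lra.
pose al := pi^-1 * a.
have al0 : 0 <= al by rewrite /al; apply: mulr_ge0 => //; rewrite invr_ge0 ltW.
have aal : a = pi * al by rewrite /al mulrA mulfV ?mul1r// gt_eqF.
have bal : pi^-1 * b <= K * al.
  by rewrite /al mulrCA ler_wpM2l// invr_ge0 ltW.
rewrite -/al; apply: (@le_trans _ _ (2 * N (f 0) ^+ 2 + 2 * c ^+ 2 * pi * al + K * al)).
  have aE2 : 2 * c ^+ 2 * pi * al = 2 * c ^+ 2 * a by rewrite -mulrA -aal.
  by rewrite aE2; apply: lerD; [exact: g2|exact: bal].
rewrite /M2; set x2 := N (f 0) ^+ 2; set cc := 2 * c ^+ 2 * pi in c0 *.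
have x20 : 0 <= x2 by rewrite sqr_ge0.
have h1 : 0 <= cc * x2 by rewrite mulr_ge0.
have h2 : 0 <= K * x2 by rewrite mulr_ge0.
lra.
Qed.

End Phi.
End BoundedOperators.

(** * Limits of holomorphic functions along an ultrafilter *)

Section Ultralimit.
Variable R : realType.
Local Notation C := (R[i]^o).
Variable U : set_system nat.
Hypothesis UU : UltraFilter U.

Let UF : ProperFilter U := @ultra_proper _ _ UU.

(** A cluster point of an ultrafilter is a limit: a neighbourhood of it or its
    complement belongs to the ultrafilter. *)
Lemma ultralimit_real (x : nat -> R) (M : R) : (forall n, `|x n| <= M) ->
  exists l : R, forall e : R, 0 < e -> \forall n \near U, `|x n - l| <= e.
Proof.
move=> xM.
have cM : compact `[- M, M]%classic by exact: segment_compact.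
have xU : (x @ U) `[- M, M]%classic.
  change (U [set n | x n \in `[- M, M]%R]).
  by apply: filterE => n /=; rewrite in_itv/= -ler_norml; exact: xM.
have [l [_ cl]] := cM (x @ U) _ xU.
exists l => e e0.
have [//|nU] := in_ultra_setVsetC [set n | `|x n - l| <= e] UU.
have nl : nbhs l [set y | `|y - l| <= e].
  by apply: (@cvgr_distC_le _ _ _ (nbhs l) _ id l) => //; exact: cvg_id.
have xn : (x @ U) [set y | ~ (`|y - l| <= e)] by exact: nU.
by have [y [h1 h2]] := cl _ _ xn nl.
Qed.

Lemma ultralimit (c : nat -> C) (M : R) : (forall n, N (c n) <= M) ->
  exists l : C, c @ U --> l.
Proof.
move=> cM.
have [a aP] := @ultralimit_real (fun n => cRe (c n)) M (fun n => le_trans (Re_le_N _) (cM n)).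
have [b bP] := @ultralimit_real (fun n => cIm (c n)) M (fun n => le_trans (Im_le_N _) (cM n)).
exists (Complex a b); apply/cvgN_le => e e0.
have e20 : 0 < e / 2 by rewrite divr_gt0.
apply: filterS2 (aP _ e20) (bP _ e20) => n ha hb.
apply: (le_trans (N_le_ReIm _)); rewrite ReB ImB /=.
by apply: (le_trans (lerD ha hb)); lra.
Qed.

Lemma ultralimit_le (c : nat -> C) (l : C) (M : R) : c @ U --> l ->
  (forall n, N (c n) <= M) -> N l <= M.
Proof.
move=> cl cM; apply/ler_addgt0Pr => e e0.
move: cl => /cvgN_le /(_ _ e0) /filter_ex[n hn].
have -> : l = (l - c n) + c n by rewrite subrK.
apply: (le_trans (N_triangle _ _)); rewrite addrC N_distC; exact: lerD.
Qed.

Section Family.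
Variables (f f' : nat -> C -> C) (A0 a : R).
Hypothesis hf : forall n, holo (f n) (f' n).
Hypothesis f0 : forall n, N (f n 0) <= A0.
Hypothesis fa : forall n, (area (f' n) <= a%:E)%E.

(** The constant of [derivative_growth]: |f' n w| <= A / (1 - |w|). *)
Let A : R := 12 * Num.sqrt a.

Let A_ge0 : 0 <= A.
Proof. by rewrite /A mulr_ge0// sqrtr_ge0. Qed.

Let r (w : C) := (1 - N w) / 4.

Let ballD (w z : C) (k : R) : k <= 4 -> N w < 1 -> N (z - w) < k * r w -> N z < 1 - (4 - k) * r w.
Proof.
move=> k4 w1 zw; have -> : z = (z - w) + w by rewrite subrK.
apply: (le_lt_trans (N_triangle _ _)).
have -> : 1 - (4 - k) * r w = k * r w + N w by rewrite /r; lra.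
by rewrite ltrD2r.
Qed.

(** A Lipschitz constant, from Cauchy's estimate for f' n on discs of radius
    proportional to r w. *)
Let L (w : C) := 2 * (4 * (A / r w) / r w).

Let r_gt0 w : N w < 1 -> 0 < r w.
Proof. by move=> w1; rewrite /r divr_gt0// subr_gt0. Qed.

Let L_ge0 w : N w < 1 -> 0 <= L w.
Proof.
move=> w1; have r0 := ltW (r_gt0 w1).
by rewrite /L; apply: mulr_ge0 => //; apply: divr_ge0 => //; apply: mulr_ge0 => //; exact: divr_ge0.
Qed.

(** Cauchy's estimate for f' n, which is bounded independently of n by
    [derivative_growth], bounds the second derivatives. *)
Lemma family_lipschitz (w : C) : N w < 1 -> forall n (z z' : C),
  N (z - w) < r w -> N (z' - w) < r w -> N (f' n z - f' n z') <= L w * N (z - z').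
Proof.
move=> w1 n z z' zw z'w; have r0 := r_gt0 w1.
have [f'' hf'] := holo_derivative (hf n).
have f''b (y : C) : N (y - w) < r w -> N (f'' y) <= 4 * (A / r w) / r w.
  move=> yw; apply: (@cauchy_estimate R (f' n) f'' y (3 * r w) (r w) r0 _ _ (A / r w)).
  - by rewrite ltr_pM2r// ltr_nat.
  - move=> u uy; apply: hf'.
    have uw : N (u - w) < 4 * r w.
      have -> : u - w = (u - y) + (y - w) by rewrite addrA subrK.
      by apply: (le_lt_trans (N_triangle _ _)); have := ltrD uy yw; lra.
    by have := ballD (lexx 4) w1 uw; rewrite subrr mul0r subr0.
  - move=> u uy.
    have uw : N (u - w) < 3 * r w.
      have -> : u - w = (u - y) + (y - w) by rewrite addrA subrK.
      by apply: (le_lt_trans (N_triangle _ _)); have := ler_ltD uy yw; lra.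
    have u1 : N u < 1 - (4 - 3) * r w by apply: ballD => //; rewrite ler_nat.
    have u1' : r w < 1 - N u by lra.
    have uD : N u < 1 by lra.
    apply: (le_trans (derivative_growth (hf n) (fa n) uD)).
    by rewrite -/A ler_wpM2l// lef_pV2 ?posrE// ?ltW//; lra.
have dball (y : C) : N (y - w) < r w -> is_derive y 1 (f' n) (f'' y).
  move=> yw; apply: hf'.
  have y4 : N (y - w) < 4 * r w by lra.
  by have := ballD (lexx 4) w1 y4; rewrite subrr mul0r subr0.
exact: (mean_value_ball dball f''b z'w zw).
Qed.

Let f'_bound (w : C) n : N w < 1 -> N (f' n w) <= A / (1 - N w).
Proof. by move=> w1; exact: derivative_growth (hf n) (fa n) w1. Qed.

Let f_bound (w : C) n : N w < 1 -> N (f n w) <= A0 + 24 * Num.sqrt a / (1 - N w).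
Proof.
move=> w1; have -> : f n w = (f n w - f n 0) + f n 0 by rewrite subrK.
apply: (le_trans (N_triangle _ _)); rewrite addrC; apply: lerD => //.
exact: value_growth (hf n) (fa n) w1.
Qed.

(** The Taylor bounds of the f n at w have a remainder independent of n, so
    they pass to the pointwise limits. *)
Lemma limit_function : exists F G : C -> C,
  [/\ forall z, N z < 1 -> (fun n => f n z) @ U --> F z,
      forall z, N z < 1 -> (fun n => f' n z) @ U --> G z & holo F G].
Proof.
have HF (z : C) : exists l : C, N z < 1 -> (fun n => f n z) @ U --> l.
  have [z1|z1] := pselect (N z < 1); last by exists 0.
  by have [l lP] := ultralimit (fun n => f_bound n z1); exists l.
have HG (z : C) : exists l : C, N z < 1 -> (fun n => f' n z) @ U --> l.
  have [z1|z1] := pselect (N z < 1); last by exists 0.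
  by have [l lP] := ultralimit (fun n => f'_bound n z1); exists l.
have [F FP] := choice HF; have [G GP] := choice HG.
exists F, G; split; [exact: FP|exact: GP|].
move=> w w1; have r0 := r_gt0 w1.
have key (h : C) : N h < r w -> N (F (w + h) - F w - G w * h) <= 2 * L w * N h ^+ 2.
  move=> hr.
  have wh1 : N (w + h) < 1.
    have h4 : N (w + h - w) < 4 * r w by rewrite addrAC subrr add0r; lra.
    by have := ballD (lexx 4) w1 h4; rewrite subrr mul0r subr0.
  apply: (@ultralimit_le (fun n => f n (w + h) - f n w - f' n w * h)).
    apply: cvgB; first by apply: cvgB; [exact: FP|exact: FP].
    by apply: cvgM; [exact: GP|exact: cvg_cst].
  move=> n; apply: (@taylor_bound R (f n) (f' n) w (r w) (L w) w h (L_ge0 w1)).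
  - move=> y yw; apply: hf.
    have y4 : N (y - w) < 4 * r w by lra.
    by have := ballD (lexx 4) w1 y4; rewrite subrr mul0r subr0.
  - exact: family_lipschitz.
  - by rewrite subrr Normc.normc0.
  - by rewrite addrAC subrr add0r.
apply/is_derive_eps => e e0.
have Lp : 0 < 2 * L w + 1 by have := L_ge0 w1; lra.
exists (Num.min (r w) (e / (2 * L w + 1))); first by rewrite lt_min r0 divr_gt0.
move=> h; rewrite lt_min => /andP[h1]; rewrite (ltr_pdivlMr _ _ Lp) => h2.
apply: (le_trans (key _ h1)); rewrite expr2 mulrA ler_wpM2r ?N_ge0//.
by apply: le_trans (ltW h2); rewrite mulrC ler_wpM2l ?N_ge0//; lra.
Qed.

(** Pointwise convergence together with a Lipschitz bound independent of n is
    uniform near each point; the closed disc of radius rho is compact. *)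
Lemma limit_uniform (G : C -> C) (rho e : R) : rho < 1 -> 0 < e ->
  (forall z, N z < 1 -> (fun n => f' n z) @ U --> G z) ->
  \forall n \near U, forall z : C, N z <= rho -> N (f' n z - G z) <= e.
Proof.
move=> rho1 e0 GP.
have Glip (w z : C) : N w < 1 -> N (z - w) < r w -> N (G z - G w) <= L w * N (z - w).
  move=> w1 zw; have r0 := r_gt0 w1.
  have z1 : N z < 1.
    have z4 : N (z - w) < 4 * r w by lra.
    by have := ballD (lexx 4) w1 z4; rewrite subrr mul0r subr0.
  apply: (@ultralimit_le (fun n => f' n z - f' n w)).
    by apply: cvgB; [exact: GP|exact: GP].
  by move=> n; apply: family_lipschitz => //; rewrite subrr Normc.normc0.
pose K : set (R * R) := [set p | N (toC p) <= rho].
have cK : compact K.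
  have cB : compact (`[-1, 1]%classic `*` `[-1, 1]%classic : set (R * R)).
    by apply: compact_setX; exact: segment_compact.
  apply: (subclosed_compact _ cB).
    have -> : K = (fun p : R * R => N (toC p)) @^-1` [set x | x <= rho] by [].
    by apply: closed_comp; [move=> p _; exact: cont_N_toC|exact: closed_le].
  move=> p Kp; have h : N (toC p) <= 1 by apply: le_trans (ltW rho1).
  split; rewrite /= in_itv/= -ler_norml.
    exact: le_trans (Re_le_N (toC p)) h.
  exact: le_trans (Im_le_N (toC p)) h.
have := (compact_near_coveringP K).1 cK nat U (fun n p => N (f' n (toC p) - G (toC p)) <= e) UF.
move=> /(_ _)/wrap[|H].
  move=> p Kp; pose w := toC p.
  have w1 : N w < 1 by apply: le_lt_trans rho1.
  have r0 := r_gt0 w1; have L0 := L_ge0 w1.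
  have Lp : 0 < 2 * L w + 1 by lra.
  have e2 : 0 < e / 2 by rewrite divr_gt0.
  pose dl := Num.min (r w) (e / 2 / (2 * L w + 1)).
  have dl0 : 0 < dl by rewrite lt_min r0 divr_gt0.
  have nb : nbhs p [set p' : R * R | N (toC p' - w) < dl].
    have : nbhs (toC p : C) [set z | N (z - w) < dl].
      by apply/nbhs_N; exists dl.
    exact: (@continuous_toC R p).
  have nU : U [set n | N (f' n w - G w) <= e / 2].
    by move: (GP _ w1) => /cvgN_le; apply.
  (* within dl of w both f' n and G vary by at most e / 4, as the Lipschitz
     constants are independent of n *)
  exists ([set p' : R * R | N (toC p' - w) < dl], [set n | N (f' n w - G w) <= e / 2]) => //.
  move=> [p' n] [h1 h2]; pose z := toC p'; change (N (f' n z - G z) <= e).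
  have {}h2 : N (f' n w - G w) <= e / 2 := h2.
  have {h1} : N (z - w) < dl := h1.
  rewrite lt_min => /andP[h1]; rewrite (ltr_pdivlMr _ _ Lp) => h3.
  have -> : f' n z - G z = (f' n z - f' n w) + (f' n w - G w) - (G z - G w) by ring.
  apply: (le_trans (N_triangle _ _)); rewrite normcN.
  have t1 := N_triangle (f' n z - f' n w) (f' n w - G w).
  have t2 : N (f' n z - f' n w) <= L w * N (z - w).
    by apply: family_lipschitz => //; rewrite subrr Normc.normc0.
  have t3 := Glip _ _ w1 h1.
  have t4 : 2 * (L w * N (z - w)) <= e / 2.
    by have := N_ge0 (z - w); lra.
  have := lerD t1 t3.
  move: h2 t2 t4; set x1 := N _; set x2 := L w * _; set x3 := N (f' n z - f' n w).
  by set x4 := N (_ + _); set x5 := N (G z - G w); lra.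
apply: filterS H => n H z zr.
have zE : toC (cRe z, cIm z) = z by case: z {zr}.
have HK : K (cRe z, cIm z) by rewrite /K; change (N (toC (cRe z, cIm z)) <= rho); rewrite zE.
have {}H : N (f' n (toC (cRe z, cIm z)) - G (toC (cRe z, cIm z))) <= e := H _ HK.
by rewrite zE in H.
Qed.

End Family.
End Ultralimit.

(** * Compact composition operators *)

Section Compact.
Variable R : realType.
Local Notation C := (R[i]^o).
Local Notation mu := (@lebesgue_measure R).
Local Notation mu2 := (@plane_measure R).
Local Notation RT := (measurableTypeR R).
Local Notation disc := (@disc R).

Lemma plane_measure_disc : (mu2 disc <= 4%:E)%E.
Proof.
pose B : set (RT * RT) := `[(-1)%R, 1%R]%classic `*` `[(-1)%R, 1%R]%classic.
have mB : measurable B by apply: measurableX; exact: measurable_itv.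
have dB : disc `<=` B.
  move=> p pD; have h : N (toC p) <= 1 by exact: ltW.
  split; rewrite /= in_itv/= -ler_norml.
    exact: le_trans (Re_le_N (toC p)) h.
  exact: le_trans (Im_le_N (toC p)) h.
apply: (@le_trans _ _ (mu2 B)).
  by apply: le_measure => //; rewrite inE//; exact: measurable_disc.
rewrite /B /plane_measure product_measure1E; [|exact: measurable_itv|exact: measurable_itv].
have e : mu `[(-1)%R, 1%R]%classic = 2%:E.
  rewrite lebesgue_measure_itv/= lte_fin.
  have -> : -1 < 1 :> R by lra.
  by rewrite -EFinB; congr EFin; lra.
change (mu `[(-1)%R, 1%R]%classic * mu `[(-1)%R, 1%R]%classic <= 4%:E)%E.
by rewrite e -EFinM lee_fin; lra.
Qed.

Lemma area_le_pointwise (g h : C -> C) (gg hh : C -> C) (D : set (RT * RT)) (a b : R) :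
  measurable D -> D `<=` disc -> holo g gg -> holo h hh -> 0 <= a -> 0 <= b ->
  (forall p, D p -> N (g (toC p)) ^+ 2 <= a * N (h (toC p)) ^+ 2 + b) ->
  (\int[mu2]_(p in D) (N (g (toC p)) ^+ 2)%:E <= a%:E * area h + (b * 4)%:E)%E.
Proof.
move=> mD DD hg hh' a0 b0 gh.
have mg : measurable_fun D (fun p => (N (g (toC p)) ^+ 2)%:E).
  exact: (measurable_funS (@measurable_disc R) DD (measurable_area hg)).
have mh := measurable_area hh'.
have mah : measurable_fun disc (fun p => (a%:E * (N (h (toC p)) ^+ 2)%:E)%E).
  exact: (measurable_funeM _ mh).
have z1 p : (0 <= a%:E * (N (h (toC p)) ^+ 2)%:E)%E.
  by apply: mule_ge0; rewrite lee_fin// sqr_ge0.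
have z2 : (0 <= b%:E)%E by rewrite lee_fin.
apply: (@le_trans _ _ (\int[mu2]_(p in disc) (a%:E * (N (h (toC p)) ^+ 2)%:E + cst b%:E p))%E).
  apply: (@le_trans _ _ (\int[mu2]_(p in D) (a%:E * (N (h (toC p)) ^+ 2)%:E + cst b%:E p))%E).
    apply: ge0_le_integral => //.
    - by move=> p _; rewrite lee_fin sqr_ge0.
    - apply: (measurable_funS (@measurable_disc R) DD).
      by apply: emeasurable_funD => //; exact: measurable_cst.
  apply: ge0_subset_integral => //.
  - exact: measurable_disc.
  - by apply: emeasurable_funD => //; exact: measurable_cst.
  - by move=> p _; apply: adde_ge0 => //; exact: z1.
have m1 := @measurable_disc R.
rewrite (ge0_integralD mu2 m1 (fun p _ => z1 p) mah (fun p _ => z2) (measurable_cst _)).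
apply: leeD.
  have s0 p : disc p -> (0 <= (N (h (toC p)) ^+ 2)%:E)%E by rewrite lee_fin sqr_ge0.
  by rewrite (ge0_integralZl_EFin mu2 m1 s0 mh a0).
rewrite integral_cst; last exact: measurable_disc.
by rewrite EFinM; apply: lee_wpmul2l => //; exact: plane_measure_disc.
Qed.

Lemma N_sqr_sum (x y : C) : N (x + y) ^+ 2 <= 2 * N x ^+ 2 + 2 * N y ^+ 2.
Proof.
have h : N (x + y) ^+ 2 <= (N x + N y) ^+ 2.
  by rewrite ler_pXn2r ?nnegrE ?addr_ge0 ?N_ge0// N_triangle.
by apply: (le_trans h); have := sqr_ge0 (N x - N y); lra.
Qed.

Lemma holoB (f g ff gg : C -> C) : holo f ff -> holo g gg ->
  holo (fun z => f z - g z) (fun z => ff z - gg z).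
Proof.
by move=> hf hg z z1; exact: (@is_deriveB _ _ _ f g _ _ _ _ (hf z z1) (hg z z1)).
Qed.

Lemma area_subr (f g ff gg : C -> C) (a b : R) : holo f ff -> holo g gg ->
  (area f <= a%:E)%E -> (area g <= b%:E)%E ->
  (area (fun z => (f z - g z)%R) <= (2 * a + 2 * b)%:E)%E.
Proof.
move=> hf hg fa gb.
have mD := @measurable_disc R.
have mf := measurable_area hf; have mg := measurable_area hg.
have hfg := holoB hf hg.
have mfg := measurable_area hfg.
have s0 (k : C -> C) p : disc p -> (0 <= (N (k (toC p)) ^+ 2)%:E)%E.
  by rewrite lee_fin sqr_ge0.
have z2 (k : C -> C) p : disc p -> (0 <= 2%:E * (N (k (toC p)) ^+ 2)%:E)%E.
  by move=> _; apply: mule_ge0; rewrite lee_fin// sqr_ge0.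
have m2f : measurable_fun disc (fun p => (2%:E * (N (f (toC p)) ^+ 2)%:E)%E) by exact: (measurable_funeM _ mf).
have m2g : measurable_fun disc (fun p => (2%:E * (N (g (toC p)) ^+ 2)%:E)%E) by exact: (measurable_funeM _ mg).
apply: (@le_trans _ _ (\int[mu2]_(p in disc) (2%:E * (N (f (toC p)) ^+ 2)%:E + 2%:E * (N (g (toC p)) ^+ 2)%:E))%E).
  apply: ge0_le_integral.
  - exact: mD.
  - exact: (s0 (fun z => f z - g z)).
  - exact: mfg.
  - exact: emeasurable_funD.
  - move=> p _; rewrite -!EFinM -EFinD lee_fin.
    by apply: (le_trans (N_sqr_sum _ _)); rewrite normcN.
rewrite (ge0_integralD mu2 mD (z2 f) m2f (z2 g) m2g) (EFinD (2 * a)) (EFinM 2 a) (EFinM 2 b).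
have h2 : 0 <= (2 : R) by [].
rewrite (ge0_integralZl_EFin mu2 mD (s0 f) mf h2) (ge0_integralZl_EFin mu2 mD (s0 g) mg h2).
by apply: leeD; apply: lee_wpmul2l.
Qed.

(** On the disc of radius rho < 1 the function G is within 1 of some g, hence
    |G|^2 <= 2 |g|^2 + 2; monotone convergence lets rho tend to 1. *)
Lemma area_limit_le (G G' : C -> C) (a : R) : holo G G' -> 0 <= a ->
  (forall rho : R, rho < 1 -> exists g g' : C -> C, [/\ holo g g', (area g <= a%:E)%E &
     forall z, N z <= rho -> N (g z - G z) <= 1]) ->
  (area G <= (2 * a + 8)%:E)%E.
Proof.
move=> hG a0 H.
pose rho (k : nat) : R := 1 - k.+1%:R^-1.
pose D (k : nat) : set (RT * RT) := [set p | N (toC p) <= rho k].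
have rho1 k : rho k < 1 by rewrite /rho ltrBlDr ltrDl invr_gt0.
have DD k : D k `<=` disc.
  by move=> p Dp; apply: le_lt_trans (rho1 k).
have mD k : measurable (D k).
  have -> : D k = [set p | N (toC p - 0) <= rho k].
    by apply/funext => p; rewrite /D /mkset subr0.
  exact: measurable_closed_ball.
have nD : nondecreasing_seq D.
  move=> k m km; apply/subsetPset => p Dp; apply: (le_trans (Dp : N (toC p) <= rho k)).
  by rewrite /rho lerD2l lerN2 lef_pV2 ?posrE// ler_nat.
have UD : \bigcup_k D k = disc.
  apply/seteqP; split => [p [k _ /DD]//|p pD].
  have d0 : 0 < 1 - N (toC p) by rewrite subr_gt0.
  exists (Num.truncn (1 - N (toC p))^-1) => //.
  have h : 0 <= (1 - N (toC p))^-1 by rewrite invr_ge0 ltW.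
  have /andP[_ ht] := truncn_itv h.
  change (N (toC p) <= 1 - (Num.truncn (1 - N (toC p))^-1).+1%:R^-1).
  rewrite lerBrDr addrC -lerBrDr -[leRHS]invrK lef_pV2 ?posrE ?invr_gt0//.
  exact: ltW.
have mG := measurable_area hG.
have G0 k (p : RT * RT) : D k p -> (0 <= (N (G (toC p)) ^+ 2)%:E)%E.
  by move=> _; rewrite lee_fin sqr_ge0.
have cv := @ge0_nondecreasing_set_cvg_integral _ _ _ D (fun p => (N (G (toC p)) ^+ 2)%:E) mu2 nD mD
  (fun k => measurable_funS (@measurable_disc R) (DD k) mG) G0.
rewrite UD in cv; apply: (cvge_le _ cv); apply: nearW => k.
have [g [g' [hg ga gG]]] := H _ (rho1 k).
apply: (le_trans (@area_le_pointwise G g _ _ (D k) 2 2 (mD k) (DD k) hG hg _ _ _)) => //.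
  move=> p Dp; have -> : G (toC p) = g (toC p) + - (g (toC p) - G (toC p)) by ring.
  apply: (le_trans (N_sqr_sum _ _)); rewrite lerD2l normcN.
  have h1 := gG _ Dp; have h0 := N_ge0 (g (toC p) - G (toC p)).
  by rewrite -[leRHS]mulr1 ler_pM2l// expr_le1.
rewrite (EFinD (2 * a)); apply: leeD; last by rewrite lee_fin; lra.
by rewrite (EFinM 2 a); apply: lee_wpmul2l.
Qed.

Section Phi.
Variables (phi phi' : C -> C).
Hypothesis hphi : holo phi phi'.
Hypothesis phiD : forall z : C, N z < 1 -> N (phi z) < 1.
Variable K : R.
Hypothesis K0 : 0 <= K.
Hypothesis kernelK : forall q, disc q -> (carleson_kernel phi phi' q <= K%:E)%E.

(** In [area_comp_kernel], |h' q|^2 is at most e^2 and the kernel at most K for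
    |q| <= rho, while the kernel is at most eps elsewhere; the disc has area
    at most 4. *)
Lemma area_comp_small (h h' : C -> C) (rho e eps a : R) : holo h h' -> 0 <= e -> 0 <= eps ->
  (area h' <= a%:E)%E ->
  (forall z, N z <= rho -> N (h' z) <= e) ->
  (forall q, disc q -> rho < N (toC q) -> (carleson_kernel phi phi' q <= eps%:E)%E) ->
  (area (fun z => (h' (phi z) * phi' z)%R) <= (eps * a + e ^+ 2 * K * 4)%:E)%E.
Proof.
move=> hh e0 eps0 ha he heps; have [h'' hh'] := holo_derivative hh.
apply: (le_trans (area_comp_kernel hphi phiD hh')).
have mh := measurable_area hh'.
have mD := @measurable_disc R.
have z1 p : (0 <= eps%:E * (N (h' (toC p)) ^+ 2)%:E)%E.
  by apply: mule_ge0; rewrite lee_fin// sqr_ge0.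
have b0 : 0 <= e ^+ 2 * K by apply: mulr_ge0 => //; exact: sqr_ge0.
have z2 : (0 <= (e ^+ 2 * K)%:E)%E by rewrite lee_fin.
have mah : measurable_fun disc (fun p => (eps%:E * (N (h' (toC p)) ^+ 2)%:E)%E).
  exact: (measurable_funeM _ mh).
apply: (@le_trans _ _ (\int[mu2]_(p in disc) (eps%:E * (N (h' (toC p)) ^+ 2)%:E + cst (e ^+ 2 * K)%:E p))%E).
  apply: ge0_le_integral => //.
  - by move=> q _; apply: mule_ge0; [rewrite lee_fin sqr_ge0|exact: carleson_kernel_ge0].
  - apply: emeasurable_funM => //.
    exact: (measurable_funTS (measurable_carleson_kernel hphi phiD)).
  - by apply: emeasurable_funD => //; exact: measurable_cst.
  move=> q qD; rewrite /cst.
  have [qr|qr] := leP (N (toC q)) rho.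
    apply: (@le_trans _ _ (e ^+ 2 * K)%:E); last by rewrite leeDr.
    rewrite (EFinM (e ^+ 2) K); apply: lee_pmul.
    - by rewrite lee_fin sqr_ge0.
    - exact: carleson_kernel_ge0.
    - by rewrite lee_fin ler_pXn2r ?nnegrE ?N_ge0// he.
    - exact: kernelK.
  apply: (@le_trans _ _ (eps%:E * (N (h' (toC q)) ^+ 2)%:E)%E); last by rewrite leeDl.
  rewrite muleC; apply: lee_wpmul2r; first by rewrite lee_fin sqr_ge0.
  exact: heps.
rewrite (ge0_integralD mu2 mD (fun p _ => z1 p) mah (fun p _ => z2) (measurable_cst _)).
rewrite (EFinD (eps * a)); apply: leeD.
  have s0 p : disc p -> (0 <= (N (h' (toC p)) ^+ 2)%:E)%E by rewrite lee_fin sqr_ge0.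
  by rewrite (ge0_integralZl_EFin mu2 mD s0 mh eps0) (EFinM eps a); apply: lee_wpmul2l.
rewrite integral_cst; last exact: measurable_disc.
by rewrite (EFinM (e ^+ 2 * K)); apply: lee_wpmul2l => //; exact: plane_measure_disc.
Qed.

(** The exponent of [carleson_kernel_le_pow] tends to infinity as q tends to
    the unit circle. *)
Lemma carleson_kernel_tail (eps : R) : 0 < eps ->
  (forall e : R, 0 < e -> exists n0, forall n, (n0 <= n)%N -> (area (pow' phi phi' n) <= e%:E)%E) ->
  exists2 rho : R, rho < 1 & forall q, disc q -> rho < N (toC q) ->
    (carleson_kernel phi phi' q <= eps%:E)%E.
Proof.
move=> eps0 H.
have c0 : 0 < (192 ^+ 2 : R) by rewrite exprn_gt0.
have [n0 n0P] := H (eps / 192 ^+ 2) (divr_gt0 eps0 c0).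
have k0 : 0 < (8 * n0.+1%:R : R) by rewrite mulr_gt0.
exists (1 - (8 * n0.+1%:R)^-1); first by rewrite ltrBlDr ltrDl invr_gt0.
move=> q qD hq.
have d0 : 0 < 1 - N (toC q) by rewrite subr_gt0.
apply: (le_trans (carleson_kernel_le_pow hphi phiD qD)).
set n := boundary_exponent _.
have hn : (n0 <= n)%N.
  apply: ltnW; rewrite -(ltr_nat R); apply: lt_trans (boundary_exponent_gt d0).
  have d1 : 8 * (1 - N (toC q)) < n0.+1%:R^-1.
    have : 1 - N (toC q) < (8 * n0.+1%:R)^-1 by rewrite ltrBlDr addrC -ltrBlDr.
    by rewrite invfM -ltr_pdivrMl ?invr_gt0// invrK.
  have n00 : 0 < (n0.+1%:R : R) by rewrite ltr0n.
  apply: (@lt_trans _ _ n0.+1%:R); first by rewrite ltr_nat.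
  by rewrite -[ltLHS]invrK ltf_pV2 ?posrE ?invr_gt0// mulr_gt0.
apply: (@le_trans _ _ ((192 ^+ 2)%:E * (eps / 192 ^+ 2)%:E)%E).
  by apply: lee_wpmul2l; [rewrite lee_fin sqr_ge0|exact: n0P].
by rewrite -EFinM lee_fin mulrC divfK// gt_eqF.
Qed.

(** A bounded sequence has a holomorphic limit along an ultrafilter by
    [limit_function], of finite Dirichlet integral by [area_limit_le].  The
    hypotheses of [area_comp_small] hold for the differences, by
    [limit_uniform] for |q| <= rho and by [carleson_kernel_tail] beyond. *)
Lemma compact_composition :
  (forall e : R, 0 < e -> exists n0, forall n, (n0 <= n)%N -> (area (pow' phi phi' n) <= e%:E)%E) ->
  compact_on_dirichlet (composition_operator phi).
Proof.
move=> Hlim; split; first by have [] := bounded_composition hphi phiD K0 kernelK.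
move=> f fD [M fM].
have p0 : 0 < (pi : R) := pi_gt0 R.
have p1 : (pi : R)^-1 <= 1 by rewrite invf_le1//; have := pi_ge2 R; lra.
pose f' n : C -> C := derive1 (f n : C -> C).
have hf n : holo (f n) (f' n) := dirichlet_holo (fD n).
have M0 : 0 <= M by apply: le_trans (fM 0%N); rewrite sqrtr_ge0.
have normM n : N (f n 0) ^+ 2 + pi^-1 * fine (area (f' n)) <= M ^+ 2.
  have fin : area (f' n) = (fine (area (f' n)))%:E.
    by rewrite fineK// ge0_fin_numE ?area_ge0//; exact: dirichlet_area (fD n).
  have a0 : 0 <= fine (area (f' n)) by rewrite fine_ge0// area_ge0.
  have := fM n; rewrite (dirichlet_normE (hf n) fin).
  rewrite -(@ler_pXn2r _ 2)// ?nnegrE ?sqrtr_ge0// sqr_sqrtr//.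
  by apply: addr_ge0; [exact: sqr_ge0|apply: mulr_ge0 => //; rewrite invr_ge0 ltW].
have f0 n : N (f n 0) <= M.
  rewrite -(@ler_pXn2r _ 2)// ?nnegrE ?N_ge0//.
  apply: le_trans (normM n); rewrite lerDl; apply: mulr_ge0; first by rewrite invr_ge0 ltW.
  by rewrite fine_ge0// area_ge0.
pose a := pi * M ^+ 2.
have a0 : 0 <= a by apply: mulr_ge0; [exact: ltW|exact: sqr_ge0].
have fa n : (area (f' n) <= a%:E)%E.
  have fin : area (f' n) = (fine (area (f' n)))%:E.
    by rewrite fineK// ge0_fin_numE ?area_ge0//; exact: dirichlet_area (fD n).
  rewrite fin lee_fin /a -ler_pdivrMl//.
  by apply: le_trans (normM n); rewrite lerDr sqr_ge0.
(* limits along U exist for every bounded sequence, and the members of U are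
   infinite sets of indices *)
have [U [UU subU]] := @ultraFilterLemma nat (nbhs \oo) _.
have UF : ProperFilter U := @ultra_proper _ _ UU.
have [F [G [FP GP hF]]] := limit_function UU hf f0 fa.
have unif (rho e : R) : rho < 1 -> 0 < e ->
  \forall n \near U, forall z : C, N z <= rho -> N (f' n z - G z) <= e.
  by move=> rho1 e0; exact: (limit_uniform UU hf fa rho1 e0 GP).
have [G' hG] := holo_derivative hF.
have aG : (area G <= (2 * a + 8)%:E)%E.
  apply: (area_limit_le hG a0) => rho rho1.
  have /filter_ex[n nP] := unif rho 1 rho1 ltr01.
  have [f'' hf'] := holo_derivative (hf n).
  by exists (f' n), f''; split => //; exact: fa.
have FD : dirichlet_space F.
  by apply/(dirichlet_spaceP hF); apply: le_lt_trans aG _; rewrite ltry.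
have TD : dirichlet_space (composition_operator phi F).
  by have [TB _] := bounded_composition hphi phiD K0 kernelK; exact: TB.
pose h n : C -> C := fun z => f n z - F z.
pose h' n : C -> C := fun z => f' n z - G z.
have hh n : holo (h n) (h' n) := holoB (hf n) hF.
pose a2 : R := 2 * a + 2 * (2 * a + 8).
have ah n : (area (h' n) <= a2%:E)%E.
  by have [f'' hf'] := holo_derivative (hf n); exact: (area_subr hf' hG (fa n) aG).
have small (dl : R) : 0 < dl -> \forall n \near U,
   dirichlet_norm (composition_operator phi (f n) \- composition_operator phi F) <= dl.
  move=> dl0.
  have a20 : 0 <= a2 by rewrite /a2; lra.
  have a21 : 0 < 4 * (a2 + 1) by lra.
  have dl20 : 0 < dl ^+ 2 by rewrite exprn_gt0.
  (* eps and e make each of the two terms of [area_comp_small] at most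
     dl^2 / 4; the value at 0 contributes another dl^2 / 4 *)
  pose eps := dl ^+ 2 / (4 * (a2 + 1)).
  have eps0 : 0 < eps by exact: divr_gt0.
  have epsa : eps * a2 <= dl ^+ 2 / 4.
    have -> : dl ^+ 2 / 4 = eps * (a2 + 1).
      by rewrite /eps; field; rewrite gt_eqF//; lra.
    by rewrite ler_wpM2l ?(ltW eps0)//; lra.
  have K10 : 0 < 4 * (K + 1) by have := K0; lra.
  pose e := dl / (4 * (K + 1)).
  have e0 : 0 < e by exact: divr_gt0.
  have eK : e ^+ 2 * K * 4 <= dl ^+ 2 / 4.
    have -> : dl ^+ 2 / 4 = e ^+ 2 * (K + 1) ^+ 2 * 4.
      by rewrite /e; field; rewrite gt_eqF//; lra.
    have KK : K <= (K + 1) ^+ 2 by have := K0; nra.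
    by rewrite ler_pM2r// ler_wpM2l// sqr_ge0.
  have [rho rho1 tail] := carleson_kernel_tail eps0 Hlim.
  have w1 : N (phi 0) < 1 by apply: phiD; exact: N0_lt1.
  have dl2 : 0 < dl / 2 by rewrite divr_gt0.
  have ev0 : \forall n \near U, N (h n (phi 0)) <= dl / 2.
    by move: (FP _ w1) => /cvgN_le/(_ _ dl2).
  apply: filterS2 ev0 (unif _ _ rho1 e0) => n hn0 hne.
  have ab := area_comp_small (hh n) (ltW e0) (ltW eps0) (ah n) hne tail.
  have [b bE /andP[b0 bb]] := area_fin ab.
  rewrite (dirichlet_normE (holo_comp hphi phiD (hh n)) bE).
  rewrite -(@ler_pXn2r _ 2)// ?nnegrE ?sqrtr_ge0 ?(ltW dl0)//.
  have pb0 : 0 <= pi^-1 * b by apply: mulr_ge0 => //; rewrite invr_ge0 ltW.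
  rewrite sqr_sqrtr; last by apply: addr_ge0 => //; exact: sqr_ge0.
  have pb : pi^-1 * b <= b by rewrite ler_piMl.
  have x2 : N (h n (phi 0)) ^+ 2 <= (dl / 2) ^+ 2.
    by rewrite ler_pXn2r// nnegrE ?N_ge0// ltW.
  have -> : dl ^+ 2 = (dl / 2) ^+ 2 + (dl ^+ 2 / 4 + dl ^+ 2 / 4 + dl ^+ 2 / 4) by field.
  apply: lerD => //; apply: (le_trans pb); apply: (le_trans bb).
  have d40 : 0 <= dl ^+ 2 / 4 by rewrite divr_ge0// ltW.
  by apply: (le_trans (lerD epsa eK)); rewrite lerDl.
(* small events belong to U, hence contain indices beyond any m: a
   subsequence along which the norms tend to 0 is chosen step by step *)
have infU (m j : nat) : exists n, (m < n)%N /\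
   dirichlet_norm (composition_operator phi (f n) \- composition_operator phi F) <= j.+1%:R^-1.
  have j0 : 0 < (j.+1%:R^-1 : R) by rewrite invr_gt0.
  have mU : U [set n | (m < n)%N] by apply: subU; exact: nbhs_infty_gt.
  by have [n [n1 n2]] := @filter_ex _ U UF _ (filterI mU (small _ j0)); exists n.
have [s sP] := choice (fun x : nat * nat => infU x.1 x.2).
pose k := fix k j := if j is j'.+1 then s (k j', j) else s (0%N, 0%N).
exists k, (composition_operator phi F); split => //.
  apply: homo_ltn => [|j]; first exact: ltn_trans.
  by have [] := sP (k j, j.+1).
apply/cvgrPdist_le => e e0.
have : \forall j \near \oo, (j.+1%:R^-1 : R) <= e.
  near=> j; have ej : e^-1 <= j%:R by near: j; exact: nbhs_infty_ger.
  by rewrite -[leRHS]invrK lef_pV2 ?posrE ?invr_gt0// (le_trans ej)// ler_nat.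
apply: filterS => j; rewrite sub0r normrN ger0_norm ?sqrtr_ge0//; apply: le_trans.
by case: j => [|j]; [have [] := sP (0%N, 0%N)|have [] := sP (k j, j.+1)].
Unshelve. all: by end_near. Qed.

End Phi.
End Compact.

(** * Dirichlet integrals of powers *)

Section PowerBounds.
Variable R : realType.
Local Notation C := (R[i]^o).
Variables (phi phi' : C -> C).
Hypothesis hphi : holo phi phi'.
Hypothesis phiD : forall z : C, N z < 1 -> N (phi z) < 1.

Lemma area_pow_le (b : R) n : 0 <= b ->
  (dirichlet_integral (fun z => (phi z ^+ n)%R) <= b%:E)%E ->
  (area (pow' phi phi' n) <= (pi * b)%:E)%E.
Proof.
move=> b0; rewrite (dirichlet_integralE (holo_pow n hphi)) => h.
have p0 : 0 < (pi : R) := pi_gt0 R.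
have := @lee_wpmul2l R pi%:E _ _ _ h; rewrite lee_fin => /(_ (ltW p0)).
by rewrite muleA -EFinM mulfV ?gt_eqF// mul1e -EFinM.
Qed.

(** As |phi| <= 1, any single power of phi has a finite Dirichlet integral:
    this covers the exponents about which a limit says nothing. *)
Lemma area_pow_base (a : R) n : (area phi' <= a%:E)%E ->
  (area (pow' phi phi' n) <= (n%:R ^+ 2 * a)%:E)%E.
Proof.
move=> ha.
have [pp hp] := holo_derivative hphi.
have [pq hq] := holo_derivative (holo_pow n hphi).
have := @area_le_pointwise R (pow' phi phi' n) phi' _ _ (@disc R) (n%:R ^+ 2) 0
  (@measurable_disc R) (fun _ x => x) hq hp (sqr_ge0 _) (lexx 0).
rewrite mul0r adde0 => /(_ _)/wrap[|h].
  move=> p pD; rewrite addr0 /pow' !Normc.normcM !exprMn.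
  have -> : N (n%:R : C) = n%:R by exact: N_nat.
  rewrite ler_wpM2r ?sqr_ge0// -[leRHS]mulr1 ler_wpM2l ?sqr_ge0//.
  have NX k : N (phi (toC p) ^+ k) <= 1.
    by rewrite N_exp exprn_ile1 ?N_ge0// ltW// phiD.
  by rewrite expr_le1// N_ge0.
apply: (le_trans h); rewrite (EFinM (n%:R ^+ 2) a); apply: lee_wpmul2l => //.
Qed.

End PowerBounds.

Theorem corollary2p3 (R : realType) (phi : R[i] -> R[i])
  (phi_disc : forall z : R[i], unit_disc z -> unit_disc (phi z))
  (phi_dirichlet : dirichlet_space phi) :
  ((ereal_sup [set dirichlet_integral (fun z => (phi z ^+ n)%R)
              | n in [set n : nat | (1 <= n)%N]] < +oo)%E ->
   bounded_on_dirichlet (composition_operator phi)) /\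
  (dirichlet_integral (fun z => (phi z ^+ n)%R) @[n --> \oo] --> (0 : \bar R)%E ->
   compact_on_dirichlet (composition_operator phi)).
Proof.
have hphi := dirichlet_holo phi_dirichlet.
set phi' := derive1 _ in hphi.
have phiD (z : R[i]^o) : N z < 1 -> N (phi z) < 1.
  by move=> /unit_discE/phi_disc/unit_discE.
have p0 : 0 < (pi : R) := pi_gt0 R.
split=> [supoo|lim0].
  set S := ereal_sup _ in supoo.
  have leS n : (0 < n)%N -> (dirichlet_integral (fun z => (phi z ^+ n)%R) <= S)%E.
    by move=> n0; apply: ereal_sup_ubound; exists n.
  have S0 : (0 <= S)%E.
    apply: le_trans (leS 1%N isT).
    rewrite (dirichlet_integralE (holo_pow 1 hphi)).
    by apply: mule_ge0; [rewrite lee_fin invr_ge0 ltW|exact: area_ge0].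
  have S_fin : S \is a fin_num by rewrite ge0_fin_numE.
  pose s : R := fine S.
  have sE : S = s%:E by rewrite fineK.
  have s0 : 0 <= s by apply: fine_ge0.
  apply: (@bounded_composition R phi phi' hphi phiD (192 ^+ 2 * (pi * s))).
    by apply: mulr_ge0; [exact: sqr_ge0|apply: mulr_ge0 => //; exact: ltW].
  apply: (carleson_kernel_bound hphi phiD) => n n0.
  by apply: (area_pow_le hphi) => //; rewrite -sE; exact: leS.
have lim_area (e : R) : 0 < e -> exists n0, forall n, (n0 <= n)%N -> (area (pow' phi phi' n) <= e%:E)%E.
  move=> e0; have ep : 0 < e / pi by rewrite divr_gt0.
  have nb : nbhs (0%:E : \bar R) [set x | (x <= (e / pi)%:E)%E].
    apply/nbhs_EFin; apply/nbhs_ballP; exists (e / pi) => // x /=.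
    by rewrite /ball /= sub0r normrN lee_fin => /ltW; apply: le_trans; exact: ler_norm.
  have [n0 _ Hn] := lim0 _ nb.
  exists n0 => n n0n; have := area_pow_le hphi (ltW ep) (Hn n n0n).
  by rewrite mulrC divfK// gt_eqF.
have [n0 n0P] := lim_area 1 ltr01.
have [a aE] : exists a : R, area phi' = a%:E.
  have := dirichlet_area phi_dirichlet; have := area_ge0 phi'.
  by rewrite -/phi'; case: (area phi') => [a| |]// _ _; exists a.
have a0 : 0 <= a by rewrite -lee_fin -aE area_ge0.
(* 1 bounds the areas from n0 on, and [area_pow_base] those before n0 *)
pose M : R := Num.max 1 (n0%:R ^+ 2 * a).
have M0 : 0 <= M by rewrite le_max ler01.
apply: (@compact_composition R phi phi' hphi phiD (192 ^+ 2 * M)) => //.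
  by rewrite mulr_ge0 ?sqr_ge0.
apply: (carleson_kernel_bound hphi phiD) => n _.
have [nn|nn] := leqP n0 n.
  by apply: (le_trans (n0P _ nn)); rewrite lee_fin le_max lexx.
have aE' : (area phi' <= a%:E)%E by rewrite aE.
apply: (le_trans (area_pow_base hphi phiD n aE')); rewrite lee_fin le_max; apply/orP; right.
by rewrite ler_wpM2r// ler_pXn2r ?nnegrE ?ler0n// ler_nat ltnW.
Qed.
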